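(* Let $0<L\le U$ and $\gamma\in\mathbb{R}$. For each dimension $d$ let $\alpha_{\uparrow}>1$ and $0<\alpha_{\downarrow}<1$ be given (they may depend on $d$). Let $q^{\mathrm{low}}$ and $q^{\mathrm{high}}$ be constants independent of $d$ with $q^{\mathrm{low}}\in\left(\Phi(-\sqrt{2/\pi}),\frac12\right)$ and $q^{\mathrm{high}}\in\left(\Phi\left(\frac{\alpha_{\downarrow}}{\alpha_{\uparrow}}\Phi^{-1}(q^{\mathrm{low}})\right),\frac12\right)$, and suppose that $\alpha_{\uparrow},\alpha_{\downarrow}$ are set so that $q^{\mathrm{low}}<p_{\mathrm{target}}<q^{\mathrm{high}}$ for all $d$. Then there exists $D>3$ such that for any $d\ge D$: (i) (A2) is satisfied under (A1), i.e. every $f:\mathbb{R}^d\to\mathbb{R}$ satisfying (A1) also satisfies (A2); (ii) $q^{\mathrm{low}}\in I_q$ and $q^{\mathrm{high}}\in I_q^{\mathrm{high}}(q^{\mathrm{low}})$ (for every $f\in\mathcal{S}_{d,L,U}$); and (iii) the following holds: $$\lim_{d\to\infty}\left\{\inf_{h\in\mathcal{P}^{\gamma}_{d,L,U}}\left\{\frac{B^{\mathrm{upper}}_{d,L,U}}{\min\left\{\frac{L}{E_{\mathcal{Q}}},\log\left(\frac{\alpha_{\uparrow}}{\alpha_{\downarrow}}\right)\right\}}\right\}\right\}\in(0,\infty),$$ where $B^{\mathrm{upper}}_{d,L,U}$ and $E_{\mathcal{Q}}$ are computed from $f\in\mathcal{S}_{d,L,U}$ with $h\in\mathcal{T}^{\gamma}(f)$.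 Moreover, $\frac{L}{E_{\mathcal{Q}}}\ge\frac{L}{dU}$; and if $h\in\mathcal{T}^{\gamma}(f)$ for $f(x)=\frac12x^{\mathrm T}Hx$, where $H$ is a symmetric matrix whose eigenvalues are bounded in $[L,U]$, then $\frac{L}{E_{\mathcal{Q}}}=\frac{L}{\mathrm{Tr}(H)}$.
   Context: **Notation.** $\Phi$ is the standard normal cdf. $p_{\mathrm{target}}=\log(1/\alpha_{\downarrow})/\log(\alpha_{\uparrow}/\alpha_{\downarrow})$. $\Theta_0=\{\theta=(m,\log\sigma): m\in\mathbb{R}^d\setminus\{0\},\sigma>0\}$. **Quantities attached to $f:\mathbb{R}^d\to\mathbb{R}$.** For $z\sim\mathcal{N}(0,I)$ in $\mathbb{R}^d$ and $\theta\in\Theta_0$: $\mathcal{Q}_z(\theta)=\frac{2}{\sigma^2}(f(m+\sigma z)-f(m)-\langle\nabla f(m),\sigma z\rangle)$, $z_e=\langle z,\nabla f(m)\rangle/\|\nabla f(m)\|$, $\mathcal{V}_{\mathrm{std}}(\theta)=\mathrm{Var}[\mathcal{Q}_z(\theta)]/(\mathbb{E}[\mathcal{Q}_z(\theta)])^2$ (expectation over $z$, $\theta$ fixed), $\kappa_{\inf}=\inf_{\theta\in\Theta_0}\mathbb{E}[\mathcal{Q}_z(\theta)]/\mathbb{E}[\mathcal{Q}_z(\theta)\mathbb{1}\{z_e\le0\}]$ (which is $\ge1$), $E_{\mathcal{Q}}=\sup_{\theta\in\Theta_0}\mathbb{E}[\mathcal{Q}_z(\theta)]$. **Function classes.** (A1)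 $f$ is measurable, continuously differentiable, $L$-strongly convex and $U$-Lipschitz smooth on $\mathbb{R}^d$, i.e. $f(x)+\langle y-x,\nabla f(x)\rangle+\frac L2\|x-y\|^2\le f(y)\le f(x)+\langle y-x,\nabla f(x)\rangle+\frac U2\|x-y\|^2$ for all $x,y$, and its unique global minimum is at the origin with $f(0)=0$. (A2) $\sup_{\theta\in\Theta_0}\mathcal{V}_{\mathrm{std}}(\theta)<\frac14\min\{\Phi(\frac{\kappa_{\inf}}2\cdot\frac1{\sqrt{2\pi}})-\frac12,\ 1-\Phi(\frac{\kappa_{\inf}}2\cdot\frac3{\sqrt{2\pi}})\}$. $\mathcal{S}_{d,L,U}$ is the set of $f$ satisfying (A1) and (A2). $\mathcal{T}^{\gamma}(f)$ is the set of all $h:\mathbb{R}^d\to\mathbb{R}$ with a unique global minimum $x^{\mathrm{opt}}\in\mathbb{R}^d$ that can be expressed as $h(x)=g(f(x-x^{\mathrm{opt}}))$ for all $x$ with $h(x)\le\gamma$, where $g:\mathbb{R}\to\mathbb{R}$ is strictly increasing. $\mathcal{P}^{\gamma}_{d,L,U}=\bigcup_{f\in\mathcal{S}_{d,L,U}}\mathcal{T}^{\gamma}(f)$. **Thresholds.** For $q\in(0,\frac12)$, $B_\theta^{\mathrm{high}}(q)=\sup_{\epsilon>\sqrt{2\mathcal{V}_{\mathrm{std}}(\theta)/(1-2q)}}\frac{2\Phi^{-1}(1-(q+\mathcal{V}_{\mathrm{std}}(\theta)/\epsilon^2))}{1+\epsilon}$; for $q\in(\mathcal{V}_{\mathrm{std}}(\theta),\frac12)$,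 $B_\theta^{\mathrm{low}}(q)=\inf_{\epsilon\in(\sqrt{\mathcal{V}_{\mathrm{std}}(\theta)/q},1)}\frac{2\Phi^{-1}(1-(q-\mathcal{V}_{\mathrm{std}}(\theta)/\epsilon^2))}{1-\epsilon}$. $B_{\inf}^{\mathrm{high}}(q)=\inf_{\theta\in\Theta_0}B_\theta^{\mathrm{high}}(q)$, $B_{\sup}^{\mathrm{low}}(q)=\sup_{\theta\in\Theta_0}B_\theta^{\mathrm{low}}(q)$. Below, $q$ ranges over the points of $(0,\frac12)$ at which the functions involved are defined, and $I_q$, $I_q^{\mathrm{high}}(q')$ are open subintervals of $(0,\frac12)$: $I_q=\left(\max\left\{\sup_{\theta\in\Theta_0}\mathcal{V}_{\mathrm{std}}(\theta),\ \sup\{q:\kappa_{\inf}\sqrt{2/\pi}\le B_{\sup}^{\mathrm{low}}(q)\}\right\},\frac12\right)$; $I_q^{\mathrm{high}}(q')=\left(\sup_{\theta\in\Theta_0}\sup\{q: B_\theta^{\mathrm{low}}(q')\le\frac{\alpha_{\uparrow}}{\alpha_{\downarrow}}B_\theta^{\mathrm{high}}(q)\},\frac12\right)$ for $q'\in I_q$; $Q(q')=\inf\{q:B_{\inf}^{\mathrm{high}}(q)<B_{\sup}^{\mathrm{low}}(q')\}$; $w(q',q'')=\frac{L}{E_{\mathcal{Q}}}\cdot\frac{B_{\inf}^{\mathrm{high}}(q'')}{\kappa_{\inf}}\cdot\left(\sqrt{\tfrac2\pi}\,\kappa_{\inf}-B_{\sup}^{\mathrm{low}}(q')\right)\cdot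 Q(q')$; $$B^{\mathrm{upper}}_{d,L,U}=\frac12\sup_{q',q''}\min\left\{\frac{w(q',q'')}4,\log\frac{\alpha_{\uparrow}}{\alpha_{\downarrow}}\right\}\min\{p_{\mathrm{target}}-q',q''-p_{\mathrm{target}}\},$$ the supremum being over $q'\in I_q$, $q''\in I_q^{\mathrm{high}}(q')$ with $q'<p_{\mathrm{target}}<q''$. ($\exp(-B^{\mathrm{upper}}_{d,L,U})$ is an upper bound on the upper convergence rate of the (1+1)-ES with step-size factors $\alpha_{\uparrow},\alpha_{\downarrow}$.)
   Formalization: In (iii) the limit need not exist if the factors oscillate with d; proved instead: liminf > 0 and limsup < ∞ always, and the limit exists in (0,∞) if p_target and log(α↑/α↓) converge and d·log(α↑/α↓) converges in [0,∞]. *)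

(* Defs.v *)
From HB Require Import structures.
From mathcomp Require Import all_boot all_order all_algebra.
From mathcomp Require Import all_classical all_reals all_analysis.

Set Implicit Arguments.
Unset Strict Implicit.
Unset Printing Implicit Defensive.

Import Order.TTheory GRing.Theory Num.Def Num.Theory.
Import numFieldNormedType.Exports.

Local Open Scope classical_set_scope.
Local Open Scope ring_scope.

(** The standard Gaussian measure N(0, I) on d-tuples of reals, as the d-fold
    product of N(0, 1): [gauss d.+1] is the image of N(0, 1) \x [gauss d] under
    [(x, t) |-> x :: t]. *)
Section gaussian.
Context {R : realType}.
Local Notation RM := (measurableTypeR R).

Definition cons_pair (n : nat) (u : RM * n.-tuple RM) : n.+1.-tuple RM :=
  [the n.+1.-tuple RM of u.1 :: u.2].

Lemma measurable_cons_pair (n : nat) :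
  measurable_fun [set: RM * n.-tuple RM] (@cons_pair n).
Proof. exact: measurable_cons. Qed.

HB.instance Definition _ (n : nat) :=
  isMeasurableFun.Build _ _ _ _ (@cons_pair n) (@measurable_cons_pair n).

Definition std_normal : probability RM R := normal_prob 0 1.

Fixpoint gauss (d : nat) : probability (d.-tuple RM) R :=
  match d return probability (d.-tuple RM) R with
  | 0 => \d_([tuple] : 0.-tuple RM)
  | n.+1 => distribution ((std_normal \x gauss n)%E : probability _ R)
              (@cons_pair n)
  end.

Definition vec {d : nat} (t : d.-tuple RM) : 'rV[R]_d := \row_i tnth t i.

(** Standard normal cdf. [Phi_inv] is its inverse on ]0, 1[ (0 elsewhere). *)
Definition Phi (x : R) : R := fine (std_normal `]-oo, x]%classic).
Definition Phi_inv (p : R) : R := xget 0 [set x | Phi x = p].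

End gaussian.

Section euclidean.
Context {R : realType} {d : nat}.
Implicit Types (x y : 'rV[R]_d) (f h : 'rV[R]_d -> R).

(** The library norm on ['rV[R]_d] is the sup norm, whence [enorm]; both induce
    the same topology, so differentiability and continuity are the library's. *)
Definition dot x y : R := \sum_i x 0 i * y 0 i.
Definition enorm x : R := Num.sqrt (dot x x).
Definition grad f x : 'rV[R]_d := \row_i 'D_(delta_mx 0 i) f x.

Definition global_min f x := forall y, f x <= f y.
Definition unique_global_min f x :=
  global_min f x /\ forall y, global_min f y -> y = x.

(** Borel measurability, through the identification of R^d with d-tuples. *)
Definition borel_fun f :=
  measurable_fun [set: d.-tuple (measurableTypeR R)] (f \o vec).

Definition A1 (L U : R) f :=
  [/\ borel_fun f,
      (forall x, differentiable f x) /\ continuous (grad f),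
      forall x y,
        f x + dot (y - x) (grad f x) + L / 2 * enorm (x - y) ^+ 2 <= f y
        /\ f y <= f x + dot (y - x) (grad f x) + U / 2 * enorm (x - y) ^+ 2,
      unique_global_min f 0 &
      f 0 = 0].

(** A state is [(m, log sigma)]. *)
Definition state : Type := ('rV[R]_d * R)%type.
Definition mean (th : state) : 'rV[R]_d := th.1.
Definition sigma (th : state) : R := expR th.2.
Definition Theta0 : set state := [set th | mean th != 0].

Section quantities.
Variable f : 'rV[R]_d -> R.
Local Notation sample := (d.-tuple (measurableTypeR R)).
Local Notation G := (@gauss R d).

Definition Qz (th : state) (t : sample) : R :=
  2 / sigma th ^+ 2 *
  (f (mean th + sigma th *: vec t) - f (mean th)
   - dot (grad f (mean th)) (sigma th *: vec t)).

Definition z_e (th : state) (t : sample) : R :=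
  dot (vec t) (grad f (mean th)) / enorm (grad f (mean th)).

(** Under [A1] one has L |z|^2 <= Qz <= U |z|^2, so the expectations and the
    variance are finite and [fine] loses nothing.  For d > 0 and f satisfying
    [A1], every real [sup] and [inf] below is over a nonempty bounded set
    at the arguments of interest, with these exceptions: for a set of q's in ]0, 1/2[
    the value sup set0 = 0 is the intended one; the set of [B_upper] can be
    empty in low dimension; and [Bsup_low] is over an unbounded set at
    q = V_sup when V_sup is not attained, a point that cannot affect [I_q]
    because of the maximum with V_sup. *)
Definition EQz (th : state) : R := fine 'E_G[Qz th].
Definition EQz_neg (th : state) : R :=
  fine 'E_G[fun t => Qz th t * \1_[set t | z_e th t <= 0] t].
Definition V_std (th : state) : R := fine 'V_G[Qz th] / EQz th ^+ 2.

Definition kappa_inf : R := inf [set EQz th / EQz_neg th | th in Theta0].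
Definition E_Q : R := sup [set EQz th | th in Theta0].
Definition V_sup : R := sup [set V_std th | th in Theta0].

Definition A2 :=
  V_sup < 4^-1 * Num.min
    (Phi (kappa_inf / 2 * (1 / Num.sqrt (2 * pi))) - 2^-1)
    (1 - Phi (kappa_inf / 2 * (3 / Num.sqrt (2 * pi)))).

Definition B_high (th : state) (q : R) : R :=
  sup [set 2 * Phi_inv (1 - (q + V_std th / e ^+ 2)) / (1 + e) | e in
       [set e | Num.sqrt (2 * V_std th / (1 - 2 * q)) < e]].

Definition B_low (th : state) (q : R) : R :=
  inf [set 2 * Phi_inv (1 - (q - V_std th / e ^+ 2)) / (1 - e) | e in
       [set e | Num.sqrt (V_std th / q) < e < 1]].

Definition Binf_high (q : R) : R := inf [set B_high th q | th in Theta0].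
Definition Bsup_low (q : R) : R := sup [set B_low th q | th in Theta0].

(** The q's at which [Bsup_low] is defined. *)
Definition dom_low : set R :=
  [set q | 0 < q < 2^-1 /\ forall th, Theta0 th -> V_std th < q].

Definition I_q : set R :=
  `]Num.max V_sup
      (sup [set q | dom_low q /\ kappa_inf * Num.sqrt (2 / pi) <= Bsup_low q]),
    2^-1[%classic.

Definition Q_of (q' : R) : R :=
  inf [set q | 0 < q < 2^-1 /\ Binf_high q < Bsup_low q'].

Section step_size.
Variables (L au ad : R). (* au, ad : step-size factors, 0 < ad < 1 < au *)

Definition I_high (q' : R) : set R :=
  `]sup [set sup [set q | 0 < q < 2^-1 /\
                          B_low th q' <= au / ad * B_high th q]
        | th in Theta0], 2^-1[%classic.

Definition w (q' q'' : R) : R :=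
  L / E_Q * (Binf_high q'' / kappa_inf)
  * (Num.sqrt (2 / pi) * kappa_inf - Bsup_low q') * Q_of q'.

Definition p_target : R := ln (1 / ad) / ln (au / ad).

Definition B_upper : R :=
  2^-1 * sup [set r | exists q' q'',
    [/\ I_q q', I_high q' q'', q' < p_target < q'' &
        r = Num.min (w q' q'' / 4) (ln (au / ad))
            * Num.min (p_target - q') (q'' - p_target)]].

End step_size.
End quantities.

Definition S_class (L U : R) f := A1 L U f /\ A2 f.

Definition T_class (gamma : R) f h :=
  exists xopt, unique_global_min h xopt /\
    exists g : R -> R, {homo g : a b / a < b} /\
      forall x, h x <= gamma -> h x = g (f (x - xopt)).

End euclidean.

Arguments S_class {R} d L U f.

(** The infimum over h in P^gamma_{d,L,U}, h being taken together with each
    f in S_{d,L,U} such that h is in T^gamma(f). *)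
Definition inf_ratio {R : realType} (d : nat) (L U gamma au ad : R) : \bar R :=
  ereal_inf [set r | exists f h : 'rV[R]_d -> R,
    [/\ S_class d L U f, T_class gamma f h &
        r = (B_upper f L au ad
             / Num.min (L / E_Q f) (ln (au / ad)))%:E]].

(* Main.v *)
Require Import Defs.
From mathcomp Require Import all_boot all_order all_algebra.
From mathcomp Require Import all_classical all_reals all_analysis.
From mathcomp Require Import measurable_realfun ring lra.

(** Everything rests on the concentration of the quadratic remainder [Qz f th] in
    high dimension.  By (A1) it lies between [L |z|^2] and [U |z|^2], so its mean is
    at least [L d], and its gradient in [z] has squared norm at most [4 U^2 |z|^2].
    A Poincare inequality for the Gaussian measure ([poincare_gauss]), obtained by
    tensorization from independent copies, bounds its variance by [o(d^2)].
    Hence [V_std] tends to [0], uniformly in the function and in the state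
    ([V_std_small]).

    When [V_std] is small the other quantities are close to ideal values that no
    longer depend on [f].  A half-space through the origin has probability [1/2],
    so [kappa_inf] is close to [2] by Cauchy-Schwarz ([EQz_neg_close]).  Both
    thresholds at [q] are close to [2 Psi q], where [Psi q] is the upper quantile
    [Phi^-1(1 - q)] ([thresholds_uniform]).  (A2) follows, as its right-hand side is
    positive for [kappa_inf = 2].  Membership in [I_q] becomes
    [Psi q' < sqrt (2 / pi)], and membership in [I_high q'] becomes
    [au / ad * Psi q'' < Psi q'].  These are the hypotheses on [qlow] and [qhigh].  The
    second one leaves no margin uniform in [d], but [B_low >= 2 Psi] and
    [B_high <= 2 Psi] hold exactly, so none is needed ([I_high_intro]).

    For the limit, write [w = L / E_Q * w_factor].  The normalized bound is then half
    the supremum of [trunc (w_factor / 4) s * margin], where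
    [s = ln (au / ad) / (L / E_Q)], and [w_factor] is close to an explicit function of
    [Psi q'] and [Psi q''].  A fixed interior pair bounds it away from [0]
    ([ratio_lower]).  The infima over the class form a Cauchy sequence: a competitor
    in dimension [m] is compared with the isotropic quadratic in dimension [n] that
    has the same value of [E_Q] per dimension ([matching_quadratic]), and a feasible
    pair for one, slightly contracted in upper-quantile coordinates, is feasible
    for the other with almost the same value ([comparison]).  The scales [s] of the
    two problems are [n ln (au / ad)] and [m ln (au / ad)], each with the step-size
    factors of its dimension, times a common constant in [[1, U / L]].  Whether
    [d ln (au / ad)] tends to [0], to a positive number or to infinity, they end up
    equivalent for the truncation ([compatible_eventually]).

    Finally [E_Q <= U d] because [|z|^2] has mean [d], and a quadratic form has its
    trace as mean because the coordinates of [z] are uncorrelated with unit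
    variance ([EQz_quad]). *)

Import Order.TTheory GRing.Theory Num.Def Num.Theory.
Import numFieldNormedType.Exports.
Set Implicit Arguments.
Unset Strict Implicit.
Unset Printing Implicit Defensive.
Local Open Scope classical_set_scope.
Local Open Scope ring_scope.

(** * Gaussian integrals on the line *)

Section normal.
Context {R : realType}.
Local Notation RM := (measurableTypeR R).
Local Notation mu := (@lebesgue_measure R).
Local Notation N01 := (@std_normal R).

Lemma integral_std_normal (f : R -> \bar R) :
  measurable_fun setT f -> (forall x, 0 <= f x)%E ->
  (\int[N01]_x f x = \int[mu]_x (f x * (normal_pdf 0 1 x)%:E))%E.
Proof.
move=> mf f0; have dom := @normal_prob_dominates R 0 1.
rewrite -(@Radon_Nikodym_SigmaFinite.change_of_variables _ _ _ N01 mu dom)//.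
have intg := Radon_Nikodym_SigmaFinite.f_integrable dom.
apply: ae_eq_integral => //.
- by apply: emeasurable_funM => //; exact: measurable_int intg.
- apply: emeasurable_funM => //.
  by apply/measurable_EFinP; exact: measurable_normal_pdf.
- apply: (@ae_eqe_mul2l _ _ _ mu setT _ (EFin \o normal_pdf 0 1)).
  apply: integral_ae_eq => //.
  + by apply/measurable_EFinP; exact: measurable_normal_pdf.
  + by move=> E _ mE; rewrite -Radon_Nikodym_SigmaFinite.f_integral.
Qed.

Definition gauss_dens (s x : R) : R := expR (- (x ^+ 2) / (s ^+ 2 *+ 2)).

Lemma normal_pdf0E (s x : R) : s != 0 ->
  normal_pdf 0 s x = (Num.sqrt (s ^+ 2 * pi *+ 2))^-1 * gauss_dens s x.
Proof. by move=> s0; rewrite normal_pdfE// /gauss_dens /normal_fun subr0. Qed.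

Lemma gauss_densM (x t : R) :
  gauss_dens t x = gauss_dens 1 x * expR ((1 - t ^- 2) * (x ^+ 2 / 2)).
Proof.
rewrite /gauss_dens -expRD; congr expR.
rewrite expr1n -(mulr_natr (t ^+ 2)) invfM; by set u := (t ^+ 2)^-1; field.
Qed.

(** Up to the factor [s], the integrand is the density of N(0, s^2) with respect
    to N(0, 1): normalization alone gives the exponential moments of [x^2]. *)
Lemma integral_normal_dilation (s : R) : 0 < s ->
  (\int[N01]_x (expR ((1 - s ^- 2) * (x ^+ 2 / 2)))%:E = s%:E)%E.
Proof.
move=> s0; rewrite integral_std_normal; last 2 first.
- apply/measurable_EFinP; apply: measurableT_comp => //.
  by apply: measurable_funM => //; apply: measurable_funM => //; exact: measurable_funX.
- by move=> x; rewrite lee_fin expR_ge0.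
transitivity (\int[mu]_x (s%:E * (normal_pdf 0 s x)%:E))%E; last first.
  rewrite ge0_integralZl//.
  - by rewrite integral_normal_pdf mule1.
  - by apply/measurable_EFinP; apply: measurable_normal_pdf.
  - by move=> x _; rewrite lee_fin normal_pdf_ge0.
  - by rewrite lee_fin ltW.
apply: eq_integral => x _; rewrite -!EFinM !normal_pdf0E ?gt_eqF// (gauss_densM _ s).
congr EFin; rewrite expr1n mul1r -mulrnAr sqrtrM ?sqr_ge0// sqrtr_sqr gtr0_norm//.
rewrite invfM; field.
by rewrite !gt_eqF// sqrtr_gt0 mulrn_wgt0// pi_gt0.
Qed.

(** Any power of [1 + x^2] is dominated by [exp (x^2 / 4)], the density ratio of
    a wider Gaussian, so all the moments of N(0, 1) are finite. *)
Lemma normal_moment_lty (k : nat) :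
  (\int[N01]_x ((1 + x ^+ 2) ^+ k)%:E < +oo)%E.
Proof.
have bnd (y : R) : 0 <= y -> (1 + y) ^+ k <= (4 ^+ k * k`!%:R) * (expR (4^-1) * expR (y / 4)).
  move=> y0; have h : ((1 + y) / 4) ^+ k / k`!%:R <= expR ((1 + y) / 4).
    have z0 : 0 <= (1 + y) / 4 by lra.
    case: k => [|k]; first by rewrite expr0 fact0 divr1 -[leLHS]expR0 ler_expR.
    apply: le_trans (_ : 1 + ((1 + y) / 4) ^+ k.+1 / k.+1`!%:R <= _).
      by rewrite lerDr.
    exact: expR_ge1Dxn.
  rewrite -expRD [X in expR X](_ : _ = (1 + y) / 4); last by field.
  rewrite -ler_pdivrMl ?mulr_gt0 ?exprn_gt0 ?ltr0n ?fact_gt0//.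
  apply: le_trans h; rewrite expr_div_n invfM le_eqVlt; apply/orP; left; apply/eqP.
  ring.
pose C : R := (4 ^+ k * k`!%:R) * expR (4^-1).
have C0 : 0 <= C by rewrite !mulr_ge0 ?exprn_ge0 ?expR_ge0.
have s20 : 0 < Num.sqrt 2 :> R by rewrite sqrtr_gt0.
apply: (@le_lt_trans _ _ (\int[N01]_x (C%:E * (expR ((1 - Num.sqrt 2 ^- 2) * (x ^+ 2 / 2)))%:E))%E).
  apply: ge0_le_integral => //.
  - by move=> x _; rewrite lee_fin exprn_ge0// addr_ge0// sqr_ge0.
  - by apply/measurable_EFinP; apply: measurable_funX; apply: measurable_funD.
  - by apply: measurable_funeM; apply/measurable_EFinP; apply: measurableT_comp => //;
      apply: measurable_funM => //; apply: measurable_funM => //; exact: measurable_funX.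
  - move=> x _; rewrite -EFinM lee_fin /C -mulrA.
    apply: le_trans (bnd _ (sqr_ge0 x)) _.
    rewrite sqr_sqrtr// (_ : (1 - 2^-1) * (x ^+ 2 / 2) = x ^+ 2 / 4); last by field.
    by rewrite -!mulrA.
rewrite ge0_integralZl//.
- by rewrite integral_normal_dilation// -EFinM ltry.
- by apply/measurable_EFinP; apply: measurableT_comp => //;
    apply: measurable_funM => //; apply: measurable_funM => //; exact: measurable_funX.
Qed.

End normal.

(** * Functions of polynomial growth *)

Section growth.
Context {R : realType} {dT : measure_display} {T : measurableType dT}.
Implicit Types (P : probability T R) (W F G : T -> R).

(** Measurable functions dominated by a power of the weight [W]: a class stable
    under the operations used below and, once all the powers of [W] are
    integrable, made of integrable functions only. *)
Definition pgrowth W F :=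
  measurable_fun [set: T] F /\ exists A k, forall t, `|F t| <= A * W t ^+ k.

Definition weight P W :=
  [/\ measurable_fun [set: T] W, forall t, 1 <= W t &
      forall k, (\int[P]_t (W t ^+ k)%:E < +oo)%E].

Lemma pg_bound W F : (forall t, 1 <= W t) -> pgrowth W F ->
  exists A k, 0 <= A /\ forall t, `|F t| <= A * W t ^+ k.
Proof.
move=> W1 [_ [A [k FA]]]; exists `|A|, k; split => // t.
apply: le_trans (FA t) _; apply: ler_wpM2r; last exact: ler_norm.
by rewrite exprn_ge0// (le_trans ler01).
Qed.

Section closure.
Variable W : T -> R.
Hypothesis W1 : forall t, 1 <= W t.

Lemma pg_le F G : measurable_fun [set: T] F -> pgrowth W G ->
  (forall t, `|F t| <= `|G t|) -> pgrowth W F.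
Proof.
move=> mF [_ [A [k GA]]] FG; split => //; exists A, k => t.
exact: le_trans (FG t) (GA t).
Qed.

Lemma pg_cst (c : R) : pgrowth W (fun=> c).
Proof.
split; first exact: measurable_cst.
by exists `|c|, 0%N => t; rewrite expr0 mulr1.
Qed.

Lemma pgD F G : pgrowth W F -> pgrowth W G -> pgrowth W (fun t => F t + G t).
Proof.
move=> pF pG; have [A [k [A0 FA]]] := pg_bound W1 pF.
have [B [l [B0 GB]]] := pg_bound W1 pG.
split; first by apply: measurable_funD; [case: pF|case: pG].
exists (A + B), (k + l)%N => t; apply: le_trans (ler_normD _ _) _.
rewrite mulrDl lerD//.
  apply: le_trans (FA t) _; apply: ler_wpM2l => //.
  by rewrite ler_weXn2l ?W1// leq_addr.
apply: le_trans (GB t) _; apply: ler_wpM2l => //.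
by rewrite ler_weXn2l ?W1// leq_addl.
Qed.

Lemma pgM F G : pgrowth W F -> pgrowth W G -> pgrowth W (fun t => F t * G t).
Proof.
move=> pF pG; have [A [k [A0 FA]]] := pg_bound W1 pF.
have [B [l [B0 GB]]] := pg_bound W1 pG.
split; first by apply: measurable_funM; [case: pF|case: pG].
exists (A * B), (k + l)%N => t; rewrite normrM exprD mulrACA.
by rewrite ler_pM.
Qed.

Lemma pgZ c F : pgrowth W F -> pgrowth W (fun t => c * F t).
Proof. by move=> pF; apply: pgM => //; exact: pg_cst. Qed.

Lemma pgN F : pgrowth W F -> pgrowth W (fun t => - F t).
Proof.
move=> [mF [A [k FA]]]; split; first exact: measurableT_comp.
by exists A, k => t; rewrite normrN.
Qed.

Lemma pgB F G : pgrowth W F -> pgrowth W G -> pgrowth W (fun t => F t - G t).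
Proof. by move=> pF pG; apply: pgD => //; exact: pgN. Qed.

Lemma pgX k F : pgrowth W F -> pgrowth W (fun t => F t ^+ k).
Proof.
move=> pF; elim: k => [|k IH]; first exact: pg_cst.
by under eq_fun do rewrite exprS; exact: pgM.
Qed.

Lemma pg_sum (I : Type) (r : seq I) (F : I -> T -> R) :
  (forall i, pgrowth W (F i)) -> pgrowth W (fun t => \sum_(i <- r) F i t).
Proof.
move=> pF; elim: r => [|i r IH].
  by under eq_fun do rewrite big_nil; exact: pg_cst.
by under eq_fun do rewrite big_cons; exact: pgD.
Qed.

Lemma pg_indic (A : set T) : measurable A -> pgrowth W (\1_A).
Proof.
move=> mA; split; first exact: measurable_indic.
by exists 1, 0%N => t; rewrite expr0 mulr1 indicE; case: (_ \in _); rewrite ?normr1 ?normr0.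
Qed.

End closure.

Section expect.
Variables (P : probability T R) (W : T -> R).
Hypothesis wW : weight P W.

Lemma pg_integrable F : pgrowth W F -> P.-integrable setT (EFin \o F).
Proof.
case: wW => mW W1 PW pF; have [A [k [A0 FA]]] := pg_bound W1 pF.
have mF : measurable_fun setT F by case: pF.
apply/integrableP; split; first exact/measurable_EFinP.
apply: (@le_lt_trans _ _ (\int[P]_t (A%:E * (W t ^+ k)%:E))%E).
  apply: ge0_le_integral => //.
  - by apply/measurableT_comp => //; exact/measurable_EFinP.
  - by apply: measurable_funeM; apply/measurable_EFinP; exact: measurable_funX.
  - by move=> t _; rewrite /= -EFinM lee_fin.
rewrite ge0_integralZl//.
- have := PW k; have : (0 <= \int[P]_t (W t ^+ k)%:E)%E.
    by apply: integral_ge0 => t _; rewrite lee_fin exprn_ge0// (le_trans ler01).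
  by case: (integral _ _ _) => // r _ _; rewrite -EFinM ltry.
- by apply/measurable_EFinP; exact: measurable_funX.
- by move=> t _; rewrite lee_fin exprn_ge0// (le_trans ler01).
Qed.

Lemma ExD F G : pgrowth W F -> pgrowth W G ->
  \int[P]_t (F t + G t) = \int[P]_t F t + \int[P]_t G t.
Proof. by move=> pF pG; rewrite RintegralD//; exact: pg_integrable. Qed.

Lemma ExB F G : pgrowth W F -> pgrowth W G ->
  \int[P]_t (F t - G t) = \int[P]_t F t - \int[P]_t G t.
Proof. by move=> pF pG; rewrite RintegralB//; exact: pg_integrable. Qed.

Lemma ExZ c F : pgrowth W F -> \int[P]_t (c * F t) = c * \int[P]_t F t.
Proof. by move=> pF; rewrite RintegralZl//; exact: pg_integrable. Qed.

Lemma Ex_cst c : \int[P]_t c = c :> R.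
Proof.
rewrite Rintegral_cst// [X in fine X](_ : _ = 1%E) ?mulr1//.
exact: probability_setT.
Qed.

Lemma Ex_le F G : pgrowth W F -> pgrowth W G -> (forall t, F t <= G t) ->
  \int[P]_t F t <= \int[P]_t G t.
Proof. by move=> pF pG FG; apply: le_Rintegral => //; exact: pg_integrable. Qed.

Lemma Ex_ge0 F : (forall t, 0 <= F t) -> 0 <= \int[P]_t F t.
Proof. by move=> F0; exact: Rintegral_ge0. Qed.

Lemma Ex_sum (I : Type) (r : seq I) (F : I -> T -> R) :
  (forall i, pgrowth W (F i)) ->
  \int[P]_t (\sum_(i <- r) F i t) = \sum_(i <- r) \int[P]_t F i t.
Proof.
have W1 : forall t, 1 <= W t by case: wW.
move=> pF; elim: r => [|i r IH].
  rewrite big_nil -[RHS]Ex_cst; apply: eq_Rintegral => t _.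
  by rewrite big_nil.
rewrite big_cons -IH -ExD//; last exact: pg_sum.
by apply: eq_Rintegral => t _; rewrite big_cons.
Qed.

Lemma Ex_norm F : pgrowth W F -> `|\int[P]_t F t| <= \int[P]_t `|F t|.
Proof. by move=> pF; apply: le_normr_Rintegral => //; exact: pg_integrable. Qed.

(** Variance is nonnegative: Jensen's inequality for the square. *)
Lemma Ex_sqr F : pgrowth W F -> (\int[P]_t F t) ^+ 2 <= \int[P]_t F t ^+ 2.
Proof.
have W1 : forall t, 1 <= W t by case: wW.
move=> pF; set c := \int[P]_t F t.
have : 0 <= \int[P]_t (F t - c) ^+ 2 by apply: Ex_ge0 => t; exact: sqr_ge0.
rewrite (_ : \int[P]_t _ = \int[P]_t (F t ^+ 2 - (2 * c) * F t + c ^+ 2)); last first.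
  by apply: eq_Rintegral => t _; ring.
have p2 := pgX W1 2 pF; have pZ := pgZ W1 (2 * c) pF; have pc := pg_cst W (c ^+ 2).
rewrite ExD//; last exact: pgB.
rewrite ExB// ExZ// Ex_cst -/c; lra.
Qed.

End expect.
End growth.

Section normal_weight.
Context {R : realType}.
Local Notation RM := (measurableTypeR R).
Local Notation N01 := (@std_normal R).

Definition wt1 (x : R) : R := 1 + x ^+ 2.

Lemma weight_normal : weight N01 wt1.
Proof.
split.
- by apply: measurable_funD => //; exact: measurable_funX.
- by move=> x; rewrite lerDl sqr_ge0.
- exact: normal_moment_lty.
Qed.

Lemma wt1_ge1 (x : R) : 1 <= wt1 x. Proof. by rewrite lerDl sqr_ge0. Qed.

Lemma pg1_id : pgrowth wt1 (fun x : R => x).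
Proof.
split; first exact: measurable_id.
exists 1, 1%N => x; rewrite expr1 mul1r /wt1 ler_norml; apply/andP; split; nra.
Qed.

(** In [integral_normal_dilation], the tangent line [1 + u <= exp u] gives
    [(s^2 - 1) E x^2 <= 2 s^2 (s - 1)]; letting [s] tend to 1 from above and from
    below bounds [E x^2] on both sides. *)
Lemma normal_second_moment : \int[N01]_x x ^+ 2 = 1 :> R.
Proof.
have wN := weight_normal.
have p2 : pgrowth wt1 (fun x : R => x ^+ 2) := pgX wt1_ge1 2 pg1_id.
set M := Rintegral _ _ _.
have key s : 0 < s -> (s ^+ 2 - 1) * M <= 2 * s ^+ 2 * (s - 1).
  move=> s0.
  have pe : pgrowth wt1 (fun x : R => 1 + ((1 - s ^- 2) / 2) * x ^+ 2).
    by apply: pgD; [exact: wt1_ge1|exact: pg_cst|apply: pgZ => //; exact: wt1_ge1].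
  have : (\int[N01]_x (1 + ((1 - s ^- 2) / 2) * x ^+ 2)%:E <= s%:E)%E.
    rewrite -(integral_normal_dilation s0); apply: le_integral => //.
    - exact: (pg_integrable wN pe).
    - apply/integrableP; split.
        apply/measurable_EFinP; apply: measurableT_comp => //.
        by apply: measurable_funM => //; apply: measurable_funM => //; exact: measurable_funX.
      under eq_integral do rewrite /= ger0_norm ?expR_ge0//.
      by rewrite /= integral_normal_dilation// ltry.
    - move=> x _; rewrite lee_fin; apply: le_trans (expR_ge1Dx _).
      by rewrite le_eqVlt; apply/orP; left; apply/eqP; field; rewrite gt_eqF.
  have -> : (\int[N01]_x (1 + ((1 - s ^- 2) / 2) * x ^+ 2)%:E =
      (\int[N01]_x (1 + ((1 - s ^- 2) / 2) * x ^+ 2))%:E)%E.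
    rewrite /Rintegral fineK//; apply: integrable_fin_num => //.
    exact: (pg_integrable wN pe).
  rewrite lee_fin (ExD wN); [|exact: pg_cst|by apply: pgZ => //; exact: wt1_ge1].
  rewrite Ex_cst (ExZ wN)// -/M => h.
  have s20 : 0 < s ^+ 2 by rewrite exprn_gt0.
  have : s ^+ 2 * (1 + (1 - s ^- 2) / 2 * M) <= s ^+ 2 * s by rewrite ler_pM2l.
  rewrite (_ : s ^+ 2 * _ = s ^+ 2 + (s ^+ 2 - 1) * M / 2); last by field; rewrite gt_eqF.
  move=> h2; nra.
have M0 : 0 <= M by apply: Ex_ge0 => x; exact: sqr_ge0.
apply/eqP; rewrite eq_le; apply/andP; split; apply/ler_addgt0Pr => e e0.
- have := @key (1 + e / 3) ltac:(lra) => h.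
  have [e1|e1] := leP e 1.
  + have : M * (2 + e / 3) <= 2 * (1 + e / 3) ^+ 2.
      rewrite -(@ler_pM2r _ (e / 3)); last lra.
      nra.
    move=> h3; nra.
  + have := @key 2 ltac:(lra) => h3; have := @key (1 + 1/3) ltac:(lra) => h4; lra.
- have [e1|e1] := leP e 1; last by lra.
  have := @key (1 - e / 3) ltac:(lra) => h.
  have : 2 * (1 - e / 3) ^+ 2 <= M * (2 - e / 3).
    rewrite -(@ler_pM2r _ (e / 3)); last lra.
    nra.
  move=> h3; nra.
Qed.

End normal_weight.

(** * Product measures and the Gaussian vector *)

Section product_growth.
Context {R : realType} {d1 d2 : measure_display}.
Context {T1 : measurableType d1} {T2 : measurableType d2}.
Variables (P1 : probability T1 R) (P2 : probability T2 R).
Variables (W1 : T1 -> R) (W2 : T2 -> R).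
Hypotheses (wW1 : weight P1 W1) (wW2 : weight P2 W2).

Definition prodw (u : T1 * T2) : R := W1 u.1 * W2 u.2.

Lemma measurable_prodw : measurable_fun [set: T1 * T2] prodw.
Proof.
case: wW1 => mW1 _ _; case: wW2 => mW2 _ _.
by apply: measurable_funM; [exact: (measurableT_comp mW1)|exact: (measurableT_comp mW2)].
Qed.

Lemma prodw_ge1 u : 1 <= prodw u.
Proof.
case: wW1 => _ h1 _; case: wW2 => _ h2 _.
by rewrite -[leLHS]mulr1 ler_pM// (le_trans ler01).
Qed.

Lemma weight_prod : weight (P1 \x P2)%E prodw.
Proof.
case: (wW1) => mW1 W1_ P1W; case: (wW2) => mW2 W2_ P2W.
split; [exact: measurable_prodw|exact: prodw_ge1|move=> k].
have mk : measurable_fun [set: T1 * T2] (fun u => (prodw u ^+ k)%:E).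
  by apply/measurable_EFinP; apply: measurable_funX; exact: measurable_prodw.
have Wk1 x : 0 <= W1 x ^+ k by rewrite exprn_ge0// (le_trans ler01).
have Wk2 x : 0 <= W2 x ^+ k by rewrite exprn_ge0// (le_trans ler01).
have mW1k : measurable_fun [set: T1] (fun x => (W1 x ^+ k)%:E).
  by apply/measurable_EFinP; exact: measurable_funX.
have mW2k : measurable_fun [set: T2] (fun y => (W2 y ^+ k)%:E).
  by apply/measurable_EFinP; exact: measurable_funX.
rewrite fubini_tonelli1//; last first.
  by move=> u; rewrite lee_fin exprn_ge0// (le_trans ler01)// prodw_ge1.
rewrite /fubini_F /prodw /=.
under eq_integral => x _.
  under eq_integral => y _ do rewrite exprMn EFinM.
  rewrite ge0_integralZl//; last 2 first.
  - by move=> y _; rewrite lee_fin.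
  - by rewrite lee_fin.
  rewrite muleC; over.
have I20 : (0 <= \int[P2]_y (W2 y ^+ k)%:E)%E.
  by apply: integral_ge0 => y _; rewrite lee_fin.
have I10 : (0 <= \int[P1]_y (W1 y ^+ k)%:E)%E.
  by apply: integral_ge0 => y _; rewrite lee_fin.
rewrite ge0_integralZl//; last by move=> x _; rewrite lee_fin.
by rewrite lte_mul_pinfty// ge0_fin_numE.
Qed.

Variable F : T1 * T2 -> R.
Hypothesis pF : pgrowth prodw F.

Lemma pg_section1 x : pgrowth W2 (fun y => F (x, y)).
Proof.
case: pF => mF [A [k FA]]; split; first exact: measurableT_comp.
by exists (A * W1 x ^+ k), k => y; apply: le_trans (FA _) _; rewrite /prodw exprMn mulrA.
Qed.

Lemma pg_section2 y : pgrowth W1 (fun x => F (x, y)).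
Proof.
case: pF => mF [A [k FA]]; split; first exact: measurableT_comp.
exists (A * W2 y ^+ k), k => x; apply: le_trans (FA _) _.
by rewrite /prodw exprMn mulrA mulrAC.
Qed.

Lemma integral_prod_Fubini : \int[(P1 \x P2)%E]_u F u = \int[P1]_x \int[P2]_y F (x, y).
Proof.
have iF := pg_integrable weight_prod pF.
rewrite /Rintegral -(integral12_prod_meas1 iF); congr fine.
apply: eq_integral => x _; rewrite /fubini_F fineK//.
by apply: integrable_fin_num => //; exact: (pg_integrable wW2 (pg_section1 x)).
Qed.

Lemma integral_prod_Fubini' : \int[(P1 \x P2)%E]_u F u = \int[P2]_y \int[P1]_x F (x, y).
Proof.
have iF := pg_integrable weight_prod pF.
rewrite /Rintegral -(integral21_prod_meas1 iF); congr fine.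
apply: eq_integral => x _; rewrite /fubini_G fineK//.
by apply: integrable_fin_num => //; exact: (pg_integrable wW1 (pg_section2 x)).
Qed.

Lemma pg_partial1 : pgrowth W1 (fun x => \int[P2]_y F (x, y)).
Proof.
have iF := pg_integrable weight_prod pF.
have W2_ : forall y, 1 <= W2 y by case: wW2.
split.
  apply: (@measurableT_comp _ _ _ _ _ _ fine) => //.
  exact: (measurable_fubini_F iF).
have [A [k [A0 FA]]] := pg_bound prodw_ge1 pF.
exists (A * \int[P2]_y W2 y ^+ k), k => x.
have pW : pgrowth W2 (fun y => W2 y ^+ k).
  split; first by apply: measurable_funX; case: wW2.
  by exists 1, k => y; rewrite mul1r ger0_norm// exprn_ge0// (le_trans ler01).
apply: le_trans (Ex_norm wW2 (pg_section1 x)) _.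
rewrite mulrAC -(ExZ wW2)//; apply: (Ex_le wW2).
- apply: (pg_le _ (pg_section1 x)).
    by apply: measurableT_comp => //; case: (pg_section1 x).
  by move=> y; rewrite normr_id.
- exact: pgZ.
- by move=> y; apply: le_trans (FA _) _; rewrite /prodw exprMn mulrA.
Qed.

End product_growth.

Section gauss.
Context {R : realType}.
Local Notation RM := (measurableTypeR R).
Local Notation N01 := (@std_normal R).
Local Notation tup n := (n.-tuple RM).

Definition scons n (x : R) (t : tup n) : tup n.+1 := cons_pair (x, t).

Lemma scons0 n x (t : tup n) : tnth (scons x t) ord0 = x.
Proof. exact: tnth0. Qed.

Lemma sconsS n x (t : tup n) i : tnth (scons x t) (lift ord0 i) = tnth t i.
Proof. by rewrite /scons /cons_pair tnthS. Qed.

(** A product, rather than [1 + |t|^2], because it factors along the recursion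
    that defines [gauss]. *)
Definition wt n (t : tup n) : R := \prod_(i < n) wt1 (tnth t i).

Lemma wt_ge1 n (t : tup n) : 1 <= wt t.
Proof.
rewrite /wt; elim/big_ind: _ => // [x y x1 y1|i _]; last exact: wt1_ge1.
by rewrite -[leLHS]mulr1 ler_pM.
Qed.

Lemma wt_scons n x (t : tup n) : wt (scons x t) = wt1 x * wt t.
Proof.
rewrite /wt big_ord_recl scons0; congr (_ * _).
by apply: eq_bigr => i _; rewrite sconsS.
Qed.

Lemma measurable_wt n : measurable_fun [set: tup n] (@wt n).
Proof.
apply: measurable_prod => i _; apply: measurable_funD => //.
by apply: measurable_funX; exact: measurable_tnth.
Qed.

Lemma pg_prodw n (F : tup n.+1 -> R) : pgrowth (@wt n.+1) F ->
  pgrowth (prodw wt1 (@wt n)) (F \o @cons_pair R n).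
Proof.
move=> [mF [A [k FA]]]; split.
  apply: measurableT_comp => //; exact: measurable_cons_pair.
by exists A, k => -[x t] /=; apply: le_trans (FA _) _; rewrite /prodw /= -wt_scons.
Qed.

Lemma weight_gauss n : weight (gauss n) (@wt n).
Proof.
elim: n => [|n IH]; split; [exact: measurable_wt|exact: wt_ge1| |
  exact: measurable_wt|exact: wt_ge1|] => k.
  rewrite /= integral_dirac//; last first.
    by apply/measurable_EFinP; apply: measurable_funX; exact: measurable_wt.
  by rewrite diracT mul1e ltry.
have [_ _ /(_ k)] := weight_prod (weight_normal) IH.
apply: le_lt_trans; rewrite /= ge0_integral_distribution//.
- by apply: ge0_le_integral => //;
    [move=> [x t] _; rewrite /= lee_fin exprn_ge0// (le_trans ler01)// wt_ge1
    |apply/measurable_EFinP; apply: measurable_funX;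
      exact: (measurableT_comp (@measurable_wt n.+1) (@measurable_cons_pair R n))
    |apply/measurable_EFinP; apply: measurable_funX; apply: measurable_prodw;
      [exact: weight_normal|exact: IH]
    |move=> [x t] _; rewrite /= lee_fin /prodw /= -wt_scons].
- by apply/measurable_EFinP; apply: measurable_funX; exact: measurable_wt.
- by move=> t; rewrite lee_fin exprn_ge0// (le_trans ler01)// wt_ge1.
Qed.

Lemma Ex_gauss0 (F : tup 0 -> R) : pgrowth (@wt 0) F ->
  \int[gauss 0]_t F t = F [tuple].
Proof.
move=> [mF _]; rewrite /Rintegral /= integral_dirac//; last exact/measurable_EFinP.
by rewrite diracT mul1e.
Qed.

Section recursion.
Variables (n : nat) (F : tup n.+1 -> R).
Hypothesis pF : pgrowth (@wt n.+1) F.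

Let pF' := pg_prodw pF.
Let wN := @weight_normal R.
Let wG := weight_gauss n.

Let Ex_gauss_prod :
  \int[gauss n.+1]_t F t = \int[(N01 \x gauss n)%E]_u (F \o @cons_pair R n) u.
Proof.
rewrite /Rintegral /= integral_distribution//.
- by apply/measurable_EFinP; case: pF.
- exact: (pg_integrable (weight_prod wN wG) pF').
Qed.

Lemma Ex_gaussS : \int[gauss n.+1]_t F t = \int[N01]_x \int[gauss n]_t F (scons x t).
Proof. by rewrite Ex_gauss_prod (integral_prod_Fubini wN wG pF'). Qed.

Lemma Ex_gaussS' : \int[gauss n.+1]_t F t = \int[gauss n]_t \int[N01]_x F (scons x t).
Proof. by rewrite Ex_gauss_prod (integral_prod_Fubini' wN wG pF'). Qed.

Lemma pg_gauss_section1 x : pgrowth (@wt n) (fun t => F (scons x t)).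
Proof. exact: (pg_section1 pF'). Qed.

Lemma pg_gauss_partial1 : pgrowth wt1 (fun x => \int[gauss n]_t F (scons x t)).
Proof. exact: (pg_partial1 wN wG pF'). Qed.

End recursion.

Lemma pg_tnth n (i : 'I_n) : pgrowth (@wt n) (fun t => tnth t i).
Proof.
split; first exact: measurable_tnth.
exists 1, 1%N => t; rewrite expr1 mul1r.
apply: (@le_trans _ _ (wt1 (tnth t i))).
  by rewrite ler_norml /wt1; apply/andP; split; nra.
rewrite /wt (bigD1 i)//= ler_peMr ?(le_trans ler01)// ?wt1_ge1//.
elim/big_ind: _ => // [x y x1 y1|j _]; last exact: wt1_ge1.
by rewrite -[leLHS]mulr1 ler_pM.
Qed.

Lemma pg_tnth_comp n (i : 'I_n) (g : R -> R) : pgrowth wt1 g ->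
  pgrowth (@wt n) (fun t => g (tnth t i)).
Proof.
move=> pg; have [A [k [A0 gA]]] := pg_bound wt1_ge1 pg; have [mg _] := pg.
split; first by apply: (measurableT_comp mg); exact: measurable_tnth.
exists A, k => t; apply: le_trans (gA _) _; apply: ler_wpM2l => //.
rewrite lerXn2r ?nnegrE ?(le_trans ler01)// ?wt1_ge1 ?wt_ge1//.
rewrite /wt (bigD1 i)//= ler_peMr ?(le_trans ler01)// ?wt1_ge1//.
elim/big_ind: _ => // [x y x1 y1|j _]; last exact: wt1_ge1.
by rewrite -[leLHS]mulr1 ler_pM.
Qed.

Lemma Ex_coord n (i : 'I_n) (g : R -> R) : pgrowth wt1 g ->
  \int[gauss n]_t g (tnth t i) = \int[N01]_x g x.
Proof.
move=> pg; elim: n i => [[]//|n IH i].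
rewrite Ex_gaussS; last exact: pg_tnth_comp.
have [->|i0] := eqVneq i ord0.
  apply: eq_Rintegral => x _; rewrite -[RHS](Ex_cst (gauss n)).
  by apply: eq_Rintegral => t _; rewrite scons0.
have [j ->] : exists j, i = lift ord0 j.
  by case: (unliftP ord0 i) i0 => [j ->|->]; [exists j|rewrite eqxx].
rewrite -(IH j) -[RHS](Ex_cst N01); apply: eq_Rintegral => x _.
by apply: eq_Rintegral => t _; rewrite sconsS.
Qed.

End gauss.

(** * Symmetries of the Gaussian measure *)

Section symmetry.
Context {R : realType}.
Local Notation RM := (measurableTypeR R).
Local Notation N01 := (@std_normal R).
Local Notation mu := (@lebesgue_measure R).
Local Notation tup n := (n.-tuple RM).

Lemma ge0_integral_normalN (f : R -> \bar R) :
  measurable_fun setT f -> (forall x, 0 <= f x)%E ->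
  (\int[N01]_x f (- x)%R = \int[N01]_x f x)%E.
Proof.
move=> mf f0; have mN : measurable_fun [set: RM] (-%R : RM -> RM) by [].
have mp : measurable_fun [set: RM] (fun x : RM => (normal_pdf 0 1 x)%:E).
  by apply/measurable_EFinP; exact: measurable_normal_pdf.
rewrite !integral_std_normal//; last first.
  exact: (measurableT_comp mf mN).
transitivity (\int[pushforward mu (-%R : RM -> RM)]_x (f x * (normal_pdf 0 1 x)%:E))%E.
  rewrite (@ge0_integral_pushforward _ _ _ _ _ _ mN mu setT
             (fun x => f x * (normal_pdf 0 1 x)%:E)%E).
  - apply: eq_integral => x _; congr (_ * _%:E)%E.
    by rewrite !normal_pdf0E ?oner_neq0// /gauss_dens sqrrN.
  - exact: measurableT.
  - exact: emeasurable_funM.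
  - by move=> x _; rewrite mule_ge0 ?lee_fin ?normal_pdf_ge0.
by apply: eq_measure_integral => A mA _; exact: lebesgue_measureN.
Qed.

Lemma std_normalN (A : set RM) : measurable A ->
  pushforward N01 (-%R : RM -> RM) A = N01 A.
Proof.
move=> mA; rewrite /pushforward.
have mN : measurable_fun [set: RM] (-%R : RM -> RM) by [].
have mA' : measurable ((-%R : RM -> RM) @^-1` A) by rewrite -[_ @^-1` _]setTI; exact: mN.
transitivity (\int[N01]_x (\1_A (- x)%R)%:E)%E.
  transitivity (\int[N01]_x (\1_((-%R : RM -> RM) @^-1` A) x)%:E)%E.
    by rewrite integral_indic// setIT.
  by apply: eq_integral => x _; rewrite !indicE.
rewrite (@ge0_integral_normalN (EFin \o \1_A)).
- by rewrite /= integral_indic// setIT.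
- exact/measurable_EFinP/measurable_indic.
- by move=> x; rewrite lee_fin.
Qed.

Lemma Ex_normalN (g : R -> R) : pgrowth wt1 g ->
  \int[N01]_x g (- x) = \int[N01]_x g x.
Proof.
move=> pg; have mN : measurable_fun [set: RM] (-%R : RM -> RM) by [].
have mg : measurable_fun [set: RM] (EFin \o g) by apply/measurable_EFinP; case: pg.
have pgN' : pgrowth wt1 (fun x => g (- x)).
  case: (pg) => mg' [A [k gA]]; split; first exact: (measurableT_comp mg').
  by exists A, k => x; rewrite (le_trans (gA _))// /wt1 sqrrN.
rewrite /Rintegral; congr fine.
transitivity (\int[pushforward N01 (-%R : RM -> RM)]_x (g x)%:E)%E.
  by rewrite integral_pushforward//; exact: (pg_integrable weight_normal pgN').
by apply: eq_measure_integral => A mA _; exact: std_normalN.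
Qed.

Lemma normal_mean0 : \int[N01]_x x = 0 :> R.
Proof.
have := Ex_normalN pg1_id.
rewrite (_ : \int[N01]_x (- x) = \int[N01]_x (- 1 * x)); last first.
  by apply: eq_Rintegral => x _; rewrite mulN1r.
rewrite (ExZ weight_normal)//; last exact: pg1_id.
lra.
Qed.

Definition flip n (s : 'I_n -> bool) (t : tup n) : tup n :=
  [tuple (-1) ^+ s i * tnth t i | i < n].

Lemma tnth_flip n s (t : tup n) i : tnth (flip s t) i = (-1) ^+ s i * tnth t i.
Proof. by rewrite tnth_mktuple. Qed.

Lemma wt_flip n s (t : tup n) : wt (flip s t) = wt t.
Proof.
apply: eq_bigr => i _; rewrite tnth_flip /wt1 exprMn.
by rewrite sqrr_sign mul1r.
Qed.

Lemma measurable_flip n s : measurable_fun [set: tup n] (@flip n s).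
Proof.
apply/measurable_fun_tnthP => i.
rewrite (_ : _ \o _ = fun t : tup n => (-1) ^+ s i * tnth t i); last first.
  by apply/funext => t /=; rewrite tnth_flip.
by apply: measurable_funM => //; exact: measurable_tnth.
Qed.

Lemma pg_flip n s (F : tup n -> R) : pgrowth (@wt R n) F -> pgrowth (@wt R n) (F \o flip s).
Proof.
move=> [mF [A [k FA]]]; split; first exact: (measurableT_comp mF (@measurable_flip n s)).
by exists A, k => t; rewrite (le_trans (FA _))// wt_flip.
Qed.

Lemma flip_scons n s x (t : tup n) :
  flip s (scons x t) = scons ((-1) ^+ s ord0 * x) (flip (s \o lift ord0) t).
Proof.
apply: eq_from_tnth => i; rewrite tnth_flip.
case: (unliftP ord0 i) => [j ->|->]; last by rewrite !scons0.
by rewrite !sconsS tnth_flip.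
Qed.

Lemma Ex_flip n s (F : tup n -> R) : pgrowth (@wt R n) F ->
  \int[gauss n]_t F (flip s t) = \int[gauss n]_t F t.
Proof.
elim: n s F => [|n IH] s F pF.
  by apply: eq_Rintegral => t _; congr F; apply: eq_from_tnth => -[].
rewrite (Ex_gaussS (pg_flip s pF)) (Ex_gaussS pF).
pose g x := \int[gauss n]_t F (scons x t).
transitivity (\int[N01]_x g ((-1) ^+ s ord0 * x)).
  apply: eq_Rintegral => x _ /=; rewrite /g -(IH (s \o lift ord0)).
    by apply: eq_Rintegral => t _; rewrite flip_scons.
  exact: pg_gauss_section1.
case: (s ord0).
  rewrite -(@Ex_normalN g); last exact: (pg_gauss_partial1 pF).
  by apply: eq_Rintegral => x _; rewrite mulN1r.
by apply: eq_Rintegral => x _; rewrite mul1r.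
Qed.

Lemma normal_set1 (a : R) : N01 [set a] = 0%E.
Proof.
have := @normal_prob_dominates R 0 1 => /null_content_dominatesP; apply => //.
exact: lebesgue_measure_set1.
Qed.

Definition tdot n (c : 'I_n -> R) (t : tup n) : R := \sum_i c i * tnth t i.

Lemma measurable_tdot n c : measurable_fun [set: tup n] (tdot c).
Proof.
apply: measurable_sum => i; apply: measurable_funM => //; exact: measurable_tnth.
Qed.

Lemma measurable_hyperplane n c (s : R) : measurable [set t : tup n | tdot c t = s].
Proof.
rewrite (_ : [set t | _] = tdot c @^-1` [set s]); last by apply/seteqP; split.
by rewrite -[X in measurable X]setTI; apply: (@measurable_tdot n c).
Qed.

(** By induction: the section at a first coordinate is again a hyperplane, unless
    the first coefficient is the only nonzero one; the sections along the first
    coordinate are then single points. *)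
Lemma Ex_hyperplane n (c : 'I_n -> R) (s : R) : (exists i, c i != 0) ->
  \int[gauss n]_t \1_[set t : tup n | tdot c t = s] t = 0 :> R.
Proof.
elim: n c s => [|n IH] c s; first by case=> -[].
have pI : pgrowth (@wt R n.+1) (\1_[set t : tup n.+1 | tdot c t = s] : tup n.+1 -> R).
  by apply: pg_indic; exact: measurable_hyperplane.
have tdotS x (t : tup n) : tdot c (scons x t) = c ord0 * x + tdot (c \o lift ord0) t.
  by rewrite /tdot big_ord_recl scons0; congr (_ + _); apply: eq_bigr => i _; rewrite sconsS.
move=> [i ci0]; have [[j cj0]|h] := pselect (exists j, c (lift ord0 j) != 0).
  rewrite (Ex_gaussS pI) -[RHS](Ex_cst N01); apply: eq_Rintegral => x _.
  rewrite -(IH (c \o lift ord0) (s - c ord0 * x)); last by exists j.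
  apply: eq_Rintegral => t _; rewrite !indicE; congr ((_ : bool)%:R).
  apply/idP/idP; rewrite !inE /= tdotS => e; first by rewrite -e; ring.
  by rewrite e; ring.
have c00 : c ord0 != 0.
  case: (unliftP ord0 i) ci0 => [j ->|->] // cj; exfalso; apply: h; by exists j.
have cS j : c (lift ord0 j) = 0.
  by apply/eqP; apply: contra_notT h => cj; exists j.
rewrite (Ex_gaussS' pI) -[RHS](Ex_cst (gauss n)); apply: eq_Rintegral => t _.
transitivity (\int[N01]_x \1_[set s / c ord0] x).
  apply: eq_Rintegral => x _; rewrite !indicE; congr ((nat_of_bool _)%:R).
  have tE : tdot c (scons x t) = c ord0 * x.
    by rewrite tdotS /tdot big1 ?addr0// => k _; rewrite /= cS mul0r.
  apply/idP/idP; rewrite !inE /= tE; first by move=> <-; rewrite mulrC mulKf.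
  by move=> ->; rewrite mulrC divfK.
by rewrite /Rintegral integral_indic// setIT; exact: (congr1 fine (normal_set1 _)).
Qed.

End symmetry.

(** * A Poincare inequality for subgradients *)

(** Closes growth side conditions by following the shape of the function. *)
Ltac pg := repeat first
  [ assumption | exact: pg_cst | apply: pgX | apply: pgN | apply: pgD | apply: pgM ].

Section poincare.
Context {R : realType}.
Local Notation RM := (measurableTypeR R).
Local Notation N01 := (@std_normal R).
Local Notation tup n := (n.-tuple RM).

(** The larger of the two values supplies the subgradient that controls the
    increment. *)
Lemma subgradient_sqr (a b x y da db : R) :
  b >= a + da * (y - x) -> a >= b + db * (x - y) ->
  (a - b) ^+ 2 <= da ^+ 2 * (x - y) ^+ 2 + db ^+ 2 * (x - y) ^+ 2.
Proof.
move=> h1 h2; rewrite -!exprMn.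
have [ab|ab] := leP b a.
  apply: (@le_trans _ _ ((da * (x - y)) ^+ 2)); last by rewrite lerDl sqr_ge0.
  rewrite ler_sqr ?nnegrE; lra.
apply: (@le_trans _ _ ((db * (x - y)) ^+ 2)); last by rewrite lerDr sqr_ge0.
rewrite -sqrrN -[leRHS]sqrrN ler_sqr ?nnegrE; lra.
Qed.

(** The variance of [g] is half the mean of [(g x - g y)^2] for independent [x]
    and [y]; [subgradient_sqr] bounds the increment, and [1 + x^2] is the mean of
    [(x - y)^2] in [y].  With subgradients instead of derivatives, no derivative
    has to be taken under an integral when the inequality is tensorized. *)
Lemma poincare_normal (g D : R -> R) : pgrowth wt1 g -> pgrowth wt1 D ->
  (forall x y, g x + D x * (y - x) <= g y) ->
  \int[N01]_x g x ^+ 2 <= (\int[N01]_x g x) ^+ 2 + \int[N01]_x (D x ^+ 2 * (1 + x ^+ 2)).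
Proof.
move=> pg pD sub; have wN := @weight_normal R.
have W1 := @wt1_ge1 R; have p1 : forall c : R, pgrowth wt1 (fun=> c) by move=> c; exact: pg_cst.
have pid := @pg1_id R; have pg2 := pgX W1 2 pg; have pD2 := pgX W1 2 pD.
have pid2 := pgX W1 2 pid.
have pDx := pgM W1 pD2 pid; have pDx2 := pgM W1 pD2 pid2.
set m := \int[N01]_x g x; set s := \int[N01]_x g x ^+ 2.
set c0 := \int[N01]_x D x ^+ 2; set c1 := \int[N01]_x (D x ^+ 2 * x).
set c2 := \int[N01]_x (D x ^+ 2 * x ^+ 2).
have inner x : g x ^+ 2 - 2 * m * g x + s <=
    D x ^+ 2 * x ^+ 2 + D x ^+ 2 + (c0 * x ^+ 2 - 2 * c1 * x + c2).
  have -> : g x ^+ 2 - 2 * m * g x + s = \int[N01]_y (g x - g y) ^+ 2.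
    rewrite (_ : \int[N01]_y _ = \int[N01]_y (g x ^+ 2 - (2 * g x) * g y + g y ^+ 2)); last first.
      by apply: eq_Rintegral => y _; ring.
    rewrite (ExD wN) ?(ExB wN); try pg.
    by rewrite Ex_cst (ExZ wN)// -/m -/s; ring.
  have -> : D x ^+ 2 * x ^+ 2 + D x ^+ 2 + (c0 * x ^+ 2 - 2 * c1 * x + c2) =
      \int[N01]_y (D x ^+ 2 * (x - y) ^+ 2 + D y ^+ 2 * (x - y) ^+ 2).
    rewrite (_ : \int[N01]_y _ = \int[N01]_y (((D x ^+ 2 * x ^+ 2 - (2 * D x ^+ 2 * x) * y)
        + D x ^+ 2 * y ^+ 2) + ((x ^+ 2 * D y ^+ 2 - (2 * x) * (D y ^+ 2 * y))
        + D y ^+ 2 * y ^+ 2))); last first.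
      by apply: eq_Rintegral => y _; ring.
    have q1 := pgZ W1 (2 * D x ^+ 2 * x) pid; have q2 := pgZ W1 (D x ^+ 2) pid2.
    have q3 := pgZ W1 (x ^+ 2) pD2; have q4 := pgZ W1 (2 * x) pDx.
    have r1 := pgB W1 (p1 (D x ^+ 2 * x ^+ 2)) q1; have r3 := pgB W1 q3 q4.
    rewrite (ExD wN); try pg.
    rewrite (ExD wN); try pg.
    rewrite (ExB wN); try pg.
    rewrite (ExD wN); try pg.
    rewrite (ExB wN); try pg.
    by rewrite Ex_cst !(ExZ wN)// normal_mean0 normal_second_moment -/c0 -/c1 -/c2; ring.
  apply: (Ex_le wN).
  - pg.
  - pg.
  - by move=> y; exact: subgradient_sqr.
have q1 := pgZ W1 (2 * m) pg; have q2 := pgZ W1 c0 pid2; have q3 := pgZ W1 (2 * c1) pid.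
have r1 := pgB W1 pg2 q1; have r2 := pgD W1 pDx2 pD2; have r3 := pgB W1 q2 q3.
have : \int[N01]_x (g x ^+ 2 - 2 * m * g x + s) <=
    \int[N01]_x (D x ^+ 2 * x ^+ 2 + D x ^+ 2 + (c0 * x ^+ 2 - 2 * c1 * x + c2)).
  by apply: (Ex_le wN) => //; pg.
rewrite (ExD wN); try pg.
rewrite (ExB wN); try pg.
rewrite Ex_cst (ExZ wN)// -/m -/s.
rewrite (ExD wN); try pg.
rewrite (ExD wN); try pg.
rewrite (ExD wN); try pg.
rewrite (ExB wN); try pg.
rewrite !(ExZ wN)// Ex_cst normal_mean0 normal_second_moment.
rewrite -/c0 -/c2 => h.
rewrite (_ : \int[N01]_x (D x ^+ 2 * (1 + x ^+ 2)) = c0 + c2); first by lra.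
rewrite -(ExD wN)//; apply: eq_Rintegral => x _; ring.
Qed.

Definition upd n (t : tup n) (i : 'I_n) (y : R) : tup n :=
  [tuple if j == i then y else tnth t j | j < n].

Lemma tnth_upd n (t : tup n) i y j : tnth (upd t i y) j = if j == i then y else tnth t j.
Proof. by rewrite tnth_mktuple. Qed.

Lemma upd_scons0 n x (t : tup n) y : upd (scons x t) ord0 y = scons y t.
Proof.
apply: eq_from_tnth => j; rewrite tnth_upd.
by case: (unliftP ord0 j) => [k ->|->]; rewrite ?scons0 ?sconsS.
Qed.

Lemma upd_sconsS n x (t : tup n) i y :
  upd (scons x t) (lift ord0 i) y = scons x (upd t i y).
Proof.
apply: eq_from_tnth => j; rewrite tnth_upd.
by case: (unliftP ord0 j) => [k ->|->]; rewrite ?scons0 ?sconsS ?tnth_upd.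
Qed.

(** Tensorization: conditionally on the other coordinates the variance splits,
    and averaging over one coordinate keeps coordinatewise subgradients. *)
Lemma poincare_gauss n (F : tup n -> R) (D : 'I_n -> tup n -> R) :
  pgrowth (@wt R n) F -> (forall i, pgrowth (@wt R n) (D i)) ->
  (forall t i y, F t + D i t * (y - tnth t i) <= F (upd t i y)) ->
  \int[gauss n]_t F t ^+ 2 <= (\int[gauss n]_t F t) ^+ 2 +
     \sum_i \int[gauss n]_t (D i t ^+ 2 * (1 + tnth t i ^+ 2)).
Proof.
elim: n F D => [|n IH] F D pF pD sub.
  have W1 : forall t, 1 <= @wt R 0 t := @wt_ge1 R 0.
  by rewrite big_ord0 addr0 !Ex_gauss0//; exact: pgX.
have W1 := @wt_ge1 R n.+1; have W1' := @wt_ge1 R n; have W11 := @wt1_ge1 R.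
have wN := @weight_normal R; have wG := @weight_gauss R n.
pose g x := \int[gauss n]_t F (scons x t).
pose g' x := \int[gauss n]_t D ord0 (scons x t).
have pDD i : pgrowth (@wt R n.+1) (fun t => D i t ^+ 2 * (1 + tnth t i ^+ 2)).
  apply: pgM => //; first exact: pgX.
  by apply: pgD => //; [exact: pg_cst|apply: pgX => //; exact: pg_tnth].
have pg : pgrowth wt1 g := pg_gauss_partial1 pF.
have pg' : pgrowth wt1 g' := pg_gauss_partial1 (pD ord0).
pose S x := \sum_(i < n) \int[gauss n]_t (D (lift ord0 i) (scons x t) ^+ 2 * (1 + tnth t i ^+ 2)).
have SE i x : \int[gauss n]_t (D (lift ord0 i) (scons x t) ^+ 2 * (1 + tnth t i ^+ 2)) =
    \int[gauss n]_t (D (lift ord0 i) (scons x t) ^+ 2 * (1 + tnth (scons x t) (lift ord0 i) ^+ 2)).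
  by apply: eq_Rintegral => t _; rewrite sconsS.
have pS i : pgrowth wt1 (fun x =>
    \int[gauss n]_t (D (lift ord0 i) (scons x t) ^+ 2 * (1 + tnth t i ^+ 2))).
  under eq_fun do rewrite SE.
  exact: (pg_gauss_partial1 (pDD _)).
have pF2 := pgX W1 2 pF.
rewrite (Ex_gaussS pF2) (Ex_gaussS pF) -/g big_ord_recl.
have step1 : \int[N01]_x \int[gauss n]_t F (scons x t) ^+ 2 <= \int[N01]_x (g x ^+ 2 + S x).
  apply: (Ex_le wN).
  - exact: (pg_gauss_partial1 pF2).
  - by apply: pgD => //; [exact: pgX|exact: pg_sum].
  - move=> x; apply: IH.
    + exact: pg_gauss_section1.
    + by move=> i; exact: pg_gauss_section1.
    + by move=> t i y; rewrite -upd_sconsS -(sconsS x t i); exact: sub.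
have ES : \int[N01]_x S x =
    \sum_(i < n) \int[gauss n.+1]_t (D (lift ord0 i) t ^+ 2 * (1 + tnth t (lift ord0 i) ^+ 2)).
  rewrite (Ex_sum wN)//; apply: eq_bigr => i _.
  by rewrite (Ex_gaussS (pDD _)); apply: eq_Rintegral => x _; rewrite SE.
have psum : pgrowth wt1 S by exact: pg_sum.
apply: le_trans step1 _; rewrite (ExD wN)//; last exact: pgX.
rewrite ES addrA lerD2r.
apply: (le_trans (poincare_normal pg pg' _)).
  move=> x y; rewrite /g /g'.
  have pX := pg_gauss_section1 pF x; have pY := pg_gauss_section1 pF y.
  have pDx := pg_gauss_section1 (pD ord0) x.
  rewrite mulrC -(ExZ wG)// -(ExD wG)//; last exact: pgZ.
  apply: (Ex_le wG) => //; first by apply: pgD => //; exact: pgZ.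
  by move=> t; rewrite mulrC -(upd_scons0 x t y); have := sub (scons x t) ord0 y; rewrite scons0.
rewrite lerD2l (Ex_gaussS (pDD _)).
have px2 : pgrowth wt1 (fun x : R => 1 + x ^+ 2).
  by apply: pgD => //; [exact: pg_cst|apply: pgX => //; exact: pg1_id].
apply: (Ex_le wN).
- by apply: pgM => //; exact: pgX.
- exact: (pg_gauss_partial1 (pDD _)).
move=> x; have pDx := pg_gauss_section1 (pD ord0) x; have pDx2 := pgX W1' 2 pDx.
rewrite (_ : \int[gauss n]_t _ = (1 + x ^+ 2) * \int[gauss n]_t D ord0 (scons x t) ^+ 2).
  rewrite mulrC ler_wpM2l ?addr_ge0 ?sqr_ge0//.
  exact: (Ex_sqr wG pDx).
rewrite -(ExZ wG)//; apply: eq_Rintegral => t _; rewrite scons0; exact: mulrC.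
Qed.

End poincare.

(** * Smooth strongly convex functions *)

Section dots.
Context {R : realType} {d : nat}.
Implicit Types (x y z : 'rV[R]_d) (a : R).

Lemma dotC x y : dot x y = dot y x.
Proof. by apply: eq_bigr => i _; rewrite mulrC. Qed.

Lemma dotDl x y z : dot (x + y) z = dot x z + dot y z.
Proof. by rewrite -big_split; apply: eq_bigr => i _; rewrite mxE mulrDl. Qed.

Lemma dotZl a x z : dot (a *: x) z = a * dot x z.
Proof. by rewrite mulr_sumr; apply: eq_bigr => i _; rewrite mxE mulrA. Qed.

Lemma dotDr x y z : dot z (x + y) = dot z x + dot z y.
Proof. by rewrite !(dotC z) dotDl. Qed.

Lemma dotZr a x z : dot z (a *: x) = a * dot z x.
Proof. by rewrite !(dotC z) dotZl. Qed.

Lemma dotNl x z : dot (- x) z = - dot x z.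
Proof. by rewrite -scaleN1r dotZl mulN1r. Qed.

Lemma dotNr x z : dot z (- x) = - dot z x.
Proof. by rewrite !(dotC z) dotNl. Qed.

Definition dotE := (dotDl, dotDr, dotNl, dotNr, dotZl, dotZr).

Lemma dot_ge0 x : 0 <= dot x x.
Proof. by apply: sumr_ge0 => i _; rewrite -expr2 sqr_ge0. Qed.

Lemma dot_eq0 x : dot x x = 0 -> x = 0.
Proof.
move=> /eqP; rewrite psumr_eq0 => [/allP h|i _]; last by rewrite -expr2 sqr_ge0.
apply/rowP => i; rewrite mxE; have := h i (mem_index_enum _).
by rewrite /= mulf_eq0 orbb => /eqP.
Qed.

Lemma enorm_sqr x : enorm x ^+ 2 = dot x x.
Proof. by rewrite sqr_sqrtr// dot_ge0. Qed.

Lemma dot0l x : dot 0 x = 0.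
Proof. by rewrite /dot big1// => i _; rewrite mxE mul0r. Qed.

End dots.

Section quadratic_remainder.
Context {R : realType} {d : nat}.
Local Notation RM := (measurableTypeR R).
Local Notation tup := (d.-tuple RM).
Local Notation G := (gauss d : probability tup R).
Local Notation W := (@wt R d).
Variables (L U : R) (f : 'rV[R]_d -> R).
Hypotheses (hL : 0 < L) (hLU : L <= U) (fA1 : A1 L U f).

Let hU : 0 < U. Proof. exact: lt_le_trans hLU. Qed.
Let W1 : forall t : tup, 1 <= W t := @wt_ge1 R d.
Let wG := @weight_gauss R d.

Lemma A1_lower x y : f x + dot (y - x) (grad f x) + L / 2 * dot (y - x) (y - x) <= f y.
Proof.
case: fA1 => _ _ /(_ x y) [+ _] _ _; rewrite enorm_sqr.
by rewrite -[x - y]opprB dotNl dotNr opprK.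
Qed.

Lemma A1_upper x y : f y <= f x + dot (y - x) (grad f x) + U / 2 * dot (y - x) (y - x).
Proof.
case: fA1 => _ _ /(_ x y) [_ +] _ _; rewrite enorm_sqr.
by rewrite -[x - y]opprB dotNl dotNr opprK.
Qed.

(** The minimum being at the origin, the gradient vanishes nowhere else. *)
Lemma grad_neq0 x : x != 0 -> grad f x != 0.
Proof.
move=> x0; apply/eqP => g0; have := A1_lower x 0.
case: fA1 => _ _ _ [/(_ x) + _] f0; rewrite f0 g0 dotC dot0l sub0r dotNl dotNr opprK.
move=> fx h; have : dot x x <= 0.
  by rewrite -(@pmulr_rle0 _ (L / 2)) ?divr_gt0//; lra.
move=> x0'; move/eqP: x0; apply; apply: dot_eq0; apply/eqP.
by rewrite eq_le x0' dot_ge0.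
Qed.

Definition aff (m : 'rV[R]_d) (s : R) (t : tup) : tup := [tuple m 0 i + s * tnth t i | i < d].

Lemma vec_aff m s t : vec (aff m s t) = m + s *: vec t.
Proof. by apply/rowP => i; rewrite !mxE tnth_mktuple. Qed.

Lemma measurable_aff m s : measurable_fun [set: tup] (aff m s).
Proof.
apply/measurable_fun_tnthP => i.
rewrite (_ : _ \o _ = fun t : tup => m 0 i + s * tnth t i); last first.
  by apply/funext => t /=; rewrite tnth_mktuple.
by apply: measurable_funD => //; apply: measurable_funM => //; exact: measurable_tnth.
Qed.

Lemma dot_vec (t : tup) : dot (vec t) (vec t) = \sum_i tnth t i ^+ 2.
Proof. by apply: eq_bigr => i _; rewrite !mxE expr2. Qed.

Lemma pg_dot_vec : pgrowth W (fun t => dot (vec t) (vec t)).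
Proof.
under eq_fun do rewrite dot_vec.
by apply: pg_sum => // i; apply: pgX => //; exact: pg_tnth.
Qed.

Lemma Ex_dot_vec : \int[G]_t dot (vec t) (vec t) = d%:R.
Proof.
under eq_Rintegral do rewrite dot_vec.
rewrite (Ex_sum wG); last by move=> i; apply: pgX => //; exact: pg_tnth.
under eq_bigr => i _.
  rewrite (Ex_coord i (g := fun x : R => x ^+ 2)); last first.
    by apply: pgX; [exact: wt1_ge1|exact: pg1_id].
  rewrite normal_second_moment; over.
by rewrite sumr_const card_ord.
Qed.

(** Strong convexity and smoothness squeeze the partial difference quotients
    around the partial derivative, which is thus a limit of Borel functions. *)
Lemma measurable_grad i : measurable_fun [set: tup] (fun t => grad f (vec t) 0 i).
Proof.
pose e : 'rV[R]_d := delta_mx 0 i.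
have de x : dot e x = x 0 i.
  rewrite /dot (bigD1 i)//= mxE !eqxx mul1r big1 ?addr0// => j ji.
  by rewrite mxE (negbTE ji) andbF mul0r.
have mf : measurable_fun [set: tup] (f \o vec) by case: fA1.
apply: (@measurable_fun_cvg _ _ _ _
  (fun n (t : tup) => n.+1%:R * (f (vec t + n.+1%:R^-1 *: e) - f (vec t)))).
  move=> n; apply: measurable_funM => //; apply: measurable_funB => //.
  rewrite (_ : (fun t : tup => _) = (f \o vec) \o aff (n.+1%:R^-1 *: e) 1); last first.
    by apply/funext => t /=; rewrite vec_aff scale1r addrC.
  by apply: measurableT_comp => //; exact: measurable_aff.
move=> t _; set x := vec t; set D := grad f x 0 i.
have bnd n : `|D - n.+1%:R * (f (x + n.+1%:R^-1 *: e) - f x)| <= U / 2 * n.+1%:R^-1.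
  have := A1_lower x (x + n.+1%:R^-1 *: e); have := A1_upper x (x + n.+1%:R^-1 *: e).
  have -> : x + n.+1%:R^-1 *: e - x = n.+1%:R^-1 *: e by rewrite addrC addKr.
  rewrite !dotE !de -/D mxE !eqxx mulr1.
  set h := n.+1%:R^-1; set y := f _; set k : R := n.+1%:R => h1 h2.
  have k0 : 0 < k by rewrite ltr0n.
  have kh : k * h = 1 by rewrite /k /h divff// gt_eqF.
  have h0 : 0 < h by rewrite invr_gt0.
  have {}h1 : k * (y - f x) <= k * (h * D + U / 2 * (h * h)).
    by rewrite ler_pM2l//; lra.
  have {}h2 : k * (h * D + L / 2 * (h * h)) <= k * (y - f x).
    by rewrite ler_pM2l//; lra.
  have e1 : k * (h * D + U / 2 * (h * h)) = (k * h) * (D + U / 2 * h) by ring.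
  have e2 : k * (h * D + L / 2 * (h * h)) = (k * h) * (D + L / 2 * h) by ring.
  rewrite e1 kh mul1r in h1; rewrite e2 kh mul1r in h2.
  have : 0 <= L / 2 * h by rewrite mulr_ge0 ?divr_ge0 ?ltW.
  have : 0 <= U / 2 * h by rewrite mulr_ge0 ?divr_ge0 ?ltW.
  by rewrite ler_norml => ? ?; apply/andP; split; lra.
apply/cvgrPdist_le => eps eps0.
have e' : 0 < (U / 2)^-1 * eps by rewrite mulr_gt0 ?invr_gt0 ?divr_gt0.
near=> n; apply: le_trans (bnd n) _; rewrite -ler_pdivlMl ?divr_gt0//.
apply: ltW; near: n; exact: (near_infty_natSinv_lt (PosNum e')).
Unshelve. all: by end_near.
Qed.

End quadratic_remainder.

(** * Concentration of the quadratic remainder *)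

Section variance_bound.
Context {R : realType} {d : nat}.
Local Notation RM := (measurableTypeR R).
Local Notation tup := (d.-tuple RM).
Local Notation G := (gauss d : probability tup R).
Local Notation W := (@wt R d).
Variables (L U : R) (f : 'rV[R]_d -> R) (th : @state R d).
Hypotheses (hL : 0 < L) (hLU : L <= U) (fA1 : A1 L U f).

Let hU : 0 < U. Proof. exact: lt_le_trans hLU. Qed.
Let W1 : forall t : tup, 1 <= W t := @wt_ge1 R d.
Let wG := @weight_gauss R d.
Let s0 : 0 < sigma th. Proof. exact: expR_gt0. Qed.
Local Notation S2 t := (dot (vec t) (vec t)).
Local Notation Q := (Qz f th).

(** The gradient of [Q] in the sample. *)
Definition gradQ (t : tup) : 'rV[R]_d :=
  2 / sigma th *: (grad f (mean th + sigma th *: vec t) - grad f (mean th)).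

Lemma Qz_ge t : L * S2 t <= Q t.
Proof.
have := A1_lower fA1 (mean th) (mean th + sigma th *: vec t).
have -> : mean th + sigma th *: vec t - mean th = sigma th *: vec t by rewrite addrC addKr.
rewrite /Qz (dotC (grad _ _)); set y := f (_ + _); set m := f (mean th).
rewrite !dotE; set g := dot _ _; set q := dot _ _ => h.
have : 2 / sigma th ^+ 2 * (L / 2 * (sigma th * (sigma th * q))) <=
    2 / sigma th ^+ 2 * (y - m - sigma th * g).
  by rewrite ler_pM2l ?divr_gt0 ?exprn_gt0//; lra.
by apply: le_trans; rewrite le_eqVlt; apply/orP; left; apply/eqP; field; rewrite gt_eqF.
Qed.

Lemma Qz_le t : Q t <= U * S2 t.
Proof.
have := A1_upper fA1 (mean th) (mean th + sigma th *: vec t).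
have -> : mean th + sigma th *: vec t - mean th = sigma th *: vec t by rewrite addrC addKr.
rewrite /Qz (dotC (grad _ _)); set y := f (_ + _); set m := f (mean th).
rewrite !dotE; set g := dot _ _; set q := dot _ _ => h.
have : 2 / sigma th ^+ 2 * (y - m - sigma th * g) <=
    2 / sigma th ^+ 2 * (U / 2 * (sigma th * (sigma th * q))).
  by rewrite ler_pM2l ?divr_gt0 ?exprn_gt0//; lra.
move/le_trans; apply; rewrite le_eqVlt; apply/orP; left; apply/eqP; field; by rewrite gt_eqF.
Qed.

Lemma Qz_ge0 t : 0 <= Q t.
Proof. by apply: le_trans (Qz_ge t); rewrite mulr_ge0 ?dot_ge0 ?ltW. Qed.

Let Q_at (z : 'rV[R]_d) : R := 2 / sigma th ^+ 2 *
  (f (mean th + sigma th *: z) - f (mean th) - dot (grad f (mean th)) (sigma th *: z)).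

Let G_at (z : 'rV[R]_d) : 'rV[R]_d :=
  2 / sigma th *: (grad f (mean th + sigma th *: z) - grad f (mean th)).

Let shift z z' : mean th + sigma th *: z' - (mean th + sigma th *: z) = sigma th *: (z' - z).
Proof. by rewrite opprD addrACA subrr add0r scalerBr. Qed.

Let Q_at_ge z z' : Q_at z + dot (z' - z) (G_at z) <= Q_at z'.
Proof.
have := A1_lower fA1 (mean th + sigma th *: z) (mean th + sigma th *: z').
rewrite shift /Q_at /G_at; set y' := f (_ + _ *: z'); set y := f (_ + _ *: z).
set gm := grad f (mean th); set gy := grad f _; set m := f _.
set q := dot (_ *: (z' - z)) (_ *: (z' - z)).
have Lq : 0 <= L / 2 * q by rewrite mulr_ge0 ?dot_ge0 ?divr_ge0 ?ltW.
rewrite !(dotZl, dotZr, dotDl, dotDr, dotNl, dotNr) (dotC z' gm) (dotC z gm).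
set a := dot z' gy; set b := dot z gy.
set a' := dot gm z'; set b' := dot gm z; set s := sigma th => h.
have : 2 / s ^+ 2 * (y + s * (a - b) - m - s * a') <= 2 / s ^+ 2 * (y' - m - s * a').
  by rewrite ler_pM2l ?divr_gt0 ?exprn_gt0//; lra.
apply: le_trans; rewrite le_eqVlt; apply/orP; left; apply/eqP; field; by rewrite gt_eqF.
Qed.

Let Q_at_le z z' : Q_at z' <= Q_at z + dot (z' - z) (G_at z) + U * dot (z' - z) (z' - z).
Proof.
have := A1_upper fA1 (mean th + sigma th *: z) (mean th + sigma th *: z').
rewrite shift /Q_at /G_at; set y' := f (_ + _ *: z'); set y := f (_ + _ *: z).
set gm := grad f (mean th); set gy := grad f _; set m := f _.
set q := dot (z' - z) (z' - z).
have -> : dot (sigma th *: (z' - z)) (sigma th *: (z' - z)) = sigma th ^+ 2 * q.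
  by rewrite dotZl dotZr mulrA expr2.
rewrite !(dotZl, dotZr, dotDl, dotDr, dotNl, dotNr) (dotC z' gm) (dotC z gm).
set a := dot z' gy; set b := dot z gy.
set a' := dot gm z'; set b' := dot gm z; set s := sigma th => h.
have : 2 / s ^+ 2 * (y' - m - s * a') <=
    2 / s ^+ 2 * (y + s * (a - b) + U / 2 * (s ^+ 2 * q) - m - s * a').
  by rewrite ler_pM2l ?divr_gt0 ?exprn_gt0//; lra.
move/le_trans; apply; rewrite le_eqVlt; apply/orP; left; apply/eqP; field; by rewrite gt_eqF.
Qed.

(** A nonnegative function with a [2 U]-Lipschitz gradient has a squared gradient
    at most [4 U] times its value: compare with a gradient step. *)
Lemma gradQ_sqr_le t : dot (gradQ t) (gradQ t) <= 4 * U ^+ 2 * S2 t.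
Proof.
have step : dot (gradQ t) (gradQ t) <= 4 * U * Q t.
  pose z' := vec t - (2 * U)^-1 *: gradQ t.
  have Q'0 : 0 <= Q_at z'.
    pose t' : tup := [tuple z' 0 i | i < d].
    have -> : z' = vec t' by apply/rowP => i; rewrite [RHS]mxE tnth_mktuple.
    exact: Qz_ge0.
  have := Q_at_le (vec t) z'.
  have -> : z' - vec t = - ((2 * U)^-1 *: gradQ t) by rewrite /z' addrC addKr.
  have dD (D : 'rV[R]_d) (c : R) : (dot (- (c *: D)) D = - (c * dot D D)) *
      (dot (- (c *: D)) (- (c *: D)) = c * (c * dot D D)).
    by split; rewrite ?(dotNl, dotZl) ?(dotNr, dotZr); ring.
  rewrite -[G_at _]/(gradQ t) -[Q_at (vec t)]/(Q t) !dD; set q := dot _ _ => h.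
  have h2 : 0 <= 4 * U * (Q t - (2 * U)^-1 * q + U * ((2 * U)^-1 * ((2 * U)^-1 * q))).
    by apply: mulr_ge0; [rewrite mulr_ge0// ltW|rewrite (le_trans Q'0)//; lra].
  have e : 4 * U * (Q t - (2 * U)^-1 * q + U * ((2 * U)^-1 * ((2 * U)^-1 * q))) = 4 * U * Q t - q.
    by field; rewrite gt_eqF.
  by rewrite e in h2; lra.
apply: (le_trans step); have := Qz_le t => h.
rewrite (_ : 4 * U ^+ 2 * S2 t = 4 * U * (U * S2 t)); last by ring.
by rewrite ler_pM2l// mulr_gt0.
Qed.

Lemma measurable_Qz : measurable_fun [set: tup] Q.
Proof.
have mf : measurable_fun [set: tup] (f \o vec) by case: fA1.
apply: measurable_funM => //; apply: measurable_funB.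
  apply: measurable_funB => //.
  rewrite (_ : (fun t : tup => _) = (f \o vec) \o aff (mean th) (sigma th)); last first.
    by apply/funext => t /=; rewrite vec_aff ?mxE.
  by apply: measurableT_comp => //; exact: measurable_aff.
apply: measurable_sum => i; apply: measurable_funM => //.
by under eq_fun do rewrite !mxE; apply: measurable_funM => //; exact: measurable_tnth.
Qed.

Lemma pg_Qz : pgrowth W Q.
Proof.
apply: (pg_le measurable_Qz (pgZ W1 U (@pg_dot_vec R d))) => t.
rewrite !ger0_norm ?Qz_ge0 ?Qz_le// mulr_ge0 ?dot_ge0//; exact: ltW.
Qed.

Lemma pg_gradQ i : pgrowth W (fun t => gradQ t 0 i).
Proof.
have pS : pgrowth W (fun t => 1 + 4 * U ^+ 2 * S2 t).
  by apply: pgD => //; [exact: pg_cst|apply: pgZ => //; exact: pg_dot_vec].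
apply: (pg_le _ pS) => [|t].
  under eq_fun do rewrite !mxE.
  apply: measurable_funM => //; apply: measurable_funB => //.
  rewrite (_ : (fun t : tup => _) =
    (fun t : tup => grad f (vec t) 0 i) \o aff (mean th) (sigma th)).
    by apply: measurableT_comp; [exact: (measurable_grad hL hLU fA1)|exact: measurable_aff].
  by apply/funext => t /=; rewrite vec_aff ?mxE.
have h := gradQ_sqr_le t.
have hi : (gradQ t 0 i) ^+ 2 <= dot (gradQ t) (gradQ t).
  rewrite /dot (bigD1 i)//= -expr2 lerDl sumr_ge0// => j _.
  by rewrite -expr2 sqr_ge0.
rewrite [leRHS]ger0_norm; last first.
  by rewrite addr_ge0// mulr_ge0 ?dot_ge0// mulr_ge0 ?sqr_ge0.
apply: (@le_trans _ _ (1 + (gradQ t 0 i) ^+ 2)); last by rewrite lerD2l (le_trans hi).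
by rewrite ler_norml; apply/andP; split; nra.
Qed.

Lemma EQzE : EQz f th = \int[G]_t Q t.
Proof. by rewrite /EQz unlock. Qed.

Lemma EQz_bounds : L * d%:R <= EQz f th <= U * d%:R.
Proof.
rewrite EQzE -(@Ex_dot_vec R d) -!(ExZ wG) ?pg_dot_vec//; try exact: pg_dot_vec.
have pS := @pg_dot_vec R d; have pQ := pg_Qz.
by apply/andP; split; apply: (Ex_le wG) => //; try (by apply: pgZ);
  move=> t; [exact: Qz_ge|exact: Qz_le].
Qed.

Lemma VQzE : fine 'V_G[Q] = \int[G]_t (Q t - EQz f th) ^+ 2.
Proof. by rewrite /EQz /variance !unlock. Qed.

Lemma V_std_ge0 : 0 <= V_std f th.
Proof.
rewrite /V_std VQzE divr_ge0 ?sqr_ge0//; apply: Ex_ge0 => t; exact: sqr_ge0.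
Qed.

Definition normal_moment6 : R := \int[@std_normal R]_x x ^+ 6.

Lemma pow_young (a b : R) : a ^+ 2 * b ^+ 4 <= a ^+ 6 + b ^+ 6.
Proof.
have ha : 0 <= a ^+ 2 by exact: sqr_ge0.
have hb : 0 <= b ^+ 2 by exact: sqr_ge0.
have -> : b ^+ 4 = (b ^+ 2) ^+ 2 by ring.
have -> : a ^+ 6 = (a ^+ 2) ^+ 3 by ring.
have -> : b ^+ 6 = (b ^+ 2) ^+ 3 by ring.
move: (a ^+ 2) (b ^+ 2) ha hb => x y x0 y0.
have x3 : 0 <= x ^+ 3 by rewrite exprn_ge0.
have y3 : 0 <= y ^+ 3 by rewrite exprn_ge0.
have [xy|/ltW xy] := leP x y.
  have : 0 <= (y - x) * y ^+ 2 by rewrite mulr_ge0 ?subr_ge0 ?sqr_ge0.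
  by rewrite (_ : _ * _ = y ^+ 3 - x * y ^+ 2); [lra|ring].
have : 0 <= (x - y) * (x + y) * x by rewrite !mulr_ge0 ?subr_ge0 ?addr_ge0.
by rewrite (_ : _ * x = x ^+ 3 - x * y ^+ 2); [lra|ring].
Qed.

(** [tnth t i ^+ 2 <= e / 2 * tnth t i ^+ 4 + (2 * e)^-1] makes the weights
    independent of [i], up to the sum of the fourth powers, so that the squared
    norm of the gradient factors out: it is all that (A1) controls. *)
Lemma sum_gradQ_le (e : R) (t : tup) : 0 < e ->
  \sum_i (gradQ t 0 i ^+ 2 * (1 + tnth t i ^+ 2)) <=
  4 * U ^+ 2 * ((1 + (2 * e)^-1) * S2 t + e * d%:R * \sum_i tnth t i ^+ 6).
Proof.
move=> e0; pose S4 := \sum_i tnth t i ^+ 4.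
have S40 : 0 <= S4 by apply: sumr_ge0 => i _; rewrite exprn_even_ge0.
have c0 : 0 <= 1 + e / 2 * S4 + (2 * e)^-1.
  by rewrite !addr_ge0// ?invr_ge0 ?mulr_ge0// ltW// divr_gt0.
apply: (@le_trans _ _ (\sum_i (gradQ t 0 i ^+ 2 * (1 + e / 2 * S4 + (2 * e)^-1)))).
  apply: ler_sum => i _; apply: ler_wpM2l; first exact: sqr_ge0.
  have hi : tnth t i ^+ 4 <= S4.
    rewrite /S4 (bigD1 i)//= lerDl sumr_ge0// => j _; by rewrite exprn_even_ge0.
  have h : 0 <= (e * tnth t i ^+ 2 - 1) ^+ 2 by exact: sqr_ge0.
  rewrite -addrA lerD2l.
  apply: (@le_trans _ _ (e / 2 * tnth t i ^+ 4 + (2 * e)^-1)); last first.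
    by rewrite lerD2r ler_wpM2l// divr_ge0// ltW.
  rewrite -(@ler_pM2l _ (2 * e)) ?mulr_gt0//.
  rewrite (_ : 2 * e * (e / 2 * tnth t i ^+ 4 + (2 * e)^-1) =
    (e * tnth t i ^+ 2) ^+ 2 + 1); last first.
    by field; rewrite gt_eqF.
  nra.
rewrite -mulr_suml; apply: (@le_trans _ _ (4 * U ^+ 2 * S2 t * (1 + e / 2 * S4 + (2 * e)^-1))).
  apply: ler_wpM2r => //; apply: le_trans (gradQ_sqr_le t).
  by apply: ler_sum => i _; rewrite expr2.
have key : S2 t * S4 <= 2 * d%:R * \sum_i tnth t i ^+ 6.
  rewrite dot_vec /S4 mulr_suml.
  apply: (@le_trans _ _ (\sum_i \sum_j (tnth t i ^+ 6 + tnth t j ^+ 6))).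
    apply: ler_sum => i _; rewrite mulr_sumr; apply: ler_sum => j _; exact: pow_young.
  under eq_bigr do rewrite big_split/= sumr_const card_ord -mulr_natl.
  rewrite big_split/= -mulr_sumr sumr_const card_ord -[X in _ + X]mulr_natl; lra.
rewrite -(mulrA (4 * U ^+ 2)); apply: ler_wpM2l; first by rewrite mulr_ge0 ?sqr_ge0.
move: key; set s6 := \sum_i _; set s2 := dot _ _ => key.
have : e / 2 * (s2 * S4) <= e / 2 * (2 * d%:R * s6).
  by rewrite ler_wpM2l// divr_ge0// ltW.
lra.
Qed.

(** By [poincare_gauss] the variance is of order [d + e d^2], while the mean is at
    least [L d]. *)
Lemma V_std_le (e : R) : 0 < e -> (0 < d)%N ->
  V_std f th <= 4 * U ^+ 2 / L ^+ 2 * ((1 + (2 * e)^-1) / d%:R + e * normal_moment6).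
Proof.
move=> e0 d0; have d0' : 0 < d%:R :> R by rewrite ltr0n.
have pQ := pg_Qz; have pS := @pg_dot_vec R d.
have p6 i : pgrowth W (fun t => tnth t i ^+ 6) by apply: pgX => //; exact: pg_tnth.
have varE : \int[G]_t (Q t - EQz f th) ^+ 2 = \int[G]_t Q t ^+ 2 - (\int[G]_t Q t) ^+ 2.
  rewrite EQzE; set m := \int[G]_t Q t.
  rewrite (_ : \int[G]_t _ = \int[G]_t (Q t ^+ 2 - (2 * m) * Q t + m ^+ 2)); last first.
    by apply: eq_Rintegral => t _; ring.
  rewrite (ExD wG); try pg.
  rewrite (ExB wG); try pg.
  by rewrite Ex_cst (ExZ wG)// -/m; ring.
have pD i : pgrowth W (fun t => gradQ t 0 i ^+ 2 * (1 + tnth t i ^+ 2)).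
  by apply: pgM => //; [apply: pgX => //; exact: pg_gradQ|
    apply: pgD => //; [exact: pg_cst|apply: pgX => //; exact: pg_tnth]].
have poin : \int[G]_t Q t ^+ 2 <= (\int[G]_t Q t) ^+ 2 +
     \sum_i \int[G]_t (gradQ t 0 i ^+ 2 * (1 + tnth t i ^+ 2)).
  apply: poincare_gauss => //; first exact: pg_gradQ.
  move=> t i y; have := Q_at_ge (vec t) (vec (upd t i y)).
  apply: le_trans; rewrite lerD2l le_eqVlt; apply/orP; left; apply/eqP.
  rewrite /dot (bigD1 i)//= !mxE tnth_upd eqxx big1 ?addr0 => [|j ji]; first exact: mulrC.
  by rewrite !mxE tnth_upd (negbTE ji) subrr mul0r.
have bnd : \int[G]_t (Q t - EQz f th) ^+ 2 <=
    4 * U ^+ 2 * ((1 + (2 * e)^-1) * d%:R + e * d%:R * (d%:R * normal_moment6)).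
  rewrite varE; apply: (@le_trans _ _ (\sum_i \int[G]_t (gradQ t 0 i ^+ 2 * (1 + tnth t i ^+ 2)))).
    by lra.
  rewrite -(Ex_sum wG)//.
  apply: (@le_trans _ _ (\int[G]_t
    (4 * U ^+ 2 * ((1 + (2 * e)^-1) * S2 t + e * d%:R * \sum_i tnth t i ^+ 6)))).
    apply: (Ex_le wG); [exact: pg_sum| |by move=> t; exact: sum_gradQ_le].
    apply: pgZ => //; apply: pgD => //; apply: pgZ => //; exact: pg_sum.
  have p6s : pgrowth W (fun t => \sum_i tnth t i ^+ 6) by exact: pg_sum.
  rewrite (ExZ wG); last by apply: pgD => //; exact: pgZ.
  rewrite (ExD wG); try exact: pgZ.
  rewrite !(ExZ wG)// Ex_dot_vec (Ex_sum wG)//.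
  under eq_bigr => i _.
    rewrite (Ex_coord i (g := fun x : R => x ^+ 6)); last first.
      by apply: pgX; [exact: wt1_ge1|exact: pg1_id].
    rewrite -/normal_moment6; over.
  by rewrite /= sumr_const card_ord -[normal_moment6 *+ d]mulr_natl.
rewrite /V_std VQzE; have /andP[E1 _] := EQz_bounds.
have Ld : 0 < L * d%:R by rewrite mulr_gt0.
rewrite ler_pdivrMr ?exprn_gt0 ?(lt_le_trans Ld)//.
apply: (le_trans bnd).
set c := (1 + (2 * e)^-1) / d%:R + e * normal_moment6.
have c0 : 0 <= c.
  have M60 : 0 <= normal_moment6 by apply: Ex_ge0 => x; rewrite exprn_even_ge0.
  apply: addr_ge0; last by rewrite mulr_ge0// ltW.
  by rewrite divr_ge0// addr_ge0// invr_ge0 mulr_ge0// ltW.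
apply: (@le_trans _ _ (4 * U ^+ 2 / L ^+ 2 * c * (L * d%:R) ^+ 2)); last first.
  apply: ler_wpM2l.
    by rewrite mulr_ge0// divr_ge0 ?sqr_ge0// mulr_ge0 ?sqr_ge0.
  by rewrite ler_sqr ?nnegrE ?(le_trans _ E1)// ltW.
rewrite le_eqVlt; apply/orP; left; apply/eqP; rewrite /c; field.
by rewrite !gt_eqF ?exprn_gt0.
Qed.

End variance_bound.

(** In [V_std_le], take [e] small first and then [d] large. *)
Lemma V_std_small {R : realType} (L U e : R) : 0 < L -> L <= U -> 0 < e ->
  exists D : nat, forall d, (D <= d)%N -> forall f : 'rV[R]_d -> R, A1 L U f ->
    forall th, V_std f th <= e.
Proof.
move=> L0 LU e0; have U0 : 0 < U by lra.
pose C := 4 * U ^+ 2 / L ^+ 2.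
have C0 : 0 < C by rewrite divr_gt0 ?exprn_gt0// mulr_gt0// exprn_gt0.
have M60 : 0 <= @normal_moment6 R by apply: Ex_ge0 => x; rewrite exprn_even_ge0.
pose a := e / (2 * C * (1 + normal_moment6)).
have M61 : 0 < 1 + @normal_moment6 R by rewrite ltr_wpDr.
have a0 : 0 < a by rewrite /a divr_gt0// mulr_gt0// mulr_gt0.
pose b := (1 + (2 * a)^-1).
have b0 : 0 < b by rewrite /b addr_gt0// invr_gt0 mulr_gt0.
have [D _ hD] := @nbhs_infty_ger R (2 * C * b / e).
exists D.+1 => d Dd f fA1 th.
have d0 : (0 < d)%N by apply: leq_trans Dd.
apply: le_trans (V_std_le th L0 LU fA1 a0 d0) _.
rewrite -/C -/b; have d0' : 0 < d%:R :> R by rewrite ltr0n.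
have := hD d (ltnW Dd); rewrite /= ler_pdivrMr// => h.
have h1 : C * (b / d%:R) <= e / 2 by rewrite mulrA ler_pdivrMr//; lra.
have h2 : C * (a * normal_moment6) <= e / 2.
  rewrite /a (_ : C * _ = e / 2 * (normal_moment6 / (1 + normal_moment6))); last first.
    by field; rewrite !gt_eqF.
  rewrite ler_piMr//; first by rewrite divr_ge0// ltW.
  by rewrite ler_pdivrMr; lra.
rewrite mulrDr; lra.
Qed.

(** * Half-spaces and [kappa_inf] *)

Section half_space.
Context {R : realType} {d : nat}.
Local Notation RM := (measurableTypeR R).
Local Notation tup := (d.-tuple RM).
Local Notation G := (gauss d : probability tup R).
Local Notation W := (@wt R d).
Variables (L U : R) (f : 'rV[R]_d -> R).
Hypotheses (hL : 0 < L) (hLU : L <= U) (fA1 : A1 L U f).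

Let W1 : forall t : tup, 1 <= W t := @wt_ge1 R d.
Let wG := @weight_gauss R d.

Section fixed_state.
Variable th : @state R d.
Hypothesis th0 : Theta0 th.
Local Notation Q := (Qz f th).
Let g i := grad f (mean th) 0 i.
Let A := [set t | z_e f th t <= 0].

Lemma tdot_vec (t : tup) : dot (vec t) (grad f (mean th)) = tdot g t.
Proof. by apply: eq_bigr => i _; rewrite mxE mulrC. Qed.

Lemma z_e_le0 t : (z_e f th t <= 0) = (tdot g t <= 0).
Proof.
have g0 := grad_neq0 hL fA1 th0.
have n0 : 0 < enorm (grad f (mean th)).
  rewrite sqrtr_gt0 lt_def dot_ge0 andbT; apply: contraNneq g0 => /dot_eq0 ->.
  exact: eqxx.
by rewrite /z_e pmulr_lle0 ?invr_gt0// tdot_vec.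
Qed.

Let AE : A = [set t | tdot g t <= 0].
Proof. by apply/seteqP; split=> t /=; rewrite /A/= z_e_le0. Qed.

Lemma measurable_half : measurable A.
Proof.
rewrite AE (_ : [set t | _] = tdot g @^-1` `]-oo, 0]%classic); last first.
  by apply/seteqP; split => t /=; rewrite in_itv.
rewrite -[X in measurable X]setTI; apply: measurable_tdot => //.
Qed.

(** The sign flip [z |-> - z] exchanges the two closed half-spaces, which
    overlap in a null hyperplane. *)
Lemma Ex_half : \int[G]_t \1_A t = 2^-1.
Proof.
have mA := measurable_half.
pose B : set tup := [set t | 0 <= tdot g t].
pose H : set tup := [set t | tdot g t = 0].
have mH : measurable H by exact: measurable_hyperplane.
have mB : measurable B.
  rewrite /B (_ : [set t | _] = tdot g @^-1` `[0, +oo[%classic); last first.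
    by apply/seteqP; split => t /=; rewrite in_itv/= andbT.
  by rewrite -[X in measurable X]setTI; apply: measurable_tdot.
have pA : pgrowth W (\1_A) by exact: pg_indic.
have pB : pgrowth W (\1_B) by exact: pg_indic.
have pH : pgrowth W (\1_H) by exact: pg_indic.
have AB : \int[G]_t \1_A t = \int[G]_t \1_B t.
  rewrite -(Ex_flip (fun=> true) pA); apply: eq_Rintegral => t _.
  have tN : tdot g (flip (fun=> true) t) = - tdot g t.
    rewrite /tdot -sumrN; apply: eq_bigr => i _; rewrite tnth_flip; ring.
  rewrite !indicE; congr ((nat_of_bool _)%:R); apply/idP/idP; rewrite !inE AE /B /= tN; lra.
have H0 : \int[G]_t \1_H t = 0.
  apply: Ex_hyperplane; apply/not_existsP => h.
  have := grad_neq0 hL fA1 th0; rewrite -[X in X != _]/(grad f (mean th)).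
  move/eqP; apply; apply/rowP => i; rewrite [RHS]mxE.
  by have /negP/negPn/eqP := h i.
have : \int[G]_t (\1_A t + \1_B t) = \int[G]_t (1 + \1_H t).
  apply: eq_Rintegral => t _; rewrite !indicE.
  have eA : (t \in A) = (tdot g t <= 0) by rewrite AE; apply/idP/idP; rewrite inE.
  have eB : (t \in B) = (0 <= tdot g t) by apply/idP/idP; rewrite inE.
  have eH : (t \in H) = (tdot g t == 0) by apply/idP/idP; rewrite inE /H /= => /eqP.
  by rewrite eA eB eH; case: (ltrgtP (tdot g t) 0) => _ /=; rewrite ?addr0 ?add0r//.
rewrite (ExD wG)// (ExD wG)//; last exact: pg_cst.
rewrite Ex_cst H0 -AB; lra.
Qed.

Lemma EQz_negE : EQz_neg f th = \int[G]_t (Q t * \1_A t).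
Proof. by rewrite /EQz_neg unlock. Qed.

(** By Cauchy-Schwarz, the correlation of [Q] with the half-space indicator is
    of the order of the standard deviation of [Q]; without correlation, half of
    the mean of [Q] would lie on each side. *)
Lemma EQz_neg_close (v : R) : (0 < d)%N -> 0 <= v -> V_std f th <= v ^+ 2 ->
  `|EQz_neg f th - EQz f th / 2| <= v / 2 * EQz f th.
Proof.
move=> d0 v0 hV; have /andP[E1 _] := EQz_bounds th hL hLU fA1.
have E0 : 0 < EQz f th by apply: lt_le_trans E1; rewrite mulr_gt0// ltr0n.
have pQ : pgrowth W Q := pg_Qz th hL hLU fA1.
have pA : pgrowth W (\1_A) := pg_indic W measurable_half.
set mu := EQz f th in E1 E0 *.
have pc : pgrowth W (fun t => (Q t - mu) * (\1_A t - 2^-1)) by pg.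
have -> : EQz_neg f th - mu / 2 = \int[G]_t ((Q t - mu) * (\1_A t - 2^-1)).
  rewrite (_ : \int[G]_t ((Q t - mu) * (\1_A t - 2^-1)) = \int[G]_t
     (Q t * \1_A t - mu * \1_A t - 2^-1 * Q t + mu / 2)); last first.
    by apply: eq_Rintegral => t _; ring.
  have p1 : pgrowth W (fun t => Q t * \1_A t) by pg.
  have p2 : pgrowth W (fun t => mu * \1_A t) by pg.
  have p3 : pgrowth W (fun t => 2^-1 * Q t) by pg.
  rewrite (ExD wG); try pg.
  rewrite (ExB wG); try pg.
  rewrite (ExB wG); try pg.
  rewrite Ex_cst (ExZ wG)// (ExZ wG)// Ex_half -EQz_negE -(EQzE f th) -/mu; lra.
have h := Ex_sqr wG pc.
have h2 : \int[G]_t ((Q t - mu) * (\1_A t - 2^-1)) ^+ 2 <= (v / 2 * mu) ^+ 2.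
  rewrite (_ : \int[G]_t _ = \int[G]_t (4^-1 * (Q t - mu) ^+ 2)); last first.
    apply: eq_Rintegral => t _; rewrite indicE exprMn mulrC; congr (_ * _).
    by case: (t \in A) => /=; lra.
  have p2 : pgrowth W (fun t => (Q t - mu) ^+ 2) by pg.
  rewrite (ExZ wG)// -VQzE.
  have : fine 'V_G[Q] <= v ^+ 2 * mu ^+ 2.
    by rewrite -ler_pdivrMr ?exprn_gt0.
  rewrite exprMn; lra.
rewrite -ler_sqr ?nnegrE ?mulr_ge0 ?divr_ge0 ?(ltW E0)//.
by rewrite -normrX ger0_norm ?sqr_ge0// (le_trans h).
Qed.

End fixed_state.

Hypothesis d0 : (0 < d)%N.

Lemma Theta0_neq0 : @Theta0 R d !=set0.
Proof.
exists (const_mx 1, 0); rewrite /Theta0 /= /mean /=; apply/eqP.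
move=> /rowP /(_ (Ordinal d0)); rewrite !mxE => /eqP; by rewrite oner_eq0.
Qed.

Lemma E_Q_bounds : L * d%:R <= E_Q f <= U * d%:R.
Proof.
have [th th0] := Theta0_neq0.
have ub : ubound [set EQz f th | th in @Theta0 R d] (U * d%:R).
  by move=> _ [th' _ <-]; have /andP[] := EQz_bounds th' hL hLU fA1.
apply/andP; split; last by apply: ge_sup => //; exists (EQz f th), th.
have /andP[h _] := EQz_bounds th hL hLU fA1.
apply: (le_trans h); apply: ub_le_sup; last by exists th.
by exists (U * d%:R).
Qed.

Lemma kappa_bounds (v : R) : 0 <= v < 1 ->
  (forall th, Theta0 th -> V_std f th <= v ^+ 2) ->
  2 / (1 + v) <= kappa_inf f <= 2 / (1 - v).
Proof.
move=> /andP[v0 v1] hV.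
have bnd th : Theta0 th -> 2 / (1 + v) <= EQz f th / EQz_neg f th <= 2 / (1 - v).
  move=> th0; have := EQz_neg_close th0 d0 v0 (hV _ th0).
  have /andP[E1 _] := EQz_bounds th hL hLU fA1.
  have E0 : 0 < EQz f th by apply: lt_le_trans E1; rewrite mulr_gt0// ltr0n.
  move: (EQz f th) (EQz_neg f th) E0 => E N E0.
  rewrite ler_norml => /andP[h1 h2].
  have N0 : 0 < N by nra.
  apply/andP; split.
    rewrite ler_pdivlMr// mulrAC ler_pdivrMr; lra.
  rewrite ler_pdivrMr// mulrAC ler_pdivlMr; lra.
have [th th0] := Theta0_neq0.
apply/andP; split.
  apply: lb_le_inf; first by exists (EQz f th / EQz_neg f th), th.
  by move=> _ [th' th'0 <-]; have /andP[] := bnd _ th'0.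
have /andP[_ h] := bnd _ th0; apply: le_trans h; apply: ge_inf; last by exists th.
by exists (2 / (1 + v)) => _ [th' th'0 <-]; have /andP[] := bnd _ th'0.
Qed.

End half_space.

(** * Quadratic forms *)

Section quadratic_form.
Context {R : realType} {d : nat}.
Local Notation RM := (measurableTypeR R).
Local Notation tup := (d.-tuple RM).
Local Notation G := (gauss d : probability tup R).
Local Notation W := (@wt R d).
Let W1 : forall t : tup, 1 <= W t := @wt_ge1 R d.
Let wG := @weight_gauss R d.

Lemma Ex_coordM (i j : 'I_d) :
  \int[G]_t (tnth t i * tnth t j) = (i == j)%:R.
Proof.
have [->|ij] := eqVneq i j.
  rewrite -[RHS](@normal_second_moment R) -(Ex_coord j (g := fun x : R => x ^+ 2)); last first.
    by apply: pgX; [exact: wt1_ge1|exact: pg1_id].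
  by apply: eq_Rintegral => t _; rewrite expr2.
have pij : pgrowth W (fun t => tnth t i * tnth t j).
  by apply: pgM => //; exact: pg_tnth.
have := Ex_flip (fun k => k == i) pij.
rewrite (_ : \int[G]_t _ = \int[G]_t (-1 * (tnth t i * tnth t j))); last first.
  apply: eq_Rintegral => t _; rewrite !tnth_flip eqxx eq_sym (negbTE ij); ring.
by rewrite (ExZ wG)// mulr0n; lra.
Qed.

Section form.
Variable H : 'M[R]_d.
Hypothesis symH : H^T = H.
Definition quad (x : 'rV[R]_d) : R := 2^-1 * (x *m H *m x^T) 0 0.

Lemma quadE x y : (x *m H *m y^T) 0 0 = dot (x *m H) y.
Proof. by rewrite mxE; apply: eq_bigr => i _; rewrite !mxE. Qed.

Lemma dot_sym x y : dot (x *m H) y = dot (y *m H) x.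
Proof.
rewrite -!quadE; have -> : x *m H *m y^T = (y *m H *m x^T)^T.
  by rewrite !trmx_mul trmxK symH mulmxA.
by rewrite mxE.
Qed.

Lemma quadD x y : quad (x + y) = quad x + dot (x *m H) y + quad y.
Proof.
rewrite /quad !quadE mulmxDl !(dotDl, dotDr) (dot_sym y x); lra.
Qed.

Lemma quadZ a x : quad (a *: x) = a ^+ 2 * quad x.
Proof. by rewrite /quad !quadE -scalemxAl dotZl dotZr; ring. Qed.

Lemma grad_quad x : grad quad x = x *m H.
Proof.
apply/rowP => i; rewrite mxE; set e := delta_mx 0 i.
have de z : dot z e = z 0 i.
  rewrite /dot (bigD1 i)//= mxE !eqxx mulr1 big1 ?addr0// => j ji.
  by rewrite mxE (negbTE ji) andbF mulr0.
rewrite /derive; apply: cvg_lim => //.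
have -> : (x *m H) 0 i = (x *m H) 0 i + 0 * quad e by rewrite mul0r addr0.
apply: cvg_trans (_ : ((x *m H) 0 i + h * quad e @[h --> 0^']) --> _).
  apply: near_eq_cvg; near=> h.
  have h0 : h != 0 by near: h; exact: nbhs_dnbhs_neq.
  rewrite /= [_ *: _ + x]addrC quadD quadZ dotZr de.
  by rewrite /GRing.scale /=; field.
apply: cvgD; first exact: cvg_cst.
apply: cvgM; last exact: cvg_cst.
exact: nbhs_dnbhs.
Unshelve. all: by end_near.
Qed.

Lemma Qz_quad (th : @state R d) t : Qz quad th t = dot (vec t *m H) (vec t).
Proof.
rewrite /Qz grad_quad quadD; set s := sigma th.
have s0 : s != 0 by rewrite gt_eqF// expR_gt0.
rewrite (_ : quad (s *: vec t) = s ^+ 2 / 2 * dot (vec t *m H) (vec t)); last first.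
  by rewrite quadZ /quad quadE; ring.
by field.
Qed.

(** The coordinates being orthonormal, the mean of the form is its trace. *)
Lemma EQz_quad th : EQz quad th = \tr H.
Proof.
rewrite EQzE; transitivity (\int[G]_t (\sum_i \sum_j H j i * (tnth t i * tnth t j))).
  apply: eq_Rintegral => t _; rewrite Qz_quad /dot; apply: eq_bigr => i _.
  rewrite !mxE mulr_suml; apply: eq_bigr => j _; rewrite !mxE; ring.
have pij i j : pgrowth W (fun t => tnth t i * tnth t j).
  by apply: pgM => //; exact: pg_tnth.
rewrite (Ex_sum wG); last by move=> i; apply: pg_sum => // j; exact: pgZ.
apply: eq_bigr => i _; rewrite (Ex_sum wG); last by move=> j; exact: pgZ.
rewrite (bigD1 i)//= big1 ?addr0 => [|j ji].
  by rewrite (ExZ wG)// Ex_coordM eqxx mulr1.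
by rewrite (ExZ wG)// Ex_coordM eq_sym (negbTE ji) mulr0.
Qed.

Lemma E_Q_quad : (0 < d)%N -> E_Q quad = \tr H.
Proof.
move=> d0; rewrite /E_Q -[RHS]sup1; congr sup; apply/seteqP; split => r /=.
  by move=> [th _ <-]; rewrite EQz_quad.
move=> ->; have [th th0] := @Theta0_neq0 R _ d0.
by exists th => //; rewrite EQz_quad.
Qed.

End form.

(** Isotropic quadratics realise every admissible value of [E_Q / d]. *)
Definition isoquad (c : R) : 'rV[R]_d -> R := quad c%:M.

Lemma isoquadE c x : isoquad c x = c / 2 * dot x x.
Proof. by rewrite /isoquad /quad quadE mul_mx_scalar dotZl; ring. Qed.

Lemma isoquad_A1 (L U c : R) : 0 < L -> L <= c <= U -> A1 L U (isoquad c).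
Proof.
move=> L0 /andP[Lc cU]; have c0 : 0 < c by lra.
have gE : grad (isoquad c) = fun x => c *: x.
  by apply/funext => x; rewrite grad_quad ?tr_scalar_mx// mul_mx_scalar.
split.
- rewrite /borel_fun (_ : _ \o _ = fun t : tup => c / 2 * \sum_i tnth t i ^+ 2); last first.
    by apply/funext => t /=; rewrite isoquadE dot_vec.
  apply: measurable_funM => //; apply: measurable_sum => i.
  by apply: measurable_funX; exact: measurable_tnth.
- split; last by rewrite gE => x; exact: scaler_continuous.
  move=> x; rewrite (_ : isoquad c =
    (fun=> c / 2) * (\sum_i (fun y : 'rV[R]_d => y 0 i * y 0 i))); last first.
    apply/funext => y; rewrite isoquadE /=; congr (_ * _).
    by rewrite fct_sumE.
  apply: differentiableM; first exact: differentiable_cst.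
  apply: differentiable_sum => i.
  by apply: differentiableM; exact: differentiable_coord.
- move=> x y; rewrite gE enorm_sqr !isoquadE.
  have q0 := dot_ge0 (y - x).
  have -> : dot (x - y) (x - y) = dot (y - x) (y - x) by rewrite -opprB dotNl dotNr opprK.
  have e : c / 2 * dot y y = c / 2 * dot x x + dot (y - x) (c *: x) + c / 2 * dot (y - x) (y - x).
    rewrite !(dotZr, dotDl, dotDr, dotNl, dotNr) (dotC y x); by field.
  rewrite e; move: (dot (y - x) (y - x)) q0 => q q0.
  have : 0 <= (c - L) * q by rewrite mulr_ge0// subr_ge0.
  have : 0 <= (U - c) * q by rewrite mulr_ge0// subr_ge0.
  by move=> h1 h2; split; lra.
- have i0 : isoquad c 0 = 0 by rewrite isoquadE dot0l mulr0.
  split=> [y|y /(_ 0)]; first by rewrite i0 isoquadE mulr_ge0 ?dot_ge0// divr_ge0// ltW.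
  rewrite i0 isoquadE pmulr_rle0 ?divr_gt0// => h; apply: dot_eq0.
  by apply/eqP; rewrite eq_le h dot_ge0.
- by rewrite isoquadE dot0l mulr0.
Qed.

Lemma E_Q_isoquad c : (0 < d)%N -> E_Q (isoquad c) = c * d%:R.
Proof.
by move=> d0; rewrite E_Q_quad ?tr_scalar_mx// mxtrace_scalar mulr_natr.
Qed.

(** The infimum over the class can thus be tested on [f] itself. *)
Lemma T_class_refl (L U gamma : R) f : A1 L U f -> T_class gamma f (f : 'rV[R]_d -> R).
Proof.
move=> [_ _ _ fmin _]; exists 0; split => //; exists id; split => // x _.
by rewrite subr0.
Qed.

End quadratic_form.

(** * The normal distribution function and its quantiles *)

Section normal_cdf.
Context {R : realType}.
Local Notation RM := (measurableTypeR R).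
Local Notation N01 := (@std_normal R).
Local Notation mu := (@lebesgue_measure R).
Implicit Types (a b x p q : R).

Let N01_fin (A : set RM) : measurable A -> N01 A \is a fin_num.
Proof. by move=> mA; exact: fin_num_measure. Qed.

Lemma PhiE_Ex x : Phi x = \int[N01]_t \1_(`]-oo, x]%classic) t.
Proof. by rewrite /Rintegral integral_indic// setIT. Qed.

Lemma Phi_itv a b : a <= b -> Phi b - Phi a = fine (N01 `]a, b]%classic).
Proof.
move=> ab; rewrite /Phi (_ : `]-oo, b]%classic = `]-oo, a]%classic `|` `]a, b]%classic :> set RM).
  rewrite measureU//; last first.
    apply/seteqP; split => t //= []; rewrite !in_itv/= => ta /andP[at' _].
    by move: at'; rewrite ltNge ta.
  by rewrite fineD ?N01_fin// addrC addKr.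
apply/seteqP; split => t /=; rewrite !in_itv/=.
  by move=> tb; have [ta|ta] := leP t a; [left|right].
by case=> [/le_trans|/andP[_]//]; apply.
Qed.

Lemma normal_pdf_le1 x : normal_pdf 0 1 x <= 1.
Proof.
apply: le_trans (@normal_pdf_ub R 0 1 x (oner_neq0 _)) _.
rewrite /normal_peak expr1n mul1r.
have p2 : 1 <= pi *+ 2 :> R by rewrite mulr2n; have := pi_ge2 R; lra.
have s1 : 1 <= Num.sqrt (pi *+ 2) :> R by rewrite -[leLHS]sqrtr1 ler_wsqrtr.
by rewrite invf_le1// (lt_le_trans _ s1).
Qed.

Lemma N01_itvE a b : fine (N01 `]a, b]%classic) =
  \int[mu]_(x in `]a, b]) normal_pdf 0 1 x.
Proof. by []. Qed.

Let integrable_pdf a b : mu.-integrable `]a, b]%classic (EFin \o normal_pdf (0:R) 1).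
Proof. by apply: (integrableS measurableT) => //; exact: integrable_normal_pdf. Qed.

Let Rintegral_cst_itv a b c : a <= b -> \int[mu]_(x in `]a, b]) c = c * (b - a).
Proof.
move=> ab; rewrite Rintegral_cst//.
rewrite [X in fine X](_ : _ = (b - a)%:E)//.
have := lebesgue_measure_itv `]a, b]; rewrite /= lte_fin => ->.
by move: ab; rewrite le_eqVlt => /orP[/eqP ->|->]; rewrite ?ltxx ?subrr// -EFinD.
Qed.

Lemma integrable_cst_itv a b c : mu.-integrable `]a, b]%classic (EFin \o (fun=> c)).
Proof.
apply: measurable_bounded_integrable => //.
  by have := lebesgue_measure_itv `]a, b]; rewrite /= => ->; case: ifP => _; rewrite ?ltry.
by exists `|c|; split; [exact: num_real|move=> M cM x _ /=; exact: ltW].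
Qed.

Lemma Phi_lip a b : a <= b -> Phi b - Phi a <= b - a.
Proof.
move=> ab; rewrite Phi_itv// N01_itvE -[leRHS]mul1r -Rintegral_cst_itv//.
apply: le_Rintegral => //; first exact: integrable_cst_itv.
by move=> x _; exact: normal_pdf_le1.
Qed.

(** On [[- M, M]] the density is smallest at the endpoints. *)
Lemma Phi_gap a b M : - M <= a -> a <= b -> b <= M ->
  normal_pdf 0 1 M * (b - a) <= Phi b - Phi a.
Proof.
move=> Ma ab bM; rewrite Phi_itv// N01_itvE -Rintegral_cst_itv//.
apply: le_Rintegral => //; first exact: integrable_cst_itv.
move=> x; rewrite /= in_itv/= => /andP[ax xb].
rewrite !normal_pdf0E ?oner_neq0// /gauss_dens.
rewrite ler_wpM2l ?invr_ge0 ?sqrtr_ge0// ler_expR; apply: ler_wpM2r.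
  by rewrite expr1n invr_ge0.
rewrite lerN2 -[leLHS]real_normK ?num_real// -[leRHS]real_normK ?num_real//.
rewrite ler_sqr ?nnegrE// (ger0_norm (_ : 0 <= M)); last by lra.
by rewrite ler_norml; apply/andP; split; lra.
Qed.

Lemma normal_pdf_gt0 x : 0 < normal_pdf (0:R) 1 x.
Proof.
rewrite normal_pdf0E ?oner_neq0// mulr_gt0 ?expR_gt0// invr_gt0 sqrtr_gt0.
by rewrite expr1n mul1r mulrn_wgt0// pi_gt0.
Qed.

Lemma Phi_lt a b : a < b -> Phi a < Phi b.
Proof.
move=> ab; rewrite -subr_gt0.
have := @Phi_gap a b (`|a| + `|b|); have := ler_norm a; have := ler_norm b.
have := ler_norm (- a); rewrite normrN; have := normr_ge0 b; have := normr_ge0 a.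
move=> *; apply: lt_le_trans (_ : normal_pdf 0 1 (`|a| + `|b|) * (b - a) <= _).
  by rewrite mulr_gt0 ?normal_pdf_gt0// subr_gt0.
by apply: Phi_gap; lra.
Qed.

Lemma Phi_ltE a b : (Phi a < Phi b) = (a < b).
Proof.
apply/idP/idP; last exact: Phi_lt.
by apply: contraTT; rewrite -!leNgt le_eqVlt => /orP[/eqP ->//|/Phi_lt/ltW].
Qed.

Lemma Phi_leE a b : (Phi a <= Phi b) = (a <= b).
Proof. by rewrite !leNgt Phi_ltE. Qed.

Lemma Phi_inj : injective (@Phi R).
Proof.
by move=> a b e; apply/eqP; rewrite eq_le -(Phi_leE a b) -(Phi_leE b a) e lexx.
Qed.

Lemma PhiN x : Phi (- x) = 1 - Phi x.
Proof.
have e1 : N01 `]-oo, - x]%classic = N01 `[x, +oo[%classic.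
  rewrite -(std_normalN (A := `]-oo, - x]%classic))// /pushforward.
  congr (N01 _); apply/seteqP; split => t /=; rewrite !in_itv/= andbT; lra.
have e2 : N01 `[x, +oo[%classic = N01 `]x, +oo[%classic.
  rewrite (_ : `[x, +oo[%classic = [set x] `|` `]x, +oo[%classic :> set RM); last first.
    apply/seteqP; split => t /=; rewrite !in_itv/= !andbT.
      by rewrite le_eqVlt => /orP[/eqP ->|]; [left|right].
    by case=> [->//|/ltW].
  rewrite measureU//; last first.
    by apply/seteqP; split => t //= [->]; rewrite in_itv/= ltxx.
  by rewrite [X in (X + _)%E](_ : _ = 0%E) ?add0e//; exact: normal_set1.
have e3 : N01 `]x, +oo[%classic = (1 - N01 `]-oo, x]%classic)%E.
  rewrite -(@probability_setC _ _ _ N01)//; congr (N01 _).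
  by rewrite setCitvl.
by rewrite /Phi e1 e2 e3 fineB ?N01_fin.
Qed.

Lemma Phi0 : Phi 0 = 2^-1 :> R.
Proof. by have := PhiN 0; rewrite oppr0; lra. Qed.

Lemma Phi_ge0 x : 0 <= Phi x.
Proof. by rewrite /Phi fine_ge0. Qed.

Lemma Phi_gt0 x : 0 < Phi x.
Proof. by apply: le_lt_trans (Phi_ge0 (x - 1)) _; apply: Phi_lt; lra. Qed.

Lemma Phi_lt1 x : Phi x < 1.
Proof. by have := Phi_gt0 (- x); rewrite PhiN; lra. Qed.

(** Chebyshev's inequality: the tails of [Phi] vanish. *)
Lemma Phi_tail x : 0 < x -> 1 - x ^- 2 <= Phi x.
Proof.
move=> x0; have wN := @weight_normal R.
have pid2 : pgrowth wt1 (fun t : R => t ^+ 2) := pgX (@wt1_ge1 R) 2 (@pg1_id R).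
have mI : measurable (`]-oo, x]%classic : set RM) by [].
have pxt : pgrowth wt1 (fun t : R => x ^- 2 * t ^+ 2) by apply: pgZ => //; exact: wt1_ge1.
have -> : 1 - x ^- 2 = \int[N01]_t (1 - x ^- 2 * t ^+ 2).
  rewrite (ExB wN)//; last exact: pg_cst.
  by rewrite Ex_cst (ExZ wN)// normal_second_moment mulr1.
rewrite PhiE_Ex; apply: (Ex_le wN).
- by apply: pgB => //; [exact: wt1_ge1|exact: pg_cst].
- exact: pg_indic.
- move=> t; rewrite indicE; case: (boolP (t \in _)) => tx /=.
    by rewrite lerBlDr lerDl mulr_ge0 ?sqr_ge0// invr_ge0 sqr_ge0.
  have {tx} : x < t by move: tx; rewrite notin_setE /= in_itv/= => /negP; rewrite -ltNge.
  move=> xt; rewrite subr_le0 mulrC ler_pdivlMr ?exprn_gt0// mul1r.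
  by rewrite ler_sqr ?nnegrE; lra.
Qed.

Lemma Phi_surj p : 0 < p < 1 -> exists x, Phi x = p.
Proof.
move=> /andP[p0 p1]; pose x := 1 / p + 1 / (1 - p) + 1.
have i0 : 0 < 1 / p by rewrite divr_gt0.
have i1 : 0 < 1 / (1 - p) by rewrite divr_gt0 ?subr_gt0.
have x1 : 1 < x by rewrite /x; lra.
have small c : 0 < c -> 1 / c <= x -> x ^- 2 <= c.
  move=> c0 cx; have h : 1 <= c * x by rewrite mulrC -ler_pdivrMr.
  rewrite -[X in X <= _]mul1r ler_pdivrMr ?exprn_gt0//; last by lra.
  rewrite expr2 mulrA; apply: (le_trans h); rewrite ler_peMr; lra.
have tail := Phi_tail (lt_trans ltr01 x1).
have h1 : p <= Phi x.
  have : x ^- 2 <= 1 - p by apply: small; rewrite ?subr_gt0// /x; lra.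
  lra.
have h2 : Phi (- x) <= p.
  have : x ^- 2 <= p by apply: small; rewrite // /x; lra.
  rewrite PhiN; lra.
have [c _ <-] : exists2 c, c \in `[- x, x] & Phi c = p.
  apply: IVT; first by lra.
    apply: continuous_subspaceT => y; apply/cvgrPdist_le => e e0.
    near=> z; have : `|y - z| <= e by near: z; apply: cvgr_dist_le.
    apply: le_trans; have [yz|/ltW yz] := leP y z.
      rewrite ler0_norm ?subr_le0 ?Phi_leE// [leRHS]ler0_norm ?subr_le0//.
      by rewrite !opprB Phi_lip.
    by rewrite ger0_norm ?subr_ge0 ?Phi_leE// [leRHS]ger0_norm ?subr_ge0// Phi_lip.
  by rewrite min_l ?max_r ?h1 ?h2// Phi_leE; lra.
by exists c.
Unshelve. all: by end_near.
Qed.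

Lemma Phi_invK p : 0 < p < 1 -> Phi (Phi_inv p) = p.
Proof.
by move=> /Phi_surj[x xp]; rewrite /Phi_inv; case: xgetP => [y _ /= ->//|/(_ x)].
Qed.

Lemma PhiK x : Phi_inv (Phi x) = x.
Proof. by apply: Phi_inj; rewrite Phi_invK// Phi_gt0 Phi_lt1. Qed.

(** Upper quantile: [q = Phi (- Psi q)]. *)
Definition Psi q : R := Phi_inv (1 - q).

Lemma Psi_Phi x : Psi (Phi (- x)) = x.
Proof. by rewrite /Psi -PhiN opprK PhiK. Qed.

Lemma Phi_Psi q : 0 < q < 1 -> Phi (- Psi q) = q.
Proof. by move=> q01; rewrite PhiN Phi_invK; lra. Qed.

Lemma Phi_inv_Psi q : 0 < q < 1 -> Phi_inv q = - Psi q.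
Proof. by move=> q01; rewrite -[in LHS](Phi_Psi q01) PhiK. Qed.

Lemma Psi_lt p q : 0 < p < 1 -> 0 < q < 1 -> (Psi p < Psi q) = (q < p).
Proof.
by move=> p01 q01; rewrite -[in RHS](Phi_Psi p01) -[in RHS](Phi_Psi q01) Phi_ltE ltrN2.
Qed.

Lemma Psi_le p q : 0 < p < 1 -> 0 < q < 1 -> (Psi p <= Psi q) = (q <= p).
Proof. by move=> p01 q01; rewrite !leNgt Psi_lt. Qed.

Lemma Psi_gt0 q : 0 < q < 2^-1 -> 0 < Psi q.
Proof.
move=> q0; have <- : Psi 2^-1 = 0 by rewrite -Phi0 -[X in Phi X]oppr0 Psi_Phi.
rewrite Psi_lt; lra.
Qed.

End normal_cdf.

(** * Thresholds at a small variance *)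

Section thresholds.
Context {R : realType}.
Implicit Types (V q e a : R).

(** The thresholds at a state depend on it only through the value [V] there. *)
Definition Bhigh V q : R :=
  sup [set 2 * Phi_inv (1 - (q + V / e ^+ 2)) / (1 + e) | e in
       [set e | Num.sqrt (2 * V / (1 - 2 * q)) < e]].

Definition Blow V q : R :=
  inf [set 2 * Phi_inv (1 - (q - V / e ^+ 2)) / (1 - e) | e in
       [set e | Num.sqrt (V / q) < e < 1]].

Let sqrt_lt x e : 0 <= x -> (Num.sqrt x < e) = (0 < e) && (x < e ^+ 2).
Proof.
move=> x0; apply/idP/andP => [h|[e0 h]].
  have e0 : 0 < e by apply: le_lt_trans h; exact: sqrtr_ge0.
  by split=> //; rewrite -(sqr_sqrtr x0) ltr_sqr ?nnegrE ?sqrtr_ge0// ltW.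
by rewrite -(ger0_norm (ltW e0)) -sqrtr_sqr ltr_sqrt// exprn_gt0.
Qed.

Lemma Bhigh_domE V q e : 0 <= V -> q < 2^-1 ->
  (Num.sqrt (2 * V / (1 - 2 * q)) < e) = (0 < e) && (2 * V < e ^+ 2 * (1 - 2 * q)).
Proof.
move=> V0 q2; rewrite sqrt_lt; last by rewrite divr_ge0//; lra.
by rewrite ltr_pdivrMr//; lra.
Qed.

Lemma Blow_domE V q e : 0 <= V -> 0 < q ->
  (Num.sqrt (V / q) < e) = (0 < e) && (V / e ^+ 2 < q).
Proof.
move=> V0 q0; have Vq : 0 <= V / q by rewrite divr_ge0// ltW.
rewrite sqrt_lt//; case: ltP => //= e0.
by rewrite ltr_pdivrMr// ltr_pdivrMr ?exprn_gt0// mulrC.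
Qed.

Section fixed_V.
Variable V : R.
Hypothesis V0 : 0 <= V.

Let Vsq e : 0 <= V / e ^+ 2.
Proof. by rewrite divr_ge0 ?sqr_ge0. Qed.

Let high_elt q e : 0 < q < 2^-1 -> Num.sqrt (2 * V / (1 - 2 * q)) < e ->
  [/\ 0 < e, q <= q + V / e ^+ 2 < 2^-1,
      0 <= 2 * Psi (q + V / e ^+ 2) / (1 + e) & 2 * Psi (q + V / e ^+ 2) / (1 + e) <= 2 * Psi q].
Proof.
move=> q0; rewrite Bhigh_domE//; last by lra.
move=> /andP[e0 h]; have := Vsq e.
have hV : V / e ^+ 2 < 2^-1 - q by rewrite ltr_pdivrMr ?exprn_gt0//; lra.
move: hV; set t := V / _ => ht t0.
have p0 : 0 < Psi (q + t) by apply: Psi_gt0; lra.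
have pq : Psi (q + t) <= Psi q by rewrite Psi_le; lra.
split=> //; first by lra.
  by rewrite divr_ge0//; lra.
by rewrite ler_pdivrMr ?addr_gt0//; nra.
Qed.

Let high_nonempty q : [set 2 * Phi_inv (1 - (q + V / e ^+ 2)) / (1 + e) | e in
       [set e | Num.sqrt (2 * V / (1 - 2 * q)) < e]] !=set0.
Proof.
set s := Num.sqrt _; exists (2 * Phi_inv (1 - (q + V / (s + 1) ^+ 2)) / (1 + (s + 1))).
by exists (s + 1) => //=; rewrite ltrDl.
Qed.

Let high_ub q : 0 < q < 2^-1 -> ubound [set 2 * Phi_inv (1 - (q + V / e ^+ 2)) / (1 + e) | e in
       [set e | Num.sqrt (2 * V / (1 - 2 * q)) < e]] (2 * Psi q).
Proof. by move=> q0 _ [e /= he <-]; have [] := high_elt q0 he. Qed.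

(** Each competitor increases the probability and divides by [1 + e], so the
    ideal value [2 Psi q] bounds [Bhigh]; by symmetry it bounds [Blow] from
    below ([Blow_ge]). *)
Lemma Bhigh_le q : 0 < q < 2^-1 -> Bhigh V q <= 2 * Psi q.
Proof. by move=> q0; apply: ge_sup => //; exact: high_ub. Qed.

Lemma Bhigh_ge q e : 0 < q < 2^-1 -> Num.sqrt (2 * V / (1 - 2 * q)) < e ->
  2 * Psi (q + V / e ^+ 2) / (1 + e) <= Bhigh V q.
Proof.
by move=> q0 he; apply: ub_le_sup; [exists (2 * Psi q); exact: high_ub|exists e].
Qed.

Lemma Bhigh_ge0 q : 0 < q < 2^-1 -> 0 <= Bhigh V q.
Proof.
move=> q0; set s := Num.sqrt (2 * V / (1 - 2 * q)).
have h : s < s + 1 by rewrite ltrDl.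
by have [_ _ h1 _] := high_elt q0 h; apply: (le_trans h1); exact: Bhigh_ge.
Qed.

Lemma Bhigh_anti q q2 : 0 < q -> q <= q2 -> q2 < 2^-1 -> Bhigh V q2 <= Bhigh V q.
Proof.
move=> q0 qq q2h; apply: ge_sup => // _ [e /= he <-].
have q2' : 0 < q2 < 2^-1 by lra.
have [e0 /andP[h1 h2] _ _] := high_elt q2' he.
apply: (@le_trans _ _ (2 * Psi (q + V / e ^+ 2) / (1 + e))).
  rewrite ler_pM2r ?invr_gt0 ?addr_gt0// ler_pM2l// -/(Psi _).
  by have := Vsq e; move: (V / _) h1 h2 => t *; rewrite Psi_le; lra.
apply: Bhigh_ge; first by lra.
apply: le_lt_trans he; apply: ler_wsqrtr; apply: ler_wpM2l; first by rewrite mulr_ge0.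
by rewrite lef_pV2 ?posrE; lra.
Qed.

Let low_elt q e : 0 < q < 2^-1 -> Num.sqrt (V / q) < e < 1 ->
  2 * Psi q <= 2 * Psi (q - V / e ^+ 2) / (1 - e).
Proof.
move=> q0; rewrite Blow_domE//; last by lra.
move=> /andP[/andP[e0 h] e1]; have := Vsq e; move: h; set t := V / _ => ht t0.
have p0 : 0 < Psi q by apply: Psi_gt0.
have pq : Psi q <= Psi (q - t) by rewrite Psi_le; lra.
by rewrite ler_pdivlMr ?subr_gt0//; nra.
Qed.

Lemma Blow_ge q : V < q < 2^-1 -> 2 * Psi q <= Blow V q.
Proof.
move=> /andP[Vq q2]; have q0 : 0 < q < 2^-1 by rewrite (le_lt_trans V0).
apply: lb_le_inf; last by move=> _ [e /= he <-]; exact: low_elt.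
set s := Num.sqrt (V / q).
have s1 : s < 1.
  rewrite /s sqrt_lt ?divr_ge0//; last by lra.
  by rewrite ltr01 expr1n ltr_pdivrMr ?mul1r//; lra.
pose e := (s + 1) / 2.
exists (2 * Phi_inv (1 - (q - V / e ^+ 2)) / (1 - e)); exists e => //=.
by rewrite -/s /e; lra.
Qed.

Lemma Blow_le q e : 0 < q < 2^-1 -> 0 < e -> V / e ^+ 2 < q -> e < 1 ->
  Blow V q <= 2 * Psi (q - V / e ^+ 2) / (1 - e).
Proof.
move=> q0 e0 h e1; apply: ge_inf.
  by exists (2 * Psi q) => _ [e' /= he <-]; exact: low_elt.
by exists e => //=; rewrite Blow_domE ?e0 ?h ?e1//; lra.
Qed.

End fixed_V.

Section modulus.
Variable M : R.
Hypothesis M0 : 0 < M.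
Let c := normal_pdf (0 : R) 1 (M + 1).
Let c0 : 0 < c. Proof. exact: normal_pdf_gt0. Qed.

(** [Phi] has slope at least [c] on [[- (M + 1), M + 1]], so moving the
    probability by [t < c] moves the quantile by at most [t / c], hence by less
    than [1]: it does not leave that window. *)
Lemma Psi_subr q t : 0 < q < 2^-1 -> Psi q <= M -> 0 <= t < c ->
  t < q /\ Psi (q - t) <= Psi q + t / c.
Proof.
have M_gt0 := M0; have c_gt0 := c0; move=> q0 qM /andP[t0 tc]; have a0 := Psi_gt0 q0.
have b1 : t / c <= 1 by rewrite ler_pdivrMr// mul1r ltW.
have b0 : 0 <= t / c by rewrite divr_ge0// ltW.
have := @Phi_gap R (Psi q) (Psi q + t / c) (M + 1).
have -> : Psi q + t / c - Psi q = t / c by ring.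
rewrite -/c [c * _]mulrC divfK ?gt_eqF// => h.
have {h} h : t <= Phi (Psi q + t / c) - Phi (Psi q) by apply: h; lra.
have q01 : 0 < q < 1 by lra.
have := Phi_Psi q01; rewrite PhiN => e.
have f := Phi_lt1 (Psi q + t / c).
have qt : 0 < q - t < 1 by lra.
split; first by lra.
by rewrite -[leRHS]Psi_Phi Psi_le ?Phi_gt0 ?Phi_lt1// PhiN; lra.
Qed.

Lemma Psi_addr q t : 0 < q < 2^-1 -> Psi q <= M -> 0 <= t < c -> q + t < 1 ->
  Psi q - t / c <= Psi (q + t).
Proof.
have M_gt0 := M0; have c_gt0 := c0; move=> q0 qM /andP[t0 tc] qt1; have a0 := Psi_gt0 q0.
have b1 : t / c <= 1 by rewrite ler_pdivrMr// mul1r ltW.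
have b0 : 0 <= t / c by rewrite divr_ge0// ltW.
have := @Phi_gap R (Psi q - t / c) (Psi q) (M + 1).
have -> : Psi q - (Psi q - t / c) = t / c by ring.
rewrite -/c [c * _]mulrC divfK ?gt_eqF// => h.
have {h} h : t <= Phi (Psi q) - Phi (Psi q - t / c) by apply: h; lra.
have q01 : 0 < q < 1 by lra.
have := Phi_Psi q01; rewrite PhiN => e.
by rewrite -[leLHS]Psi_Phi Psi_le ?Phi_gt0 ?Phi_lt1// ?PhiN; lra.
Qed.

(** Both thresholds converge to [2 Psi q] as [V] tends to [0], uniformly for
    [q] away from [0]: take [e ^ 3] of the order of [V]. *)
Lemma thresholds_uniform (eta : R) : 0 < eta -> exists2 delta, 0 < delta &
  forall V q, 0 <= V <= delta -> 0 < q < 2^-1 -> Psi q <= M ->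
  [/\ V < q, Blow V q <= 2 * Psi q + eta & 2 * Psi q - eta <= Bhigh V q].
Proof.
have M_gt0 := M0; have c_gt0 := c0.
move=> eta0; pose K := 4 * M + 4 / c.
have ic : 0 < c^-1 by rewrite invr_gt0.
have K0 : 0 < K by rewrite /K; lra.
pose e := Num.min (2^-1) (Num.min (c / 2) (eta / K)).
have e0 : 0 < e by rewrite !lt_min invr_gt0 ltr0n /= !divr_gt0.
have e12 : e <= 2^-1 by rewrite ge_min lexx.
have ec : e <= c / 2 by rewrite !ge_min lexx orbT.
have eK : K * e <= eta by rewrite mulrC -ler_pdivlMr// !ge_min lexx !orbT.
exists (e ^+ 3); first by rewrite exprn_gt0.
move=> V q /andP[V0 Ve] q0 qM; have a0 := Psi_gt0 q0.
have t0 : 0 <= V / e ^+ 2 by rewrite divr_ge0 ?sqr_ge0.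
have te : V / e ^+ 2 <= e by rewrite ler_pdivrMr ?exprn_gt0// -exprS.
have [tq h] := @Psi_subr q (V / e ^+ 2) q0 qM ltac:(lra).
have e2 : e ^+ 2 < 1 by rewrite expr_lt1 ?ltW//; lra.
have VE : V = V / e ^+ 2 * e ^+ 2 by rewrite divfK// gt_eqF// exprn_gt0.
have tc : V / e ^+ 2 / c <= e / c by rewrite ler_pM2r.
have ec0 : 0 <= e / c by rewrite divr_ge0// ltW.
have Kexp : 4 * (M * e) + 4 * (e / c) <= eta by move: eK; rewrite /K; lra.
split.
- have : V / e ^+ 2 * e ^+ 2 <= V / e ^+ 2 * 1 by rewrite ler_wpM2l// ltW.
  by rewrite -VE mulr1; lra.
- apply: le_trans (Blow_le V0 q0 e0 tq _) _; first by lra.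
  rewrite ler_pdivrMr; last by lra.
  have h2 : Psi (q - V / e ^+ 2) <= Psi q + e / c by lra.
  have h3 : Psi q * e <= M * e by rewrite ler_pM2r.
  have h4 : eta * e <= eta / 2 by rewrite ler_pM2l.
  rewrite mulrBr mulr1 mulrDl; lra.
- have [ha|ha] := leP (Psi q) (e / c).
    apply: le_trans (Bhigh_ge0 V0 q0); have : 0 <= M * e by rewrite mulr_ge0 ?ltW.
    lra.
  have hd : 2 * V < e ^+ 2 * (1 - 2 * q).
    have := @Phi_gap R 0 (Psi q) (M + 1); rewrite -/c subr0 Phi0 => /(_ _ _ _)hg.
    have {}hg : c * Psi q <= Phi (Psi q) - 2^-1 by apply: hg; lra.
    have q01 : 0 < q < 1 by lra.
    have := Phi_Psi q01; rewrite PhiN => eq.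
    have : e < c * Psi q by rewrite mulrC -ltr_pdivrMr.
    move=> ?; have : V / e ^+ 2 < 2^-1 - q by lra.
    by rewrite ltr_pdivrMr ?exprn_gt0//; lra.
  have hs : Num.sqrt (2 * V / (1 - 2 * q)) < e by rewrite Bhigh_domE ?e0//; lra.
  apply: le_trans (Bhigh_ge V0 q0 hs).
  have h2 : Psi q - e / c <= Psi (q + V / e ^+ 2).
    by apply: (@le_trans _ _ (Psi q - V / e ^+ 2 / c)); [lra|apply: Psi_addr; lra].
  rewrite ler_pdivlMr; last by lra.
  have h3 : Psi q * e <= M * e by rewrite ler_pM2r.
  have h4 : 0 <= eta * e by rewrite mulr_ge0 ?ltW.
  rewrite mulrDr mulr1 mulrBl; lra.
Qed.

End modulus.
End thresholds.

(** * The high-dimensional regime *)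

Section near_ideal.
Context {R : realType}.
Variables (L U : R).

(** The supremum of the [Psi q] for [q] in [I_q], in the limit where [kappa_inf] is
    [2] and [Bsup_low q] is [2 Psi q]. *)
Definition r0 : R := Num.sqrt (2 / pi).

Lemma r0_gt0 : 0 < r0.
Proof. by rewrite sqrtr_gt0 divr_gt0// pi_gt0. Qed.

Lemma r0_le1 : r0 <= 1.
Proof. by rewrite -[leRHS]sqrtr1 ler_wsqrtr// ler_pdivrMr ?pi_gt0// mul1r pi_ge2. Qed.

(** High-dimensional regime: up to [eta], the thresholds are those of a
    deterministic [Q], namely [2 Psi q], and [kappa_inf] is [2].  The condition
    [Psi q <= r0 + 1] keeps [q] away from [0], where this fails to be uniform. *)
Definition near_ideal (eta : R) d (f : 'rV[R]_d -> R) :=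
  [/\ (0 < d)%N,
      forall th, Theta0 th -> 0 <= V_std f th <= eta,
      forall th q, Theta0 th -> 0 < q < 2^-1 -> Psi q <= r0 + 1 ->
        [/\ V_std f th < q, B_low f th q <= 2 * Psi q + eta &
            2 * Psi q - eta <= B_high f th q],
      2 - eta <= kappa_inf f <= 2 + eta &
      L * d%:R <= E_Q f <= U * d%:R].

Lemma near_ideal_eventually (eta : R) : 0 < L -> L <= U -> 0 < eta ->
  exists D : nat, forall d, (D <= d)%N -> forall f : 'rV[R]_d -> R, A1 L U f ->
    near_ideal eta f.
Proof.
move=> L0 LU eta0; have r00 := r0_gt0.
have [delta delta0 hB] := @thresholds_uniform R (r0 + 1) ltac:(lra) eta eta0.
pose v := Num.min (2^-1) (eta / 4).
have v0 : 0 < v by rewrite lt_min invr_gt0 ltr0n /= divr_gt0.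
have v2 : v <= 2^-1 by rewrite ge_min lexx.
have v4 : v <= eta / 4 by rewrite ge_min lexx orbT.
pose e := Num.min delta (Num.min (v ^+ 2) eta).
have e0 : 0 < e by rewrite !lt_min delta0 eta0 exprn_gt0.
have [D hD] := V_std_small L0 LU e0.
exists D.+1 => d Dd f fA1; have hV := hD d (ltnW Dd) f fA1.
have d0 : (0 < d)%N by apply: leq_trans Dd.
have hV1 th : V_std f th <= delta by apply: (le_trans (hV th)); rewrite ge_min lexx.
have hV2 th : V_std f th <= v ^+ 2 by apply: (le_trans (hV th)); rewrite !ge_min lexx orbT.
have hV3 th : V_std f th <= eta by apply: (le_trans (hV th)); rewrite !ge_min lexx !orbT.
split=> //.
- by move=> th _; rewrite V_std_ge0 hV3.
- by move=> th q _ q0 qM; apply: hB => //; rewrite V_std_ge0 hV1.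
- have v01 : 0 <= v < 1 by lra.
  have /andP[k1 k2] := kappa_bounds L0 LU fA1 d0 v01 (fun th _ => hV2 th).
  apply/andP; split.
    apply: le_trans k1; rewrite ler_pdivlMr; nra.
  apply: (le_trans k2); rewrite ler_pdivrMr; nra.
- exact: E_Q_bounds.
Qed.

Section consequences.
Variables (eta : R) (d : nat) (f : 'rV[R]_d -> R).
Hypotheses (eta0 : 0 < eta) (eta2 : eta <= 2^-1).
Hypothesis eta_lt : eta < Phi (- (r0 + 1)).
Hypothesis fI : near_ideal eta f.

Let thE : @Theta0 R d !=set0.
Proof. by case: fI => d0 _ _ _ _; exact: Theta0_neq0. Qed.

Let V0 th : Theta0 th -> 0 <= V_std f th.
Proof. by move=> th0; case: fI => _ /(_ th th0)/andP[]. Qed.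

Lemma B_high_le th q : Theta0 th -> 0 < q < 2^-1 -> B_high f th q <= 2 * Psi q.
Proof. by move=> th0 q0; apply: (Bhigh_le (V0 th0)). Qed.

Lemma B_high_ge0 th q : Theta0 th -> 0 < q < 2^-1 -> 0 <= B_high f th q.
Proof. by move=> th0 q0; apply: (Bhigh_ge0 (V0 th0)). Qed.

Lemma B_low_ge th q : Theta0 th -> 0 < q < 2^-1 -> Psi q <= r0 + 1 ->
  2 * Psi q <= B_low f th q.
Proof.
move=> th0 q0 qM; apply: (Blow_ge (V0 th0)).
by case: fI => _ _ /(_ th q th0 q0 qM)[-> _ _] _ _; case/andP: q0.
Qed.

Let low_set q : [set B_low f th q | th in @Theta0 R d] !=set0.
Proof. by have [th th0] := thE; exists (B_low f th q), th. Qed.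

Let high_set q : [set B_high f th q | th in @Theta0 R d] !=set0.
Proof. by have [th th0] := thE; exists (B_high f th q), th. Qed.

Lemma Bsup_low_bounds q : 0 < q < 2^-1 -> Psi q <= r0 + 1 ->
  2 * Psi q <= Bsup_low f q <= 2 * Psi q + eta.
Proof.
move=> q0 qM.
have ub : ubound [set B_low f th q | th in @Theta0 R d] (2 * Psi q + eta).
  by move=> _ [th th0 <-]; case: fI => _ _ /(_ th q th0 q0 qM)[].
apply/andP; split; last by apply: ge_sup.
have [th th0] := thE; apply: (le_trans (B_low_ge th0 q0 qM)).
by apply: ub_le_sup; [exists (2 * Psi q + eta)|exists th].
Qed.

Let high_lb q : 0 < q < 2^-1 -> lbound [set B_high f th q | th in @Theta0 R d] 0.
Proof. by move=> q0 _ [th th0 <-]; exact: B_high_ge0. Qed.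

Lemma Binf_high_le q : 0 < q < 2^-1 -> Binf_high f q <= 2 * Psi q.
Proof.
move=> q0; have [th th0] := thE; apply: le_trans (B_high_le th0 q0).
by apply: ge_inf; [exists 0; exact: high_lb|exists th].
Qed.

Lemma Binf_high_ge q : 0 < q < 2^-1 -> Psi q <= r0 + 1 -> 2 * Psi q - eta <= Binf_high f q.
Proof.
move=> q0 qM; apply: lb_le_inf => // _ [th th0 <-].
by case: fI => _ _ /(_ th q th0 q0 qM)[].
Qed.

Lemma Binf_high_ge0 q : 0 < q < 2^-1 -> 0 <= Binf_high f q.
Proof. by move=> q0; apply: lb_le_inf => //; exact: high_lb. Qed.

Lemma Binf_high_anti q q2 : 0 < q -> q <= q2 -> q2 < 2^-1 -> Binf_high f q2 <= Binf_high f q.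
Proof.
move=> q0 qq q2h; apply: lb_le_inf => // _ [th th0 <-].
apply: (@le_trans _ _ (B_high f th q2)); last exact: (Bhigh_anti (V0 th0)).
by apply: ge_inf; [exists 0; apply: high_lb; lra|exists th].
Qed.

Lemma Phi_r0 : 0 < Phi (- (r0 + 1)) < 2^-1.
Proof.
by rewrite Phi_gt0 -Phi0 Phi_ltE/=; have := r0_gt0; lra.
Qed.

Let Psi_r0 : Psi (Phi (- (r0 + 1))) = r0 + 1. Proof. exact: Psi_Phi. Qed.

(** For the ideal thresholds, [Binf_high x < Bsup_low q] means [q < x].  The error
    [eta] on upper quantiles is at most [eta] on probabilities since [Phi] is
    [1]-Lipschitz. *)
Lemma Q_of_bounds q : 0 < q < 2^-1 -> Psi q <= r0 + 2^-1 -> q - eta <= Q_of f q <= q.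
Proof.
have e0 := eta0; have e2 := eta2.
move=> q0 qM; have qM1 : Psi q <= r0 + 1 by lra.
have q01 : 0 < q < 1 by lra.
have /andP[s1 s2] := Bsup_low_bounds q0 qM1.
have inS x : q < x -> x < 2^-1 -> 0 < x < 2^-1 /\ Binf_high f x < Bsup_low f q.
  move=> qx x2; have x0 : 0 < x < 2^-1 by lra.
  split=> //; apply: le_lt_trans (Binf_high_le x0) _; apply: lt_le_trans s1.
  by rewrite ltr_pM2l// Psi_lt; lra.
apply/andP; split.
  apply: lb_le_inf; first by exists ((q + 2^-1) / 2); apply: inS; lra.
  move=> x [x0 hx]; have x01 : 0 < x < 1 by lra.
  have [xM|xM] := leP (Psi x) (r0 + 1).
    have := Binf_high_ge x0 xM => h1.
    have h2 : Psi x <= Psi q + eta by lra.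
    have h3 : Phi (- (Psi q + eta)) <= x by rewrite -[leRHS]Phi_Psi// Phi_leE; lra.
    have := @Phi_lip R (- (Psi q + eta)) (- Psi q); rewrite Phi_Psi//.
    by move=> h4; have {}h4 := h4 ltac:(lra); lra.
  have xq : x <= Phi (- (r0 + 1)) by rewrite -[leLHS]Phi_Psi// Phi_leE; lra.
  have := Binf_high_ge Phi_r0; rewrite Psi_r0 => /(_ (lexx _)) h1.
  have := Binf_high_anti (_ : 0 < x) xq _; have := Phi_r0 => *; exfalso.
  have : Binf_high f (Phi (- (r0 + 1))) <= Binf_high f x by apply: Binf_high_anti; lra.
  lra.
apply/ler_addgt0Pr => e e00.
have lb : has_lbound [set x | 0 < x < 2^-1 /\ Binf_high f x < Bsup_low f q].
  by exists 0 => x [/andP[/ltW]].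
pose x := Num.min (q + e) ((q + 2^-1) / 2).
have x1 : x <= q + e by rewrite ge_min lexx.
have x2 : x <= (q + 2^-1) / 2 by rewrite ge_min lexx orbT.
have x3 : q < x by rewrite lt_min; apply/andP; split; lra.
by apply: le_trans x1; apply: ge_inf => //; apply: inS; lra.
Qed.

Lemma V_sup_ge th : Theta0 th -> V_std f th <= V_sup f.
Proof.
move=> th0; apply: ub_le_sup; last by exists th.
by exists eta => _ [th' th'0 <-]; case: fI => _ /(_ th' th'0)/andP[].
Qed.

Lemma V_sup_le : 0 <= V_sup f <= eta.
Proof.
have [th th0] := thE; apply/andP; split.
  exact: le_trans (V0 th0) (V_sup_ge th0).
apply: ge_sup; first by exists (V_std f th), th.
by move=> _ [th' th'0 <-]; case: fI => _ /(_ th' th'0)/andP[].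
Qed.

(** Above [V_sup] the thresholds [B_low] are bounded uniformly in the state, even
    where [near_ideal] says nothing about them: the supremum is a genuine one. *)
Lemma Bsup_low_ge q : V_sup f < q < 2^-1 -> 2 * Psi q <= Bsup_low f q.
Proof.
move=> /andP[Vq q2]; have /andP[Vs0 _] := V_sup_le; have [th th0] := thE.
have q0 : 0 < q < 2^-1 by lra.
have Vth := V_sup_ge th0.
have : 2 * Psi q <= B_low f th q by apply: (Blow_ge (V0 th0)); lra.
move/le_trans; apply; apply: ub_le_sup; last by exists th.
pose e := (Num.sqrt (V_sup f / q) + 1) / 2.
have s0 : 0 <= V_sup f / q by rewrite divr_ge0//; lra.
have s1 : Num.sqrt (V_sup f / q) < 1.
  by rewrite -[ltRHS]sqrtr1 ltr_sqrt// ltr_pdivrMr ?mul1r; lra.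
have e0 : Num.sqrt (V_sup f / q) < e by rewrite /e; lra.
have e1 : e < 1 by rewrite /e; lra.
move: e0; rewrite Blow_domE//; last by lra.
move=> /andP[e0 he].
exists (2 * Psi (q - V_sup f / e ^+ 2) / (1 - e)) => _ [th' th'0 <-].
have Ve : V_std f th' / e ^+ 2 <= V_sup f / e ^+ 2.
  by rewrite ler_pM2r ?invr_gt0 ?exprn_gt0// V_sup_ge.
have Ve0 : 0 <= V_std f th' / e ^+ 2 by rewrite divr_ge0 ?V0// sqr_ge0.
apply: (le_trans (Blow_le (V0 th'0) q0 e0 _ e1)); first by lra.
rewrite ler_pM2r ?invr_gt0 ?subr_gt0// ler_pM2l// Psi_le; lra.
Qed.

Let kappa_le : kappa_inf f <= 2 + eta. Proof. by case: fI => _ _ _ /andP[]. Qed.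
Let kappa_ge : 2 - eta <= kappa_inf f. Proof. by case: fI => _ _ _ /andP[]. Qed.

Let etar : 0 <= eta * r0 <= eta.
Proof.
have := r0_gt0; have := r0_le1; have e0 := eta0 => h1 h2.
by apply/andP; split; [apply: mulr_ge0; exact: ltW|rewrite ler_piMr// ltW].
Qed.

Lemma kappa_r0_le : kappa_inf f * r0 <= 2 * r0 + eta.
Proof.
have := kappa_le; rewrite -(ler_pM2r r0_gt0) mulrDl; have := etar; lra.
Qed.

Lemma kappa_r0_ge : 2 * r0 - eta <= kappa_inf f * r0.
Proof.
have := kappa_ge; rewrite -(ler_pM2r r0_gt0) mulrBl; have := etar; lra.
Qed.

Lemma I_q_intro q : 0 < q < 2^-1 -> Psi q < r0 - eta -> I_q f q.
Proof.
have e0 := eta0; have el := eta_lt; move=> q0 qr.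
have q01 : 0 < q < 1 by lra.
have hq : Phi (- (r0 - eta)) < q by rewrite -[ltRHS]Phi_Psi// Phi_ltE; lra.
have q1 : Phi (- (r0 + 1)) < Phi (- (r0 - eta)) by rewrite Phi_ltE; lra.
rewrite /I_q /= in_itv /= gt_max; apply/andP; split; last by case/andP: q0.
apply/andP; split; first by have /andP[] := V_sup_le; lra.
set S := [set q | _]; have [->|/set0P S0] := eqVneq S set0; first by rewrite sup0; lra.
apply: le_lt_trans hq; apply: ge_sup => // x [[x0 _] hx].
have x01 : 0 < x < 1 by lra.
rewrite -[leLHS]Phi_Psi// Phi_leE lerN2.
have [xM|xM] := leP (Psi x) (r0 + 1); last by lra.
have /andP[_ h] := Bsup_low_bounds x0 xM; have := kappa_r0_ge.
by move: hx; rewrite -/r0; lra.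
Qed.

Lemma I_q_elim q : I_q f q ->
  [/\ 0 < q < 2^-1, Psi q < r0 + eta & Bsup_low f q < kappa_inf f * r0].
Proof.
rewrite /I_q /= in_itv /= gt_max => /andP[/andP[Vq sq] q2].
have /andP[Vs0 _] := V_sup_le; have q0 : 0 < q < 2^-1 by lra.
have hlt : Bsup_low f q < kappa_inf f * r0.
  rewrite ltNge; apply/negP => h; move: sq; rewrite ltNge => /negP; apply.
  apply: ub_le_sup; first by exists (2^-1) => x [[/andP[_ /ltW]]].
  by split=> //; split=> // th th0; apply: le_lt_trans Vq; exact: V_sup_ge.
split=> //; have := @Bsup_low_ge q; rewrite Vq q2 => /(_ isT) h.
have := kappa_r0_le; have e0 := eta0; lra.
Qed.

Section ratio.
Variables (au ad : R).
Hypothesis r_gt0 : 0 < au / ad.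
Local Notation r := (au / ad).

(** The limiting condition is sufficient without any margin, because [2 Psi] is an
    exact bound for both thresholds. *)
Lemma I_high_intro q' q'' : 0 < q' < 2^-1 -> Psi q' <= r0 + 1 -> 0 < q'' < 2^-1 ->
  r * Psi q'' < Psi q' -> I_high f au ad q' q''.
Proof.
move=> q'0 q'M q''0 hr; rewrite /I_high /= in_itv /=; apply/andP; split; last by case/andP: q''0.
have q''01 : 0 < q'' < 1 by lra.
pose Z := Phi (- (Psi q' / r)).
have Zq : Z < q''.
  by rewrite -[ltRHS]Phi_Psi// Phi_ltE ltrN2 ltr_pdivlMr// mulrC.
apply: le_lt_trans Zq; apply: ge_sup.
  have [th th0] := thE.
  by exists (sup [set q | 0 < q < 2^-1 /\ B_low f th q' <= r * B_high f th q]), th.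
move=> _ [th th0 <-]; set S := [set q | _].
have [->|/set0P S0] := eqVneq S set0; first by rewrite sup0 Phi_ge0.
apply: ge_sup => // x [x0 hx]; have x01 : 0 < x < 1 by lra.
rewrite -[leLHS]Phi_Psi// Phi_leE lerN2 ler_pdivrMr//.
have h1 := B_low_ge th0 q'0 q'M; have h2 := B_high_le th0 x0.
have : r * B_high f th x <= r * (2 * Psi x) by rewrite ler_pM2l.
lra.
Qed.

Lemma I_high_elim q' q'' : I_high f au ad q' q'' -> 0 < q' < 2^-1 -> Psi q' <= r0 + 1 ->
  0 < q'' -> Psi q'' <= r0 + 1 ->
  q'' < 2^-1 /\ r * (2 * Psi q'' - eta) < 2 * Psi q' + eta.
Proof.
rewrite /I_high /= in_itv /= => /andP[hs q''2] q'0 q'M q''0 q''M; split=> //.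
have q''b : 0 < q'' < 2^-1 by rewrite q''0.
have [th th0] := thE.
have hub th' : has_ubound [set q | 0 < q < 2^-1 /\ B_low f th' q' <= r * B_high f th' q].
  by exists (2^-1) => x [/andP[_ /ltW]].
have h : r * B_high f th q'' < B_low f th q'.
  rewrite ltNge; apply/negP => h; move: hs; rewrite ltNge => /negP; apply.
  apply: (@le_trans _ _ (sup [set q | 0 < q < 2^-1 /\ B_low f th q' <= r * B_high f th q])).
    by apply: ub_le_sup.
  apply: ub_le_sup; last by exists th.
  exists (2^-1) => _ [th' th'0 <-]; set S := [set q | _].
  have [->|/set0P S0] := eqVneq S set0; first by rewrite sup0.
  by apply: ge_sup => // x [/andP[_ /ltW]].
have [_ h1 _] : [/\ V_std f th < q', B_low f th q' <= 2 * Psi q' + eta &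
    2 * Psi q' - eta <= B_high f th q'] by case: fI => _ _ /(_ th q' th0 q'0 q'M).
have [_ _ h2] : [/\ V_std f th < q'', B_low f th q'' <= 2 * Psi q'' + eta &
    2 * Psi q'' - eta <= B_high f th q''] by case: fI => _ _ /(_ th q'' th0 q''b q''M).
apply: lt_le_trans h1; apply: le_lt_trans h; by rewrite ler_pM2l.
Qed.

End ratio.
End consequences.
End near_ideal.

(** * The normalized bound at a given function *)

Section truncated_ratio.
Context {R : realType}.
Implicit Types (K s eps : R).

Lemma prod3_bounds (a b c a' b' c' : R) : 0 <= a <= a' -> 0 <= b <= b' -> 0 <= c <= c' ->
  0 <= a * b * c <= a' * b' * c'.
Proof.
move=> /andP[a0 aa] /andP[b0 bb] /andP[c0 cc].
rewrite !mulr_ge0//=; apply: ler_pM => //; [exact: mulr_ge0 | exact: ler_pM].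
Qed.

Lemma quotient_bounds (a b a' b' : R) : 0 <= a <= a' -> 0 < b' <= b ->
  0 <= a / b <= a' / b'.
Proof.
move=> /andP[a0 aa] /andP[b0 bb]; have b1 : 0 < b by apply: lt_le_trans bb.
rewrite divr_ge0 ?(ltW b1)//=; apply: ler_pM => //; first by rewrite invr_ge0 ltW.
by rewrite lef_pV2 ?posrE.
Qed.

(** With [A = L / E_Q] and [l = ln (au / ad)], the truncations by [l] in
    [B_upper] and in its normalization only matter through [s = l / A]. *)
Definition trunc K s : R := Num.min K s / Num.min 1 s.

Lemma truncE (A l K : R) : 0 < A -> 0 < l ->
  Num.min (A * K) l / Num.min A l = trunc K (l / A).
Proof.
move=> A0 l0; have minA (x : R) : Num.min (A * x) l = A * Num.min x (l / A).
  by rewrite minr_pMr ?ltW// [A * (l / A)]mulrC divfK ?gt_eqF.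
have -> : Num.min A l = A * Num.min 1 (l / A) by rewrite -minA mulr1.
have m0 : 0 < Num.min 1 (l / A) by rewrite lt_min ltr01 divr_gt0.
rewrite minA /trunc; field; by rewrite !gt_eqF.
Qed.

Section bounds.
Variable s : R.
Hypothesis s0 : 0 < s.

Let m0 : 0 < Num.min 1 s. Proof. by rewrite lt_min ltr01. Qed.

Lemma trunc_le1 K : K <= 1 -> trunc K s <= 1.
Proof.
by move=> K1; rewrite /trunc ler_pdivrMr// mul1r le_min !ge_min K1 lexx orbT.
Qed.

Lemma trunc_ge K K0 : 0 <= K0 -> K0 <= K -> K0 <= 1 -> K0 <= trunc K s.
Proof.
move=> K00 KK K1; rewrite /trunc ler_pdivlMr// le_min; apply/andP; split.
  by apply: le_trans KK; rewrite ler_piMr// ge_min lexx.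
apply: le_trans (_ : 1 * Num.min 1 s <= _); first by rewrite ler_wpM2r// ltW.
by rewrite mul1r ge_min lexx orbT.
Qed.

Lemma trunc_ge0 K : 0 <= K -> 0 <= trunc K s.
Proof. by move=> K0; rewrite /trunc divr_ge0 ?(ltW m0)// le_min K0 ltW. Qed.

End bounds.

(** [trunc] at [s] hardly exceeds [trunc] at [s'] for the arguments of interest.
    This holds for close scales, for scales above [1], where [trunc] is the
    identity, and for scales below [Kmin], where [trunc] is [1]. *)
Definition compatible (eps Kmin s s' : R) := forall K K', 0 <= K <= 1 ->
  Kmin <= K' <= 1 -> K <= (1 + eps) * K' -> trunc K s <= trunc K' s' + 3 * eps.

Lemma compatible_close eps Kmin s s' : 0 < eps <= 1 -> 0 < Kmin -> 0 < s -> 0 < s' ->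
  s <= (1 + eps) * s' -> s' <= (1 + eps) * s -> compatible eps Kmin s s'.
Proof.
move=> /andP[e0 e1] Km s0 s'0 h1 h2 K K' /andP[K0 K1] /andP[Kk K'1] KK.
have m0 : 0 < Num.min 1 s by rewrite lt_min ltr01.
have m'0 : 0 < Num.min 1 s' by rewrite lt_min ltr01.
have t1 : trunc K' s' <= 1 by apply: trunc_le1.
have t0 : 0 <= trunc K' s' by apply: trunc_ge0 => //; lra.
have a1 : Num.min K s <= (1 + eps) * Num.min K' s'.
  by rewrite minr_pMr; [rewrite le_min !ge_min KK h1 orbT|lra].
have a2 : Num.min 1 s' <= (1 + eps) * Num.min 1 s.
  rewrite minr_pMr; last by lra.
  by rewrite le_min !ge_min h2 orbT andbT; apply/orP; left; lra.
have E' : Num.min K' s' = trunc K' s' * Num.min 1 s' by rewrite divfK// gt_eqF.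
apply: (@le_trans _ _ ((1 + eps) ^+ 2 * trunc K' s')); last by nra.
rewrite {1}/trunc ler_pdivrMr//; apply: (le_trans a1); rewrite E'.
move: (trunc K' s') t0 => T t0.
rewrite [leRHS](_ : _ = (1 + eps) * (T * ((1 + eps) * Num.min 1 s))); last by ring.
by rewrite ler_pM2l; [apply: ler_wpM2l|lra].
Qed.

Lemma compatible_large eps Kmin s s' : 0 < eps -> 1 <= s -> 1 <= s' ->
  compatible eps Kmin s s'.
Proof.
move=> e0 s1 s'1 K K' /andP[K0 K1] /andP[Kk K'1] KK.
have tE (x y : R) : x <= 1 -> 1 <= y -> trunc x y = x.
  by move=> x1 y1; rewrite /trunc (min_l y1) divr1 min_l// (le_trans x1).
rewrite !tE//; nra.
Qed.

Lemma compatible_small eps Kmin s s' : 0 < eps -> Kmin <= 1 -> 0 < s -> 0 < s' -> s' <= Kmin ->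
  compatible eps Kmin s s'.
Proof.
move=> e0 Km1 s0 s'0 s'K K K' /andP[K0 K1] /andP[Kk K'1] KK.
have -> : trunc K' s' = 1.
  by rewrite /trunc !min_r ?divff ?gt_eqF//; lra.
have := trunc_le1 s0 K1; lra.
Qed.

End truncated_ratio.

Section bounds_of_ratio.
Context {R : realType}.
Variables (L U qlow qhigh : R).
Hypothesis L0 : 0 < L.
Local Notation r0 := (@r0 R).
Hypothesis hqlow : Phi (- r0) < qlow < 2^-1.

Local Notation alow := (Psi qlow).
Local Notation ahigh := (Psi qhigh).
Local Notation q1 := (Phi (- (r0 + 1))).

(** The hypotheses on the step-size factors in a given dimension. *)
Definition admissible (au ad : R) := [/\ 1 < au, 0 < ad < 1,
  Phi (ad / au * Phi_inv qlow) < qhigh < 2^-1 & qlow < p_target au ad < qhigh].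

Definition ratio d (f : 'rV[R]_d -> R) (au ad : R) : R :=
  B_upper f L au ad / Num.min (L / E_Q f) (ln (au / ad)).

(** The function [w] without its factor [L / E_Q]. *)
Definition w_factor d (f : 'rV[R]_d -> R) (q' q'' : R) : R :=
  Binf_high f q'' / kappa_inf f * (r0 * kappa_inf f - Bsup_low f q') * Q_of f q'.

Definition margin (p q' q'' : R) := Num.min (p - q') (q'' - p).

Definition feasible d (f : 'rV[R]_d -> R) (au ad q' q'' : R) :=
  [/\ I_q f q', I_high f au ad q' q'' & q' < p_target au ad < q''].

Section one_dimension.
Variables (au ad : R).
Hypothesis adm : admissible au ad.

Let qlow01 : 0 < qlow < 2^-1.
Proof. by case/andP: hqlow => h ->; rewrite andbT (lt_trans _ h)// Phi_gt0. Qed.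

Lemma qhigh01 : 0 < qhigh < 2^-1.
Proof.
case: adm => _ _ /andP[h ->] _; rewrite andbT; apply: lt_trans h; exact: Phi_gt0.
Qed.

Lemma r_gt1 : 1 < au / ad.
Proof.
by case: adm => a1 /andP[a0 a2] _ _; rewrite ltr_pdivlMr// mul1r (lt_trans a2).
Qed.

Lemma ell_gt0 : 0 < ln (au / ad).
Proof. by rewrite ln_gt0// r_gt1. Qed.

Lemma alow_lt : alow < r0.
Proof.
have q01 : 0 < qlow < 1 by have := qlow01; lra.
by rewrite -[ltRHS]Psi_Phi Psi_lt ?Phi_gt0 ?Phi_lt1//; case/andP: hqlow.
Qed.

Lemma ahigh_gt0 : 0 < ahigh.
Proof. by apply: Psi_gt0; exact: qhigh01. Qed.

(** The lower bound on [qhigh], in terms of upper quantiles. *)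
Lemma r_ahigh : au / ad * ahigh < alow.
Proof.
case: (adm) => a1 /andP[a0 a2] /andP[h _] _.
have q01 : 0 < qlow < 1 by have := qlow01; lra.
have q'01 : 0 < qhigh < 1 by have := qhigh01; lra.
have r0' := lt_trans ltr01 r_gt1.
move: h; rewrite Phi_inv_Psi// -[X in _ < X -> _]Phi_Psi// Phi_ltE mulrN ltrN2.
rewrite (_ : ad / au = (au / ad)^-1); last by rewrite invf_div.
by rewrite mulrC ltr_pdivlMr// mulrC.
Qed.

(** A bound on the step-size ratio that is uniform in the dimension. *)
Lemma r_lt : au / ad < ahigh^-1.
Proof.
have h := ahigh_gt0; rewrite -(ltr_pM2r h) mulVf ?gt_eqF//.
by apply: (lt_le_trans r_ahigh); apply: le_trans (ltW alow_lt) _; exact: r0_le1.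
Qed.

Lemma ahigh_lt : ahigh < alow.
Proof.
apply: le_lt_trans r_ahigh; rewrite -[leLHS]mul1r ler_pM2r ?ahigh_gt0//.
exact: ltW r_gt1.
Qed.

Section one_function.
Variables (eta : R) (d : nat) (f : 'rV[R]_d -> R).
Hypotheses (eta0 : 0 < eta) (eta4 : eta <= 4^-1) (eta_lt : eta < q1).
Hypothesis fI : near_ideal L U eta f.

Let eta2 : eta <= 2^-1. Proof. by have := eta4; lra. Qed.

Lemma A_gt0 : 0 < L / E_Q f.
Proof.
case: fI => d0 _ _ _ /andP[h _]; rewrite divr_gt0// (lt_le_trans _ h)//.
by rewrite mulr_gt0// ltr0n.
Qed.

Lemma kappa_near : 2 - eta <= kappa_inf f <= 2 + eta.
Proof. by case: fI. Qed.

(** Through [q' < p_target < q''], the bounds [qlow] and [qhigh] on [p_target] keep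
    [Psi q'] away from [0] and [Psi q''] below [r0]. *)
Lemma feasible_facts q' q'' : feasible f au ad q' q'' ->
  [/\ 0 < q' < 2^-1, 0 < q'' < 2^-1, ahigh < Psi q' < r0 + eta, 0 < Psi q'' < alow &
      au / ad * (2 * Psi q'' - eta) < 2 * Psi q' + eta].
Proof.
move=> [Iq Ih /andP[pq' pq'']]; case: adm => _ _ _ /andP[p1 p2].
have e0 := eta0; have e4 := eta4; have ql := qlow01; have qh := qhigh01.
have [q'0 q'r _] := I_q_elim eta0 fI Iq.
have q'01 : 0 < q' < 1 by lra.
have q''0 : 0 < q'' by lra.
have rpos := lt_trans ltr01 r_gt1.
have q''M : Psi q'' < alow.
  rewrite -[ltLHS]Psi_Phi -[ltRHS]Psi_Phi.
  have [q''1|q''1] := ltP q'' 1; last first.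
    move: Ih; rewrite /I_high /= in_itv /= => /andP[_]; lra.
  by rewrite !Psi_Phi Psi_lt; lra.
have al := alow_lt.
have [q''2 hr] := I_high_elim fI rpos Ih q'0 ltac:(lra) q''0 ltac:(lra).
split=> //; first by lra.
  by rewrite q'r andbT Psi_lt; lra.
by rewrite q''M andbT Psi_gt0//; lra.
Qed.

Lemma w_factor_bounds q' q'' : feasible f au ad q' q'' ->
  0 < 2 * r0 - 2 * Psi q' + eta /\
  0 <= w_factor f q' q'' <= 2 * Psi q'' / (2 - eta) * (2 * r0 - 2 * Psi q' + eta) * q'.
Proof.
move=> F; have [q'0 q''0 /andP[_ a1] a2 _] := feasible_facts F.
have e0 := eta0; have e4 := eta4; have el := eta_lt.
case: F => Iq _ _; have [_ _ kb] := I_q_elim eta0 fI Iq.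
have /andP[k1 k2] := kappa_near.
have q'01 : 0 < q' < 1 by lra.
have q'M : Psi q' <= r0 + 2^-1 by lra.
have q1q' : q1 < q' by rewrite -[ltRHS]Phi_Psi// Phi_ltE; lra.
have q'M1 : Psi q' <= r0 + 1 by lra.
have /andP[Q1 Q2] := Q_of_bounds eta0 eta2 fI q'0 q'M.
have /andP[S1 _] := Bsup_low_bounds fI q'0 q'M1.
have H1 := Binf_high_le fI q''0; have H0 := Binf_high_ge0 fI q''0.
have kr := kappa_r0_le eta0 fI; rewrite mulrC in kr; rewrite mulrC in kb.
have k0 : 0 < kappa_inf f by lra.
rewrite /w_factor; set k := kappa_inf f in kr kb k0 k1 k2 *.
have F2 : 0 < 2 * r0 - 2 * Psi q' + eta by lra.
by split=> //; apply: prod3_bounds; [apply: quotient_bounds|..]; lra.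
Qed.

(** Up to errors of order [eta] this lower bound is the upper bound of
    [w_factor_bounds], which is what makes [comparison] possible. *)
Lemma w_factor_ge q' q'' : 0 < q' < 2^-1 -> Psi q' <= r0 + 2^-1 -> 0 < q'' < 2^-1 ->
  Psi q'' <= r0 + 1 -> 0 <= 2 * Psi q'' - eta -> 0 <= 2 * r0 - 2 * Psi q' - 2 * eta ->
  (2 * Psi q'' - eta) / (2 + eta) * (2 * r0 - 2 * Psi q' - 2 * eta) * (q' - eta) <=
  w_factor f q' q''.
Proof.
move=> q'0 q'M q''0 q''M a1 a2.
have e0 := eta0; have e4 := eta4; have el := eta_lt.
have /andP[k1 k2] := kappa_near.
have q'01 : 0 < q' < 1 by lra.
have q1q' : q1 < q' by rewrite -[ltRHS]Phi_Psi// Phi_ltE; lra.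
have q'M1 : Psi q' <= r0 + 1 by lra.
have /andP[Q1 Q2] := Q_of_bounds eta0 eta2 fI q'0 q'M.
have /andP[_ S1] := Bsup_low_bounds fI q'0 q'M1.
have H1 := Binf_high_ge fI q''0 q''M.
have kr := kappa_r0_ge eta0 fI; rewrite mulrC in kr.
rewrite /w_factor; set k := kappa_inf f in kr k1 k2 *.
apply: (fun h => proj2 (andP h)).
by apply: prod3_bounds; [apply: quotient_bounds|..]; lra.
Qed.

Lemma w_factor_le4 q' q'' : feasible f au ad q' q'' -> 0 <= w_factor f q' q'' / 4 <= 1.
Proof.
move=> F; have [F2 /andP[C0 C1]] := w_factor_bounds F.
have [q'0 q''0 /andP[h1 a1] a2 _] := feasible_facts F.
have e0 := eta0; have e4 := eta4; have al := alow_lt; have rl := @r0_le1 R; have ag := ahigh_gt0.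
rewrite divr_ge0//= ler_pdivrMr// mul1r; apply: (le_trans C1).
have -> : 4 = 2 * 4 * 2^-1 :> R by field.
apply: (fun h => proj2 (andP h)).
apply: prod3_bounds; [|lra|lra].
by rewrite divr_ge0 ?ler_pdivrMr//; lra.
Qed.

Let S : set R := [set r | exists q' q'',
    [/\ I_q f q', I_high f au ad q' q'', q' < p_target au ad < q'' &
        r = Num.min (w f L q' q'' / 4) (ln (au / ad))
            * Num.min (p_target au ad - q') (q'' - p_target au ad)]].

Let sE : 0 < ln (au / ad) / (L / E_Q f).
Proof. by rewrite divr_gt0 ?ell_gt0 ?A_gt0. Qed.

Let minE : 0 < Num.min (L / E_Q f) (ln (au / ad)).
Proof. by rewrite lt_min A_gt0 ell_gt0. Qed.

Let termE q' q'' :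
  Num.min (w f L q' q'' / 4) (ln (au / ad))
            * Num.min (p_target au ad - q') (q'' - p_target au ad) =
  Num.min (L / E_Q f) (ln (au / ad)) *
   (trunc (w_factor f q' q'' / 4) (ln (au / ad) / (L / E_Q f)) * margin (p_target au ad) q' q'').
Proof.
rewrite -truncE ?A_gt0 ?ell_gt0// [RHS]mulrA.
rewrite (mulrC (Num.min (L / E_Q f) (ln (au / ad)))) divfK ?gt_eqF//.
congr (Num.min _ _ * _); rewrite /w /w_factor -/r0; ring.
Qed.

Lemma feasible_margin q' q'' : feasible f au ad q' q'' ->
  0 <= margin (p_target au ad) q' q'' <= 2^-1.
Proof.
move=> F; have [q'0 q''0 _ _ _] := feasible_facts F.
case: F => _ _ /andP[pq' pq'']; apply/andP; split.
  by rewrite /margin le_min; apply/andP; split; lra.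
case: adm => _ _ _ /andP[_ p2]; have qh := qhigh01.
by rewrite /margin ge_min; apply/orP; left; lra.
Qed.

Local Notation s := (ln (au / ad) / (L / E_Q f)).

Lemma ratio_le b : 0 <= b ->
  (forall q' q'', feasible f au ad q' q'' ->
     trunc (w_factor f q' q'' / 4) s * margin (p_target au ad) q' q'' <= b) ->
  ratio f au ad <= b / 2.
Proof.
move=> b0 h; rewrite /ratio /B_upper -/S ler_pdivrMr ?minE//.
suff : sup S <= Num.min (L / E_Q f) (ln (au / ad)) * b by lra.
have [->|/set0P S0] := eqVneq S set0.
  by rewrite sup0 mulr_ge0// ltW// minE.
apply: ge_sup => // _ [q' [q'' [Iq Ih pq ->]]].
by rewrite termE ler_wpM2l ?(ltW minE)//; apply: h.
Qed.

Lemma ratio_ge q' q'' : feasible f au ad q' q'' ->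
  trunc (w_factor f q' q'' / 4) s * margin (p_target au ad) q' q'' / 2 <= ratio f au ad.
Proof.
move=> F; rewrite /ratio /B_upper -/S ler_pdivlMr ?minE//.
suff : Num.min (L / E_Q f) (ln (au / ad)) *
    (trunc (w_factor f q' q'' / 4) s * margin (p_target au ad) q' q'') <= sup S by lra.
apply: ub_le_sup; last by case: F => Iq Ih pq; exists q', q''; split; rewrite ?termE.
exists (Num.min (L / E_Q f) (ln (au / ad)) * (1 * 2^-1)) => _ [p' [p'' [Iq Ih pq ->]]].
have Fp : feasible f au ad p' p'' by split.
have /andP[m0 m1] := feasible_margin Fp; have /andP[c0 c1] := w_factor_le4 Fp.
rewrite termE ler_wpM2l ?(ltW minE)// ler_pM//; first exact: trunc_ge0.
exact: trunc_le1.
Qed.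

Lemma ratio_ge0 : 0 <= ratio f au ad.
Proof.
have [[q' [q'' F]]|h] := pselect (exists q' q'', feasible f au ad q' q'').
  apply: le_trans (ratio_ge F); rewrite divr_ge0// mulr_ge0//.
    by apply: trunc_ge0 => //; have /andP[] := w_factor_le4 F.
  by have /andP[] := feasible_margin F.
rewrite /ratio /B_upper -/S (_ : S = set0) ?sup0 ?mulr0 ?mul0r//.
apply/seteqP; split=> // x [q' [q'' [Iq Ih pq _]]]; apply: h.
by exists q', q''.
Qed.

End one_function.
End one_dimension.
End bounds_of_ratio.

(** * Transfer of feasible points between dimensions *)

(** The pair [(a', a'')] of upper quantiles is moved to
    [((1 - l) * a', (1 - l) ^+ 2 * a'' + z)] with [z = l * h ^+ 2 / 8].  The extra
    factor [1 - l] on [a''] creates a slack of order [l * h] in [r * a'' < a'], which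
    absorbs [r * z], the variation of [r] and the errors [eta]. *)
Lemma perturbed_ratio {R : realType} (h l eta a' a'' r r' : R) :
  0 < h < 1 -> 0 < l <= 8^-1 -> 0 < eta <= (l * h ^+ 2 / 8) / 2 ->
  h < a' -> 0 < a'' < 1 -> 0 < r < h^-1 -> 0 < r' < h^-1 -> - eta <= r - r' <= eta ->
  r * (2 * a'' - eta) < 2 * a' + eta ->
  r' * ((1 - l) ^+ 2 * a'' + l * h ^+ 2 / 8) < (1 - l) * a'.
Proof.
move=> /andP[h0 h1] /andP[l0 l8] /andP[e0 ez] ha' /andP[a0 a1] /andP[p0 p1] /andP[p'0 p'1].
move=> /andP[d1 d2] hra.
have ih1 : 1 <= h^-1 by rewrite -[leLHS]invr1 lef_pV2 ?posrE// ltW.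
have k4 : h^-1 * (l * h ^+ 2 / 8) = l * h / 8 by field; rewrite gt_eqF.
have k1 : r * a'' <= a' + h^-1 * eta.
  have t1 : r * eta <= h^-1 * eta by rewrite ler_pM2r// ltW.
  have t2 : 1 * eta <= h^-1 * eta by rewrite ler_pM2r.
  have t3 : r * (2 * a'' - eta) = 2 * (r * a'') - r * eta by ring.
  by clear -t1 t2 t3 hra; lra.
have k2 : r' * a'' <= a' + 2 * (h^-1 * eta).
  have t1 : (r' - r) * a'' <= eta * 1.
    apply: (@le_trans _ _ (eta * a'')); first by rewrite ler_pM2r//; clear -d1; lra.
    by rewrite ler_pM2l// ltW.
  have t2 : 1 * eta <= h^-1 * eta by rewrite ler_pM2r.
  by rewrite mulrBl in t1; clear -t1 t2 k1; lra.
have k3 : r' * (l * h ^+ 2 / 8) <= h^-1 * (l * h ^+ 2 / 8).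
  by rewrite ler_wpM2r// ?(ltW p'1)// divr_ge0// mulr_ge0 ?sqr_ge0// ltW.
have k5 : h^-1 * eta <= l * h / 16.
  apply: (@le_trans _ _ (h^-1 * ((l * h ^+ 2 / 8) / 2))); first by rewrite ler_pM2l ?invr_gt0.
  by rewrite mulrA k4; clear; lra.
have -> : r' * ((1 - l) ^+ 2 * a'' + l * h ^+ 2 / 8) =
    (1 - l) ^+ 2 * (r' * a'') + r' * (l * h ^+ 2 / 8) by ring.
have sq1 : (1 - l) ^+ 2 <= 1 by rewrite expr_le1//; clear -l0 l8; lra.
have lh0 : 0 < l * h by rewrite mulr_gt0.
have k6 : (1 - l) ^+ 2 * (r' * a'') <= (1 - l) ^+ 2 * (a' + l * h / 8).
  by apply: ler_wpM2l; [exact: sqr_ge0|clear -k2 k5; lra].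
have k7 : (1 - l) ^+ 2 * (a' + l * h / 8) <= (1 - l) ^+ 2 * a' + l * h / 8.
  by rewrite mulrDr lerD2l ler_piMl// divr_ge0// ltW.
have k8 : (1 - l) ^+ 2 * a' = ((1 - l) * a') - l * ((1 - l) * a') by ring.
have k9 : l * h / 2 <= l * ((1 - l) * a').
  have -> : l * h / 2 = l * (h / 2) by ring.
  rewrite ler_pM2l//; apply: (@le_trans _ _ (2^-1 * a')); first by clear -ha'; lra.
  by rewrite ler_pM2r; [clear -l8; lra|exact: lt_trans ha'].
by clear -k3 k4 k6 k7 k8 k9 lh0; lra.
Qed.

(** The move decreases [a'] by at least [l * h], so that [rr - a'], which is
    only known to be larger than [- eta], becomes bounded below. *)
Lemma perturbed_bounds {R : realType} (h l eta rr a' a'' : R) :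
  let z := l * h ^+ 2 / 8 in let b' := (1 - l) * a' in
  let b'' := (1 - l) ^+ 2 * a'' + z in
  0 < h < 1 -> rr <= 1 -> h <= rr -> 0 < l <= 8^-1 ->
  0 < eta <= z / 2 -> eta <= l * rr / 8 -> h < a' < rr + eta -> 0 < a'' < 1 ->
  [/\ z <= l, 0 < b' <= a' & a' - b' <= 2 * l] /\
  [/\ b' < rr - eta, 0 < b'' <= a'' + z, 2 * (1 - l) ^+ 2 * a'' <= 2 * b'' - eta &
      z <= 2 * b'' - eta] /\
  2 * rr - 2 * a' + eta <= 2 * rr - 2 * b' - 2 * eta /\
  l * rr <= 2 * rr - 2 * b' - 2 * eta.
Proof.
cbv zeta.
move=> /andP[h0 h1] rr1 hrr /andP[l0 l8] /andP[e0 ez] er /andP[ha' a'r] /andP[a0 a1].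
have lh : l * h <= l by rewrite ger_pMr// ltW.
have lh2 : l * h ^+ 2 <= l * h by rewrite ler_pM2l// expr2 ger_pMr// ltW.
have a'0 := lt_trans h0 ha'.
have la'h : l * h <= l * a' by rewrite ler_pM2l// ltW.
have z0 : 0 < (l * h ^+ 2 / 8) by rewrite divr_gt0// mulr_gt0// exprn_gt0.
have e1 : eta <= 1 by clear -ez lh lh2 l8; lra.
have la'2 : l * a' <= l * 2 by rewrite ler_pM2l//; clear -a'r rr1 e1; lra.
have b'E : ((1 - l) * a') = a' - l * a' by ring.
have la'r : l * a' <= 8^-1 * a' by rewrite ler_pM2r.
have sq1 : (1 - l) ^+ 2 * a'' <= a''.
  rewrite ler_piMl//; first exact: ltW.
  by rewrite expr_le1//; clear -l0 l8; lra.
have sq0 : 0 <= (1 - l) ^+ 2 * a'' by rewrite mulr_ge0 ?sqr_ge0// ltW.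
have up : (1 - l) * a' <= (1 - l) * (rr + eta).
  by rewrite ler_pM2l ?(ltW a'r)//; clear -l8; lra.
have upE : (1 - l) * (rr + eta) = rr + eta - l * rr - l * eta by ring.
have leta : 0 < l * eta by rewrite mulr_gt0.
have lrr : 0 < l * rr by rewrite mulr_gt0// (lt_le_trans h0).
split; [split|split; [split|split]].
- by clear -lh lh2 l0; lra.
- by rewrite b'E; clear -la'r la'h a'0 l0 lh; apply/andP; split; [lra|have := mulr_gt0 l0 a'0; lra].
- by rewrite b'E; clear -la'2; lra.
- by clear -up upE leta er lrr; lra.
- by clear -sq0 sq1 z0; apply/andP; split; lra.
- by clear -ez z0; lra.
- by clear -sq0 ez z0; lra.
- by rewrite b'E; have := mulr_gt0 l0 a'0; clear -ez lh2 la'h; lra.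
- by clear -up upE leta er lrr; lra.
Qed.

Lemma fourth_power_bound {R : realType} (l : R) : 0 < l <= 8^-1 -> 1 <= (1 + 8 * l) * (1 - l) ^+ 4.
Proof.
move=> /andP[l0 l8]; have s0 := sqr_ge0 l.
have h1 : 1 - 2 * l <= (1 - l) ^+ 2 by rewrite sqrrB; clear -s0; lra.
have h2 : (1 - 2 * l) ^+ 2 <= ((1 - l) ^+ 2) ^+ 2.
  by rewrite ler_sqr ?nnegrE ?sqr_ge0//; clear -l8; lra.
have h3 : 1 - 4 * l <= (1 - l) ^+ 4.
  rewrite (exprM (1 - l) 2 2); apply: le_trans h2; rewrite sqrrB exprMn.
  by clear -s0; lra.
apply: (@le_trans _ _ ((1 + 8 * l) * (1 - 4 * l))); last first.
  by rewrite ler_pM2l//; clear -l0; lra.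
have h4 : l * l <= l * 8^-1 by rewrite ler_pM2l.
by clear -h4 l0; lra.
Qed.

(** Compares the upper bound of [w_factor] before the move with its lower bound
    after the move. *)
Lemma perturbed_product {R : realType} (l eta x y p q F G : R) :
  0 < l <= 8^-1 -> 0 < eta <= l ->
  0 <= x -> 2 * (1 - l) ^+ 2 * x <= y -> 0 < F -> F <= G -> 0 <= p -> (1 - l) * p <= q ->
  (1 - l) ^+ 4 * (2 * x / (2 - eta) * F * p) <= y / (2 + eta) * G * q.
Proof.
move=> /andP[l0 l8] /andP[e0 el] x0 xy F0 FG p0 pq.
have l1 : 0 < 1 - l by clear -l8; lra.
have d1 : 0 < 2 - eta by clear -el l8; lra.
have d2 : 0 < 2 + eta by clear -e0; lra.
have i4 : (1 - l) / (2 - eta) <= (2 + eta)^-1.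
  rewrite ler_pdivrMr// mulrC ler_pdivlMr//.
  have := mulr_gt0 l0 e0; clear -el => t.
  have -> : (1 - l) * (2 + eta) = 2 - 2 * l + eta - l * eta by ring.
  lra.
have -> : (1 - l) ^+ 4 * (2 * x / (2 - eta) * F * p) =
   (2 * (1 - l) ^+ 2 * x * ((1 - l) / (2 - eta))) * F * ((1 - l) * p) by ring.
have n1 : 0 <= 2 * (1 - l) ^+ 2 * x by rewrite mulr_ge0// mulr_ge0// sqr_ge0.
have n2 : 0 <= (1 - l) / (2 - eta) by rewrite divr_ge0// ltW.
apply: ler_pM => //; [by apply: mulr_ge0; [exact: mulr_ge0|exact: ltW]|by rewrite mulr_ge0// ltW|].
by apply: ler_pM => //; [exact: mulr_ge0|exact: ltW|exact: ler_pM].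
Qed.

(** A point that is feasible for [f], moved by a factor close to [1] in
    upper-quantile coordinates, becomes feasible for [f'] in another dimension
    and keeps almost the same value.  The shift by [z] keeps [w_factor] above a
    fixed [Kmin], as [compatible] requires. *)
Lemma comparison {R : realType} (L U qlow qhigh eps : R) :
  0 < L -> Phi (- r0) < qlow < 2^-1 -> 0 < Psi qhigh -> 0 < eps <= 1 -> exists eta Kmin : R,
  [/\ 0 < eta, 0 < Kmin <= 1 &
  forall d d' (f : 'rV[R]_d -> R) (f' : 'rV[R]_d' -> R) (au ad au' ad' : R),
    admissible qlow qhigh au ad -> admissible qlow qhigh au' ad' ->
    near_ideal L U eta f -> near_ideal L U eta f' ->
    `|p_target au ad - p_target au' ad'| <= eta -> `|au / ad - au' / ad'| <= eta ->
    compatible eps Kmin (ln (au / ad) / (L / E_Q f)) (ln (au' / ad') / (L / E_Q f')) ->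
    ratio L f au ad <= ratio L f' au' ad' + 4 * eps].
Proof.
move=> L0 hqlow h0; have hh := h0; have r00 := @r0_gt0 R; have r01 := @r0_le1 R.
move=> /andP[e0 e1].
have q10 : 0 < Phi (- (@r0 R + 1)) by exact: Phi_gt0.
pose l := eps / 8; have lE : eps = 8 * l by rewrite /l; clear; field.
have l0 : 0 < l by rewrite divr_gt0.
have l8 : l <= 8^-1 by clear -lE e1; lra.
clearbody l; subst eps.
pose z := l * Psi qhigh ^+ 2 / 8.
have z0 : 0 < z by rewrite divr_gt0// mulr_gt0// exprn_gt0.
pose eta := Num.min (4^-1) (Num.min (z / 2) (Num.min (l * Phi (- (@r0 R + 1)) / 2) (l * r0 / 8))).
have eta0 : 0 < eta.
  rewrite !lt_min invr_gt0 ltr0n /=; apply/and3P.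
  by split; rewrite divr_gt0// mulr_gt0.
have eta4 : eta <= 4^-1 by rewrite ge_min lexx.
have etaz : eta <= z / 2 by rewrite !ge_min lexx orbT.
have etaq : eta <= l * Phi (- (@r0 R + 1)) / 2 by rewrite !ge_min lexx !orbT.
have etar : eta <= l * r0 / 8 by rewrite !ge_min lexx !orbT.
have lq1 : l * Phi (- (@r0 R + 1)) <= 8^-1 * Phi (- (@r0 R + 1)) by rewrite ler_pM2r.
have eta_lt : eta < Phi (- (@r0 R + 1)) by clear -etaq lq1 q10; lra.
clearbody eta.
pose K4 := z / 3 * (l * r0) * (Phi (- (@r0 R + 1)) / 2).
have K40 : 0 < K4.
  by apply: mulr_gt0; [apply: mulr_gt0; [rewrite divr_gt0|exact: mulr_gt0]|rewrite divr_gt0].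
exists eta, (Num.min (K4 / 4) 1); split=> //.
  by rewrite lt_min ge_min lexx orbT divr_gt0 ?ltr01.
move=> d d' f f' au ad au' ad' A A' fI fI' hp hr hs.
have R0' := ratio_ge0 L0 hqlow A' eta0 eta4 eta_lt fI'.
have hal := alow_lt hqlow; have hlow := ahigh_lt hqlow A.
have hlt1 : Psi qhigh < 1 by clear -hal hlow r01; lra.
have hler : Psi qhigh <= r0 by clear -hal hlow; lra.
apply: (@le_trans _ _ ((2 * ratio L f' au' ad' + 4 * l + 3 * (8 * l)) / 2)); last first.
  by clear -l0; lra.
have s0 : 0 < ln (au / ad) / (L / E_Q f).
  by rewrite divr_gt0//; [exact: (ell_gt0 A)|exact: (A_gt0 L0 fI)].
have s'0 : 0 < ln (au' / ad') / (L / E_Q f').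
  by rewrite divr_gt0//; [exact: (ell_gt0 A')|exact: (A_gt0 L0 fI')].
apply: (ratio_le L0 A fI); first by clear -R0' l0; lra.
move=> q' q'' F.
have /andP[c0 c1] := w_factor_le4 hqlow A eta0 eta4 eta_lt fI F.
have /andP[m0 m1] := feasible_margin hqlow A eta0 eta4 fI F.
have T1 := trunc_le1 s0 c1; have T0 := trunc_ge0 s0 c0.
have [q'0 q''0 a'B a''B hra] := feasible_facts hqlow A eta0 eta4 fI F.
have [F2 /andP[_ CU]] := w_factor_bounds hqlow A eta0 eta4 eta_lt fI F.
set T := trunc _ _ in T1 T0 *; set P := margin _ _ _ in m0 m1 *.
(* pairs with a small margin contribute little to the supremum *)
have [P4|P4] := leP P (4 * l).
  have t : T * P <= 1 * (4 * l) by rewrite ler_pM.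
  by clear -t R0' l0; lra.
set a' := Psi q' in a'B hra CU F2; set a'' := Psi q'' in a''B hra CU.
have a''1 : 0 < a'' < 1.
  by case/andP: a''B => -> h2; rewrite (lt_trans h2)//; clear -hal r01; lra.
have l01 : 0 < l <= 8^-1 by rewrite l0.
have h01 : 0 < Psi qhigh < 1 by rewrite hh.
have ez : 0 < eta <= z / 2 by rewrite eta0.
have [[zl b'a' a'b'] [[b'r b''a'' yl zb''] [FG lrG]]] :=
  perturbed_bounds h01 r01 hler l01 ez etar a'B a''1.
rewrite -/z in zl b''a'' yl zb''.
have hrr : au' / ad' * ((1 - l) ^+ 2 * a'' + z) < (1 - l) * a'.
  have /andP[ha' _] := a'B.
  apply: (perturbed_ratio h01 l01 ez ha' a''1 _ _ _ hra).
  - by rewrite (r_lt hqlow A) (lt_trans ltr01 (r_gt1 A)).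
  - by rewrite (r_lt hqlow A') (lt_trans ltr01 (r_gt1 A')).
  - by rewrite -ler_norml.
set b' := (1 - l) * a' in b'a' a'b' b'r FG lrG hrr.
set b'' := (1 - l) ^+ 2 * a'' + z in b''a'' yl zb'' hrr.
have /andP[b'0 b'le] := b'a'; have /andP[b''0 b''le] := b''a''.
pose y' := Phi (- b'); pose y'' := Phi (- b'').
have q'01 : 0 < q' < 1 by clear -q'0; lra.
have q''01 : 0 < q'' < 1 by clear -q''0; lra.
have half (x : R) : 0 < x -> 0 < Phi (- x) < 2^-1.
  by move=> x0; rewrite Phi_gt0 -Phi0 Phi_ltE/= oppr_lt0.
have y'0 := half _ b'0; have y''0 := half _ b''0.
rewrite -/y' in y'0; rewrite -/y'' in y''0.
have Py' : Psi y' = b' by exact: Psi_Phi.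
have Py'' : Psi y'' = b'' by exact: Psi_Phi.
have qy' : q' <= y' by rewrite -[leLHS]Phi_Psi// Phi_leE -/a' lerN2.
have y'q : y' <= q' + 2 * l.
  have := @Phi_lip R (- a') (- b'); rewrite -/y' Phi_Psi// lerN2 => /(_ b'le) t.
  by clear -t a'b'; lra.
have qy'' : q'' - z <= y''.
  apply: (@le_trans _ _ (Phi (- (a'' + z)))); last by rewrite Phi_leE lerN2.
  have := @Phi_lip R (- (a'' + z)) (- a''); rewrite Phi_Psi// lerN2 lerDl.
  by move=> /(_ (ltW z0)) t; clear -t; lra.
have etal : eta <= l by clear -etaz zl z0; lra.
have hP : P - 4 * l <= margin (p_target au' ad') y' y''.
  move: hp; rewrite ler_norml => /andP[hp1 hp2].
  have P1 : P <= p_target au ad - q' by rewrite ge_min lexx.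
  have P2 : P <= q'' - p_target au ad by rewrite ge_min lexx orbT.
  by rewrite /margin le_min; apply/andP; split;
    [clear -P1 hp1 hp2 y'q etal l0|clear -P2 hp1 hp2 qy'' zl etal l0]; lra.
have rg' := lt_trans ltr01 (r_gt1 A').
have b'h : b' <= r0 + 2^-1 by clear -b'r eta0; lra.
have b'1 : b' <= r0 + 1 by clear -b'r eta0; lra.
have b''1 : b'' <= r0 + 1.
  by have /andP[_ t] := a''B; clear -b''le t zl l8 hal; lra.
have F' : feasible f' au' ad' y' y''.
  split.
  - by apply: (I_q_intro eta0 eta_lt fI') => //; rewrite Py'.
  - by apply: (I_high_intro fI') => //; rewrite Py' ?Py''.
  - have mpos : 0 < margin (p_target au' ad') y' y'' by clear -hP P4; lra.
    by move: mpos; rewrite lt_min !subr_gt0.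
have /andP[_ c'1] := w_factor_le4 hqlow A' eta0 eta4 eta_lt fI' F'.
have lr0 : 0 < l * r0 by rewrite mulr_gt0.
have q1q' : Phi (- (@r0 R + 1)) <= q'.
  by have /andP[_ t] := a'B; rewrite -[leRHS]Phi_Psi// Phi_leE -/a'; clear -t eta4; lra.
have lqq : l * Phi (- (@r0 R + 1)) <= l * q' by rewrite ler_pM2l.
have y'e : (1 - l) * q' <= y' - eta.
  by rewrite mulrBl mul1r; have /andP[t _] := q'0; have := mulr_gt0 l0 t; clear -lqq etaq qy'; lra.
have y'e2 : Phi (- (@r0 R + 1)) / 2 <= y' - eta by clear -etaq lq1 q10 q1q' qy'; lra.
have CL : (2 * b'' - eta) / (2 + eta) * (2 * r0 - 2 * b' - 2 * eta) * (y' - eta)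
    <= w_factor f' y' y''.
  rewrite -[in leLHS]Py' -[in leLHS]Py''.
  apply: (w_factor_ge eta0 eta4 eta_lt fI') => //; rewrite ?Py' ?Py''//.
    by apply: le_trans zb''; apply: ltW.
  by apply: le_trans lrG; apply: ltW.
have KK : K4 <= w_factor f' y' y''.
  apply: le_trans CL; rewrite /K4; apply: ler_pM => //.
  - by apply: mulr_ge0; [rewrite divr_ge0// ltW|exact: ltW].
  - by rewrite divr_ge0// ltW.
  - apply: ler_pM => //; [by rewrite divr_ge0// ltW|exact: ltW|].
    apply: ler_pM => //; first exact: ltW.
    by rewrite lef_pV2 ?posrE//; clear -eta0 eta4; lra.
have CC : (1 - l) ^+ 4 * w_factor f q' q'' <= w_factor f' y' y''.
  have p4 : 0 <= (1 - l) ^+ 4 by rewrite exprn_even_ge0.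
  apply: le_trans CL; apply: (le_trans (ler_wpM2l p4 CU)).
  have /andP[t1 _] := a''1; have /andP[t2 _] := q'0.
  by apply: (perturbed_product l01 _ (ltW t1) yl F2 FG (ltW t2) y'e); rewrite eta0.
have CE : w_factor f q' q'' <= (1 + 8 * l) * w_factor f' y' y''.
  have p0 : 0 < 1 + 8 * l by clear -l0; lra.
  apply: (@le_trans _ _ ((1 + 8 * l) * ((1 - l) ^+ 4 * w_factor f q' q''))); last first.
    by rewrite ler_pM2l.
  rewrite mulrA ler_peMl ?fourth_power_bound//.
  by clear -c0; lra.
have hT : T <= trunc (w_factor f' y' y'' / 4) (ln (au' / ad') / (L / E_Q f')) + 3 * (8 * l).
  apply: hs; first by rewrite c0 c1.
    rewrite c'1 andbT ge_min; apply/orP; left; clear -KK; lra.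
  by rewrite mulrA ler_pM2r.
have hR := ratio_ge L0 hqlow A' eta0 eta4 eta_lt fI' F'.
have /andP[m'0 _] := feasible_margin hqlow A' eta0 eta4 fI' F'.
have C'0 : 0 <= w_factor f' y' y'' / 4 by rewrite divr_ge0// (le_trans (ltW K40)).
move: hT hR m'0 hP; set T' := trunc _ _; set P' := margin _ _ _ => hT hR m'0 hP.
have T'1 : T' <= 1 by exact: trunc_le1.
have T'0 : 0 <= T' by exact: trunc_ge0.
have j1 : T * P <= (T' + 3 * (8 * l)) * P by rewrite ler_wpM2r.
have j2 : T' * P <= T' * (P' + 4 * l) by rewrite ler_wpM2l//; clear -hP; lra.
have j3 : T' * (4 * l) <= 1 * (4 * l) by rewrite ler_wpM2r// mulr_ge0// ltW.
have j4 : 3 * (8 * l) * P <= 3 * (8 * l) * 1.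
  by rewrite ler_wpM2l ?mulr_ge0 ?(ltW l0)//; clear -m1; lra.
rewrite mulrDl in j1; rewrite mulrDr in j2; clear -j1 j2 j3 j4 hR; lra.
Qed.

(** * Uniform bounds in high dimension *)

Section high_dimension.
Context {R : realType}.
Variables (L U qlow qhigh : R).
Hypothesis L0 : 0 < L.
Hypothesis hqlow : Phi (- r0) < qlow < 2^-1.

(** For [kappa_inf] between [1] and [3] both terms of the minimum in [A2] are bounded
    below by positive constants, so a small [V_sup] suffices. *)
Lemma near_ideal_A2 : exists2 eta : R, 0 < eta &
  forall d (f : 'rV[R]_d -> R), near_ideal L U eta f -> A2 f.
Proof.
pose s : R := Num.sqrt (2 * pi).
have s0 : 0 < s by rewrite sqrtr_gt0 mulr_gt0// pi_gt0.
have is0 : 0 < s^-1 by rewrite invr_gt0.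
pose b := Num.min (Phi (2^-1 * (1 / s)) - 2^-1) (1 - Phi (3 / 2 * (3 / s))).
have b0 : 0 < b.
  rewrite lt_min !subr_gt0 Phi_lt1 -[X in X < _]Phi0 Phi_ltE andbT mul1r.
  by rewrite mulr_gt0 ?invr_gt0.
exists (Num.min 1 (b / 5)); first by rewrite lt_min ltr01 divr_gt0.
move=> d f fI; have /andP[_ Ve] := V_sup_le fI; have /andP[k1 k2] := kappa_near fI.
have e1 : Num.min 1 (b / 5) <= 1 by rewrite ge_min lexx.
have e2 : Num.min 1 (b / 5) <= b / 5 by rewrite ge_min lexx orbT.
rewrite /A2 -/s; apply: (@lt_le_trans _ _ (4^-1 * b)).
  by apply: le_lt_trans Ve _; apply: le_lt_trans e2 _;
    rewrite mulrC ltr_pM2r// ltf_pV2 ?posrE// ltr_nat.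
have K1 : 1 <= kappa_inf f by lra.
have K3 : kappa_inf f <= 3 by lra.
rewrite ler_pM2l ?invr_gt0// le_min !ge_min; apply/andP; split; apply/orP.
  left; rewrite lerD2r Phi_leE ler_pM2r ?mul1r//; lra.
right; rewrite lerD2l lerN2 Phi_leE ler_pM2r; first by lra.
by rewrite divr_gt0.
Qed.

(** In the limit, membership in [I_q] reads [Psi q' < r0] and membership in [I_high]
    reads [au / ad * Psi q'' < Psi q']: these are the hypotheses on [qlow] and
    [qhigh]. *)
Lemma near_ideal_intervals (au ad eta : R) d (f : 'rV[R]_d -> R) :
  admissible qlow qhigh au ad -> 0 < eta < Phi (- (r0 + 1)) -> eta < r0 - Psi qlow ->
  near_ideal L U eta f -> I_q f qlow /\ I_high f au ad qlow qhigh.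
Proof.
move=> A /andP[e0 el] er fI; have al := alow_lt hqlow.
have ql : 0 < qlow < 2^-1 by case/andP: hqlow => h ->; rewrite andbT (lt_trans _ h)// Phi_gt0.
have qh := qhigh01 A; have rg := lt_trans ltr01 (r_gt1 A).
split; first by apply: (I_q_intro e0 el fI) => //; lra.
by apply: (I_high_intro fI rg) => //; [lra|exact: (r_ahigh hqlow A)].
Qed.

(** The pair with upper quantiles [(Psi qlow + r0) / 2] and [Psi qhigh / 2] lies
    strictly inside the limiting domain, and the value there bounds the supremum
    below. *)
Lemma ratio_lower : 0 < Psi qhigh -> exists c eta : R, [/\ 0 < c, 0 < eta &
  forall d (f : 'rV[R]_d -> R) au ad, admissible qlow qhigh au ad ->
    near_ideal L U eta f -> c <= ratio L f au ad].
Proof.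
move=> h0; have al := alow_lt hqlow; have r00 := @r0_gt0 R; have r01 := @r0_le1 R.
have qd : 0 < Phi (- (@r0 R + 1)) by exact: Phi_gt0.
have ql : 0 < qlow < 2^-1 by case/andP: hqlow => h ->; rewrite andbT (lt_trans _ h)// Phi_gt0.
have gap : 0 < r0 - Psi qlow by rewrite subr_gt0.
have a0 : 0 < Psi qlow by exact: Psi_gt0.
set h := Psi qhigh in h0 *; set q1 := Phi _ in qd *; set a := Psi qlow in al gap a0 *.
pose b' := (a + r0) / 2; pose b'' := h / 2.
have b'0 : 0 < b' by rewrite /b'; lra.
have b''0 : 0 < b'' by rewrite /b''; lra.
pose y' := Phi (- b'); pose y'' := Phi (- b'').
have half (x : R) : 0 < x -> 0 < Phi (- x) < 2^-1.
  by move=> x0; rewrite Phi_gt0 -Phi0 Phi_ltE/= oppr_lt0.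
have y'0 : 0 < y' < 2^-1 := half _ b'0; have y''0 : 0 < y'' < 2^-1 := half _ b''0.
have ql01 : 0 < qlow < 1 by lra.
have y'l : y' < qlow by rewrite -[ltRHS]Phi_Psi// Phi_ltE -/a /b'; lra.
have Py' : Psi y' = b' by exact: Psi_Phi.
have Py'' : Psi y'' = b'' by exact: Psi_Phi.
pose eta := Num.min (4^-1) (Num.min (h / 2) (Num.min ((r0 - a) / 8) (q1 / 2))).
have eta0 : 0 < eta.
  rewrite !lt_min invr_gt0 ltr0n /=; apply/and3P.
  by split; rewrite divr_gt0.
have eta4 : eta <= 4^-1 by rewrite ge_min lexx.
have etah : eta <= h / 2 by rewrite !ge_min lexx orbT.
have etar : eta <= (r0 - a) / 8 by rewrite !ge_min lexx !orbT.
have etaq : eta <= q1 / 2 by rewrite !ge_min lexx !orbT.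
have eta_lt : eta < q1 by lra.
pose K := (h / 2) / 3 * ((r0 - a) / 2) * (q1 / 2).
have K0 : 0 < K by rewrite !mulr_gt0 ?divr_gt0 ?invr_gt0.
have [qh|qh] := ltP qhigh y''; last first.
  (* otherwise no pair of step-size factors is admissible *)
  exists 1, 1; split=> // d f au ad A _; exfalso.
  have qh0 := qhigh01 A; have qh01 : 0 < qhigh < 1 by lra.
  by move: qh; rewrite -[leRHS]Phi_Psi// Phi_leE -/h /b''; lra.
pose P := Num.min (qlow - y') (y'' - qhigh).
have P0 : 0 < P by rewrite lt_min !subr_gt0 y'l.
pose K1 := Num.min (K / 4) 1.
have K10 : 0 < K1 by rewrite lt_min divr_gt0 ?ltr01.
exists (K1 * P / 2), eta; split=> //; first by rewrite divr_gt0// mulr_gt0.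
move=> d f au ad A fI; have rg := lt_trans ltr01 (r_gt1 A).
case: (A) => _ _ _ /andP[p1 p2].
have b'1 : b' <= r0 + 1 by rewrite /b'; lra.
have b'r : b' < r0 - eta by rewrite /b'; lra.
have F : feasible f au ad y' y''.
  split.
  - by apply: (I_q_intro eta0 eta_lt fI); rewrite ?Py'.
  - apply: (I_high_intro fI rg) => //; rewrite Py' ?Py''//.
    have := r_ahigh hqlow A; rewrite -/h -/a /b' /b'' => hr.
    rewrite mulrA; lra.
  - by apply/andP; split; lra.
apply: le_trans (ratio_ge L0 hqlow A eta0 eta4 eta_lt fI F).
rewrite ler_pM2r ?invr_gt0//; apply: ler_pM; [exact: ltW|exact: ltW| |].
  apply: trunc_ge; [|exact: ltW| |by rewrite ge_min lexx orbT].
    by rewrite divr_gt0 ?(ell_gt0 A) ?(A_gt0 L0 fI).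
  rewrite ge_min; apply/orP; left; rewrite ler_pM2r ?invr_gt0//.
  have b''1 : b'' <= r0 + 1.
    by rewrite /b''; have := ahigh_lt hqlow A; rewrite -/h -/a; lra.
  have b'h : b' <= r0 + 2^-1 by rewrite /b'; lra.
  have q1y : q1 < y' by rewrite Phi_ltE /b'; lra.
  have e1 : h / 2 <= 2 * b'' - eta by rewrite /b''; lra.
  have e2 : (r0 - a) / 2 <= 2 * r0 - 2 * b' - 2 * eta by rewrite /b'; lra.
  have e3 : 0 <= q1 / 2 <= y' - eta by lra.
  have CL : (2 * b'' - eta) / (2 + eta) * (2 * r0 - 2 * b' - 2 * eta) * (y' - eta)
      <= w_factor f y' y''.
    rewrite -[in leLHS]Py' -[in leLHS]Py''.
    by apply: (w_factor_ge eta0 eta4 eta_lt fI) => //; rewrite ?Py' ?Py''//;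
      move: e1 e2 h0 gap; clear; lra.
  apply: le_trans CL; apply: (fun h => proj2 (andP h)).
  apply: prod3_bounds => //; [apply: quotient_bounds|]; lra.
by rewrite le_min !ge_min !lerD2 !lerN2 (ltW p1) (ltW p2) !(lexx, orbT).
Qed.

Lemma ratio_upper (au ad eta : R) d (f : 'rV[R]_d -> R) :
  admissible qlow qhigh au ad -> 0 < eta <= 4^-1 -> eta < Phi (- (r0 + 1)) ->
  near_ideal L U eta f -> ratio L f au ad <= 4^-1.
Proof.
move=> A /andP[e0 e4] el fI; rewrite (_ : 4^-1 = 2^-1 / 2); last by field.
apply: (ratio_le L0 A fI); first by rewrite invr_ge0.
move=> q' q'' F; have /andP[c0 c1] := w_factor_le4 hqlow A e0 e4 el fI F.
have /andP[m0 m1] := feasible_margin hqlow A e0 e4 fI F.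
have s0 : 0 < ln (au / ad) / (L / E_Q f).
  by rewrite divr_gt0 ?(ell_gt0 A) ?(A_gt0 L0 fI).
rewrite -[leRHS]mul1r; apply: ler_pM => //; first exact: trunc_ge0.
exact: trunc_le1.
Qed.

End high_dimension.

Section matching.
Context {R : realType}.
Variables (L U : R).

(** The quadratic has the same [E_Q] per dimension as [f'], so that the two scales
    differ only by the dimensions and the step-size factors. *)
Lemma matching_quadratic d' (f' : 'rV[R]_d' -> R) d : 0 < L -> (0 < d)%N -> (0 < d')%N ->
  L * d'%:R <= E_Q f' <= U * d'%:R ->
  exists2 f : 'rV[R]_d -> R, A1 L U f &
    exists2 k, 1 <= k <= U / L &
      (forall l : R, l / (L / E_Q f) = d%:R * l * k) /\
      (forall l : R, l / (L / E_Q f') = d'%:R * l * k).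
Proof.
move=> L0 d0 d'0 /andP[E1 E2]; have d'p : 0 < d'%:R :> R by rewrite ltr0n.
pose c := E_Q f' / d'%:R.
have c1 : L <= c <= U by rewrite ler_pdivlMr// ler_pdivrMr// E1.
exists (isoquad c); first exact: isoquad_A1.
have /andP[c2 c3] := c1.
have cp : 0 < c by apply: lt_le_trans c2.
have E0 : E_Q f' = c * d'%:R by rewrite divfK// gt_eqF.
exists (c / L); first by rewrite ler_pdivlMr// mul1r c2 ler_pM2r ?invr_gt0.
have dp : 0 < d%:R :> R by rewrite ltr0n.
split=> l; [rewrite E_Q_isoquad//|rewrite E0]; field; by rewrite !gt_eqF.
Qed.

(** Here [tau d] stands for [d * ln (au / ad)] and [k] for the common value of
    [E_Q / (d * L)]; each possible limit of [tau] falls under one case of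
    [compatible]. *)
Lemma compatible_eventually (tau : nat -> R) (eps Kmin : R) :
  0 < L -> 0 < eps <= 1 -> 0 < Kmin <= 1 -> (forall d, (0 < d)%N -> 0 < tau d) ->
  cvgn (fun d => (tau d)%:E) ->
  exists D, forall d d', (D <= d)%N -> (D <= d')%N -> forall k, 1 <= k <= U / L ->
    compatible eps Kmin (tau d * k) (tau d' * k).
Proof.
move=> L0 /andP[e0 e1] /andP[Km0 Km1] tau0 /cvg_ex[/= [t| |] ct].
- have [t0|t0] := ltP 0 t.
    (* positive finite limit: the ratio of two scales tends to 1 *)
    have : tau @ \oo --> t by move/fine_cvgP: ct => -[_].
    move=> /cvgrPdist_le /(_ (eps / 4 * t)) [|D _ hD]; first by rewrite mulr_gt0 ?divr_gt0.
    exists D.+1 => d d' Dd Dd' k /andP[k1 _]; have k0 : 0 < k by lra.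
    have := hD d (ltnW Dd); rewrite /= ler_norml => /andP[a1 a2].
    have := hD d' (ltnW Dd'); rewrite /= ler_norml => /andP[b1 b2].
    have td := tau0 d (leq_trans (ltn0Sn _) Dd).
    have td' := tau0 d' (leq_trans (ltn0Sn _) Dd').
    apply: compatible_close; rewrite ?e0 ?mulr_gt0//.
      by rewrite mulrA ler_pM2r//; nra.
    by rewrite mulrA ler_pM2r//; nra.
  (* zero limit: the scale in dimension [d'] falls below [Kmin] *)
  have : tau @ \oo --> t by move/fine_cvgP: ct => -[_].
  move=> /cvgrPdist_lt /(_ (Kmin / (1 + `|U / L|))) [|D _ hD].
    by rewrite divr_gt0// ltr_pwDl.
  exists D.+1 => d d' Dd Dd' k /andP[k1 k2]; have k0 : 0 < k by lra.
  have td := tau0 d (leq_trans (ltn0Sn _) Dd).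
  have td' := tau0 d' (leq_trans (ltn0Sn _) Dd').
  apply: compatible_small => //; try exact: mulr_gt0.
  have := hD d' (ltnW Dd'); rewrite /= ltr_pdivlMr ?ltr_pwDl// => h.
  apply: le_trans (ltW h); apply: ler_pM; [exact: ltW|exact: ltW| |].
    by rewrite -normrN opprB ger0_norm; lra.
  by apply: (le_trans k2); apply: (le_trans (ler_norm _)); rewrite lerDr.
- (* infinite limit: both scales exceed 1 *)
  have : \forall d \near \oo, 1 <= tau d.
    by move/cvgeyPge : ct => /(_ 1); apply: filterS => d; rewrite lee_fin.
  move=> [D _ hD]; exists D => d d' Dd Dd' k /andP[k1 _].
  by apply: compatible_large => //; rewrite -[leLHS]mul1r ler_pM//; exact: hD.
- exfalso; have : \forall d \near \oo, tau d <= 0.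
    by move/cvgeNyPle : ct => /(_ 0); apply: filterS => d; rewrite lee_fin.
  move=> [D _ /(_ D.+1 (leqnSn _))]; rewrite /= leNgt => /negP; apply; exact: tau0.
Qed.

End matching.

(** * Convergence of the infimum *)

Section extended_sequences.
Context {R : realType}.
Implicit Type u : nat -> \bar R.

Lemma limn_einf_ge u (c : \bar R) D : (forall n, (D <= n)%N -> (c <= u n)%E) ->
  (c <= limn_einf u)%E.
Proof.
move=> h; rewrite limn_einf_lim; apply: lime_ge; first exact: is_cvg_einfs.
exists D => // n /= Dn; apply: le_ereal_inf_tmp => _ [k /= nk <-].
by apply: h; exact: leq_trans nk.
Qed.

Lemma limn_esup_le u (c : \bar R) D : (forall n, (D <= n)%N -> (u n <= c)%E) ->
  (limn_esup u <= c)%E.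
Proof.
move=> h; rewrite limn_esup_lim; apply: lime_le; first exact: is_cvg_esups.
exists D => // n /= Dn; apply: ge_ereal_sup => _ [k /= nk <-].
by apply: h; exact: leq_trans nk.
Qed.

(** One-sided estimates suffice, since [n] and [m] can be exchanged. *)
Lemma cauchy_bounded_cvg u (c b : R) D :
  (forall n, (D <= n)%N -> (c%:E <= u n <= b%:E)%E) ->
  (forall e : R, 0 < e -> exists N, forall n m, (N <= n)%N -> (N <= m)%N ->
     (u n <= u m + e%:E)%E) ->
  exists2 l : R, c <= l & u @ \oo --> l%:E.
Proof.
move=> ub uc; pose x n := fine (u n).
have uE n : (D <= n)%N -> u n = (x n)%:E.
  by move=> Dn; have := ub n Dn; rewrite /x; case: (u n) => // /andP[].
have xcv : cvgn x.
  apply: cauchy_cvg; apply: cauchy_exP => e e0.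
  have [N hN] := uc (e / 2) ltac:(lra); exists (x (maxn D N)).
  exists (maxn D N) => // n /= hn; rewrite /ball /= /ball_ /=.
  have Dn : (D <= n)%N by apply: leq_trans hn; exact: leq_maxl.
  have Nn : (N <= n)%N by apply: leq_trans hn; exact: leq_maxr.
  have := hN _ _ Nn (leq_maxr D N); have := hN _ _ (leq_maxr D N) Nn.
  rewrite !uE ?leq_maxl// -!EFinD !lee_fin ltr_norml => h1 h2.
  by apply/andP; split; lra.
have /cvg_ex[l xl] := xcv; exists l.
  have -> : l = limn x by apply/esym/cvg_lim.
  apply: limr_ge => //; exists D => // n /= Dn.
  by have := ub n Dn; rewrite uE// lee_fin => /andP[].
apply/fine_cvgP; split; last exact: xl.
by exists D => // n /= Dn; rewrite uE.
Qed.

End extended_sequences.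

Section infimum_ratio.
Context {R : realType}.
Variables (L U gamma qlow qhigh : R) (au ad : nat -> R).
Hypotheses (L0 : 0 < L) (LU : L <= U).
Hypothesis hqlow : Phi (- r0) < qlow < 2^-1.
Hypothesis adm : forall d, (0 < d)%N -> admissible qlow qhigh (au d) (ad d).
Let u d := inf_ratio d L U gamma (au d) (ad d).

Let h0 : 0 < Psi qhigh.
Proof. exact: (ahigh_gt0 (adm (ltn0Sn 0))). Qed.

Lemma S_class_eventually : exists D, forall d, (D <= d)%N ->
  forall f : 'rV[R]_d -> R, A1 L U f -> A2 f.
Proof.
have [eta eta0 hA2] := @near_ideal_A2 R L U.
have [D hD] := near_ideal_eventually L0 LU eta0.
by exists D => d Dd f fA1; apply: hA2; exact: hD.
Qed.

Lemma inf_ratio_ge (c : R) d : (forall f : 'rV[R]_d -> R, A1 L U f ->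
  c <= ratio L f (au d) (ad d)) -> (c%:E <= u d)%E.
Proof.
move=> h; apply: le_ereal_inf_tmp => _ [f [g [[fA1 _] _ ->]]].
by rewrite lee_fin; exact: h.
Qed.

Lemma inf_ratio_le d (f : 'rV[R]_d -> R) : A1 L U f -> A2 f ->
  (u d <= (ratio L f (au d) (ad d))%:E)%E.
Proof.
move=> fA1 fA2; apply: ereal_inf_lbound; exists f, f; split=> //.
exact: T_class_refl fA1.
Qed.

Lemma inf_ratio_bounds : exists (c : R) D, 0 < c /\
  forall d, (D <= d)%N -> (c%:E <= u d <= (4^-1)%:E)%E.
Proof.
have [c [eta [c0 eta0 hc]]] := ratio_lower U L0 hqlow h0.
have qd : 0 < Phi (- (@r0 R + 1)) by exact: Phi_gt0.
pose e := Num.min (4^-1) (Phi (- (@r0 R + 1)) / 2).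
have e0 : 0 < e by rewrite lt_min invr_gt0 ltr0n /= divr_gt0.
have e4 : e <= 4^-1 by rewrite ge_min lexx.
have el : e < Phi (- (@r0 R + 1)).
  apply: (@le_lt_trans _ _ (Phi (- (@r0 R + 1)) / 2)); first by rewrite ge_min lexx orbT.
  lra.
have [D1 hD1] := near_ideal_eventually L0 LU eta0.
have [D2 hD2] := near_ideal_eventually L0 LU e0.
have [D3 hD3] := S_class_eventually.
exists c, (maxn D1 (maxn D2 (maxn D3 1))); split=> // d; rewrite !geq_max.
move=> /and4P[d1 d2 d3 d4]; have A := adm d4; apply/andP; split.
  by apply: inf_ratio_ge => f fA1; apply: hc A _; exact: hD1.
have fA1 : A1 L U (isoquad L : 'rV[R]_d -> R) by apply: isoquad_A1; rewrite // lexx.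
apply: (le_trans (inf_ratio_le fA1 (hD3 _ d3 _ fA1))); rewrite lee_fin.
apply: (ratio_upper L0 hqlow A _ el (hD2 _ d2 _ fA1)); by rewrite e0.
Qed.

(** Any competitor in dimension [m] is matched, in dimension [n], by the isotropic
    quadratic with the same [E_Q] per dimension; [comparison] then bounds the
    infimum in dimension [n] by the ratio of the competitor. *)
Lemma inf_ratio_cauchy :
  cvgn (fun d => p_target (au d) (ad d)) -> cvgn (fun d => ln (au d / ad d)) ->
  cvgn (fun d => (d%:R * ln (au d / ad d))%:E) ->
  forall e : R, 0 < e -> exists N, forall n m, (N <= n)%N -> (N <= m)%N ->
     (u n <= u m + e%:E)%E.
Proof.
move=> cp cl ct e e0; have U0 : 0 < U by apply: lt_le_trans LU.
pose eps := Num.min 1 (e / 4).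
have eps0 : 0 < eps by rewrite lt_min ltr01 divr_gt0.
have eps1 : 0 < eps <= 1 by rewrite eps0 ge_min lexx.
have [eta [Kmin [eta0 Km hcomp]]] := comparison U L0 hqlow h0 eps1.
have [D1 hD1] := near_ideal_eventually L0 LU eta0.
have [D2 hD2] := S_class_eventually.
have tau0 d : (0 < d)%N -> 0 < d%:R * ln (au d / ad d).
  by move=> d0; rewrite mulr_gt0 ?ltr0n// (ell_gt0 (adm d0)).
have [D3 hD3] := compatible_eventually U L0 eps1 Km tau0 ct.
have close (x : nat -> R) : cvgn x -> exists D, forall n m, (D <= n)%N -> (D <= m)%N ->
    `|x n - x m| <= eta.
  move=> /cvg_ex[l /cvgrPdist_le /(_ (eta / 2))]; rewrite divr_gt0// => /(_ isT)[D _ hD].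
  exists D => n m /hD /= h1 /hD /= h2; have -> : x n - x m = (l - x m) - (l - x n) by ring.
  by apply: le_trans (ler_normB _ _) _; rewrite [leRHS]splitr lerD.
have [D4 hD4] := close _ cp.
have cr : cvgn (fun d => expR (ln (au d / ad d))).
  have /cvg_ex[l hl] := cl; apply/cvg_ex; exists (expR l).
  exact: (continuous_cvg _ (@continuous_expR R l) hl).
have [D5 hD5] := close _ cr.
exists (maxn 1 (maxn D1 (maxn D2 (maxn D3 (maxn D4 D5))))) => n m; rewrite !geq_max.
move=> /and5P[n0 n1 n2 n3 /andP[n4 n5]] /and5P[m0 m1 m2 m3 /andP[m4 m5]].
rewrite -leeBlDr//; apply: le_ereal_inf_tmp => _ [f' [g [[f'A1 _] _ ->]]].
have f'I := hD1 _ m1 _ f'A1.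
have E' : L * m%:R <= E_Q f' <= U * m%:R by case: f'I.
have [f fA1 [k k1 [kE kE']]] := matching_quadratic L0 n0 m0 E'.
rewrite leeBlDr//; apply: (le_trans (inf_ratio_le fA1 (hD2 _ n2 _ fA1))).
rewrite -EFinD lee_fin; apply: (@le_trans _ _ (ratio L f' (au m) (ad m) + 4 * eps)); last first.
  rewrite lerD2l; have : eps <= e / 4 by rewrite ge_min lexx orbT.
  lra.
have rE d : (0 < d)%N -> expR (ln (au d / ad d)) = au d / ad d.
  by move=> d0; rewrite lnK// posrE (lt_trans ltr01)// (r_gt1 (adm d0)).
apply: (hcomp _ _ f f' _ _ _ _ (adm n0) (adm m0) (hD1 _ n1 _ fA1) f'I (hD4 _ _ n4 m4)).
  by rewrite -(rE n n0) -(rE m m0); exact: hD5.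
by rewrite kE kE'; exact: hD3.
Qed.

End infimum_ratio.

(** * The limit *)

Theorem corollary15 (R : realType) (L U gamma : R) (au ad : nat -> R)
    (qlow qhigh : R)
    (hL : 0 < L) (hLU : L <= U)
    (hau : forall d, (0 < d)%N -> 1 < au d)
    (had : forall d, (0 < d)%N -> 0 < ad d < 1)
    (hqlow : Phi (- Num.sqrt (2 / pi)) < qlow < 2^-1)
    (hqhigh : forall d, (0 < d)%N ->
       Phi (ad d / au d * Phi_inv qlow) < qhigh < 2^-1)
    (hp : forall d, (0 < d)%N -> qlow < p_target (au d) (ad d) < qhigh) :
  (exists D : nat, [/\ (3 < D)%N,
     (forall d, (D <= d)%N ->
        (forall f : 'rV[R]_d -> R, A1 L U f -> A2 f)
        /\ (forall f : 'rV[R]_d -> R, S_class d L U f ->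
              I_q f qlow /\ I_high f (au d) (ad d) qlow qhigh)) &
     let u := fun d => inf_ratio d L U gamma (au d) (ad d) in
     [/\ (0 < limn_einf u)%E,
         (limn_esup u < +oo)%E &
         cvgn (fun d => p_target (au d) (ad d)) ->
         cvgn (fun d => ln (au d / ad d)) ->
         cvgn (fun d => (d%:R * ln (au d / ad d))%:E) ->
         exists l : R, 0 < l /\ u @ \oo --> l%:E]])
  /\ (forall d, (0 < d)%N -> forall f h : 'rV[R]_d -> R,
        S_class d L U f -> T_class gamma f h ->
        L / (d%:R * U) <= L / E_Q f)
  /\ (forall d, (0 < d)%N -> forall (H : 'M[R]_d) (h : 'rV[R]_d -> R),
        H^T = H -> (forall a, eigenvalue H a -> L <= a <= U) ->
        let f := fun x : 'rV[R]_d => 2^-1 * (x *m H *m x^T) 0 0 in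
        T_class gamma f h ->
        L / E_Q f = L / \tr H).
Proof.
have U0 : 0 < U by exact: lt_le_trans hLU.
have adm d : (0 < d)%N -> admissible qlow qhigh (au d) (ad d).
  by move=> d0; split; [exact: hau|exact: had|exact: hqhigh|exact: hp].
have EQ_le d (d0 : (0 < d)%N) (f : 'rV[R]_d -> R) : A1 L U f -> L * d%:R <= E_Q f <= U * d%:R.
  by move=> fA1; exact: E_Q_bounds.
split; last split.
- have qd : 0 < Phi (- (@r0 R + 1)) by exact: Phi_gt0.
  have gap : 0 < r0 - Psi qlow by rewrite subr_gt0; exact: alow_lt.
  pose e := Num.min (Phi (- (@r0 R + 1)) / 2) ((r0 - Psi qlow) / 2).
  have e0 : 0 < e by rewrite lt_min !divr_gt0.
  have e1 : e < Phi (- (@r0 R + 1)).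
    apply: (@le_lt_trans _ _ (Phi (- (@r0 R + 1)) / 2)); first by rewrite ge_min lexx.
    lra.
  have e2 : e < r0 - Psi qlow.
    apply: (@le_lt_trans _ _ ((r0 - Psi qlow) / 2)); first by rewrite ge_min lexx orbT.
    lra.
  have [D1 hD1] := S_class_eventually hL hLU.
  have [D2 hD2] := near_ideal_eventually hL hLU e0.
  exists (maxn 4 (maxn D1 D2)); split; first exact: leq_maxl.
    move=> d; rewrite !geq_max => /and3P[d4 d1 d2]; split=> f; first exact: hD1.
    move=> [fA1 _]; have d0 : (0 < d)%N by apply: leq_trans d4.
    apply: (near_ideal_intervals hqlow (adm d d0) _ e2 (hD2 _ d2 _ fA1)).
    by rewrite e0.
  move=> u; have [c [D [c0 hD]]] := inf_ratio_bounds gamma hL hLU hqlow adm.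
  split.
  + by apply: (@lt_le_trans _ _ c%:E); [rewrite lte_fin|
      apply: (@limn_einf_ge _ _ _ D) => n /hD/andP[]].
  + by apply: (@le_lt_trans _ _ (4^-1)%:E); [
      apply: (@limn_esup_le _ _ _ D) => n /hD/andP[]|exact: ltry].
  + move=> cp cl ct.
    have [l cl' ul] := cauchy_bounded_cvg hD
      (inf_ratio_cauchy gamma hL hLU hqlow adm cp cl ct).
    by exists l; split=> //; exact: lt_le_trans cl'.
- move=> d d0 f h [fA1 _] _; have /andP[E1 E2] := EQ_le d d0 f fA1.
  have d0' : 0 < d%:R :> R by rewrite ltr0n.
  have E0 : 0 < E_Q f by apply: lt_le_trans E1; exact: mulr_gt0.
  rewrite ler_pM2l// lef_pV2 ?posrE//; last exact: mulr_gt0.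
  by rewrite mulrC.
- move=> d d0 H h symH _ f _; rewrite -(E_Q_quad symH d0); congr (L / E_Q _).
Qed.
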